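(* Let $k\ge10$ be an integer, let $K\subset\mathbb R^3$ be a tetrahedron and let $b_K$ be its quartic bubble function. Then $$b_K^2\,\mathbb B^{2\mathrm{cott}}_{k-8}(K;\mathbb S\cap\mathbb T)\subset b_K\,\mathbb B^{1\mathrm{cott}}_{k-4}(K;\mathbb S\cap\mathbb T)\subset \mathbb B^{\mathrm{cott}}_{k}(K;\mathbb S\cap\mathbb T),$$ and the following three sequences are exact: $$0\to b_KP_{k-3}(K;\mathbb R^3)\xrightarrow{\operatorname{dev}\operatorname{def}}\mathbb B^{\mathrm{cott}}_k(K;\mathbb S\cap\mathbb T)\xrightarrow{\operatorname{cott}}\mathbb B^{\operatorname{div}}_{k-3}(K;\mathbb S\cap\mathbb T)\cap\ker(\operatorname{div})\xrightarrow{\operatorname{div}}0,$$ $$0\to b_K^2P_{k-7}(K;\mathbb R^3)\xrightarrow{\operatorname{dev}\operatorname{def}}b_K\mathbb B^{1\mathrm{cott}}_{k-4}(K;\mathbb S\cap\mathbb T)\xrightarrow{\operatorname{cott}}\mathbb B^{\operatorname{div}}_{k-3}(K;\mathbb S\cap\mathbb T)\cap\ker(\operatorname{div})\xrightarrow{\operatorname{div}}0,$$ $$0\to b_K^3P_{k-11}(K;\mathbb R^3)\xrightarrow{\operatorname{dev}\operatorname{def}}b_K^2\mathbb B^{2\mathrm{cott}}_{k-8}(K;\mathbb S\cap\mathbb T)\xrightarrow{\operatorname{cott}}\mathbb B^{\operatorname{div}}_{k-3}(K;\mathbb S\cap\mathbb T)\cap\ker(\operatorname{div})\xrightarrow{\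operatorname{div}}0.$$
   Context: $\mathbb S\cap\mathbb T$: real symmetric traceless $3\times 3$ matrices. $P_k(K;\mathbb X)$: $\mathbb X$-valued polynomials of degree $\le k$ on $K$ ($=\{0\}$ if $k<0$). $b_K=\lambda_0\lambda_1\lambda_2\lambda_3$ is the product of the barycentric coordinates of $K$. $\mathcal F(K)$: set of faces. Operators: $\operatorname{sym}U=\frac12(U+U^T)$, $\operatorname{dev}U=U-\frac13\operatorname{Tr}(U)\mathbf I$, $\operatorname{def}\boldsymbol u=\operatorname{sym}\nabla\boldsymbol u$; $\operatorname{div}$ and $\operatorname{curl}$ act row-wise on matrix fields. $S(U)=U^T-\operatorname{Tr}(U)\mathbf I$. $\operatorname{cott}U=\operatorname{curl}S^{-1}\operatorname{curl}S^{-1}\operatorname{curl}U$ (linearized Cotton–York operator); for symmetric traceless $\boldsymbol\sigma$ it equals $\operatorname{curl}\big((\operatorname{curl}(\operatorname{sym}\operatorname{curl}\boldsymbol\sigma))^T\big)$. For a vector $\boldsymbol a$, $\operatorname{mskw}(\boldsymbol a)$ is the skew matrix with $\operatorname{mskw}(\boldsymbol a)\boldsymbol b=\boldsymbol a\times\boldsymbol b$; $U\times\boldsymbol a:=U\operatorname{mskw}(\boldsymbol a)$. On a face $F$ with outward unit normal $\boldsymbol n$: $\Pi_F=\mathbf I-\boldsymbol n\boldsymbol n^T$, $\nabla_F=\Pi_F\nabla$, $\operatorname{def}_F\boldsymbol a=\frac12(\boldsymbol a\nabla_F^T+\nabla_F\boldsymbol a^T)$ (i.e. $(\boldsymbol a\nabla_F^T)_{ij}=(\nabla_F)_ja_i$),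 $\partial_n=\boldsymbol n\cdot\nabla$. The traces of a symmetric traceless field $\boldsymbol\sigma$ are $\operatorname{tr}_1^{\mathrm{cott}}(\boldsymbol\sigma)=\operatorname{sym}(\Pi_F\boldsymbol\sigma\times\boldsymbol n)$, $\operatorname{tr}_2^{\mathrm{cott}}(\boldsymbol\sigma)=\operatorname{sym}\big((2\operatorname{def}_F(\Pi_F\boldsymbol\sigma\boldsymbol n)-\Pi_F(\partial_n\boldsymbol\sigma)\Pi_F)\times\boldsymbol n\big)$, $\operatorname{tr}_3^{\mathrm{cott}}(\boldsymbol\sigma)=2\operatorname{def}_F(\Pi_F(\operatorname{sym}\operatorname{curl}\boldsymbol\sigma)\boldsymbol n)-\Pi_F\,\partial_n(\operatorname{sym}\operatorname{curl}\boldsymbol\sigma)\,\Pi_F$. Bubble spaces: $\mathbb B^{\operatorname{div}}_k(K;\mathbb S\cap\mathbb T)=\{\boldsymbol\sigma\in P_k(K;\mathbb S\cap\mathbb T):\boldsymbol\sigma\boldsymbol n|_F=0\ \forall F\in\mathcal F(K)\}$; $\mathbb B^{\mathrm{cott}}_k(K;\mathbb S\cap\mathbb T)=\{\boldsymbol\sigma\in P_k(K;\mathbb S\cap\mathbb T):\operatorname{tr}^{\mathrm{cott}}_i(\boldsymbol\sigma)|_F=0,\ i=1,2,3,\ \forall F\in\mathcal F(K)\}$; $\mathbb B^{1\mathrm{cott}}_{k-4}(K;\mathbb S\cap\mathbb T)=\{\boldsymbol\sigma\in P_{k-4}(K;\mathbb S\cap\mathbb T):b_K\boldsymbol\sigma\in\mathbb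 B^{\mathrm{cott}}_k(K;\mathbb S\cap\mathbb T)\}$; $\mathbb B^{2\mathrm{cott}}_{k-8}(K;\mathbb S\cap\mathbb T)=\{\boldsymbol\sigma\in P_{k-8}(K;\mathbb S\cap\mathbb T):b_K^2\boldsymbol\sigma\in\mathbb B^{\mathrm{cott}}_k(K;\mathbb S\cap\mathbb T)\}$. Exactness includes that each map takes values in the next space. *)

(* Defs.v *)
From HB Require Import structures.
From mathcomp Require Import all_boot all_order all_algebra.
From mathcomp Require Import boolp classical_sets reals.
From mathcomp Require Import mpoly.

Set Implicit Arguments.
Unset Strict Implicit.
Unset Printing Implicit Defensive.

Import Order.TTheory GRing.Theory Num.Theory.

Local Open Scope classical_set_scope.
Local Open Scope ring_scope.

(* Since K has nonempty interior, a polynomial field on K is the same as a    *)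
(* formal one: fields are matrices over {mpoly R[3]}, derivatives are formal, *)
(* and values are taken only when a field is restricted to a face.            *)
Notation vfield R := 'cV[{mpoly R[3]}]_3.
Notation mfield R := 'M[{mpoly R[3]}]_3.

Definition cst (R : realType) m n (A : 'M[R]_(m, n)) :
    'M[{mpoly R[3]}]_(m, n) := map_mx (@mpolyC 3 R) A.

(* Restriction to a set of points being zero. *)
Definition vanishes_on (R : realType) (A : set 'cV[R]_3) m n
    (U : 'M[{mpoly R[3]}]_(m, n)) : Prop :=
  forall x, A x -> map_mx (meval (fun l => x l 0)) U = 0.

Section Algebra.
Variable T : comNzRingType.

(* The indices in 'I_3 are added modulo 3. *)
Definition cross (a b : 'cV[T]_3) : 'cV[T]_3 :=
  \col_i (a (i + 1) 0 * b (i + 2) 0 - a (i + 2) 0 * b (i + 1) 0).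

Definition mskw (a : 'cV[T]_3) : 'M[T]_3 :=
  \matrix_(i, j) if j == i + 2 then a (i + 1) 0
                 else if j == i + 1 then - a (i + 2) 0 else 0.

Lemma mskwE a b : mskw a *m b = cross a b.
Proof.
apply/matrixP=> i j; rewrite (ord1 j) !mxE.
rewrite (bigD1 (i + 2)) //= (bigD1 (i + 1)) /=; last by case: i => -[|[|[]]].
rewrite big1 ?addr0 => [|l /andP[/negPf n2 /negPf n1]]; last first.
  by rewrite mxE n2 n1 mul0r.
rewrite !mxE !eqxx; case: eqP => [|_]; last by rewrite mulNr.
by case: i => -[|[|[]]].
Qed.

End Algebra.

Section Operators.
Variable R : realType.
Implicit Types (u : vfield R) (U : mfield R) (n : 'cV[R]_3).

Definition sym U : mfield R := (2^-1)%:MP *: (U + U^T).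

Definition dev U : mfield R := U - (3^-1)%:MP *: (\tr U)%:M.

Definition grad u : mfield R := \matrix_(i, j) (u i 0)^`M(j).

Definition symgrad u : mfield R := sym (grad u).

Definition devdef u : mfield R := dev (symgrad u).

Definition div U : vfield R := \col_i \sum_j (U i j)^`M(j).

(* Row-wise; as in [cross], indices are taken modulo 3. *)
Definition curl U : mfield R :=
  \matrix_(i, j) ((U i (j + 2))^`M(j + 1) - (U i (j + 1))^`M(j + 2)).

Definition opS U : mfield R := U^T - (\tr U)%:M.

Definition opSinv U : mfield R := U^T - (2^-1)%:MP *: (\tr U)%:M.

Lemma halfK (c : {mpoly R[3]}) : (2^-1)%:MP * (c *+ 2) = c.
Proof.
rewrite -[c *+ 2]mulr_natl mulrA -mpolyC_nat -mpolyCM mulVf ?pnatr_eq0 //.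
by rewrite mpolyC1 mul1r.
Qed.

Lemma opSK : cancel opS opSinv.
Proof.
move=> U; rewrite /opSinv /opS [in X in X - _]linearB /= trmxK tr_scalar_mx.
rewrite raddfB /= mxtrace_tr mxtrace_scalar scale_scalar_mx.
have -> : \tr U - \tr U *+ 3 = - (\tr U *+ 2).
  by rewrite mulrSr opprD addrCA subrr addr0.
by rewrite mulrN halfK raddfN /= opprK subrK.
Qed.

Lemma opSinvK : cancel opSinv opS.
Proof.
move=> U; rewrite /opSinv /opS scale_scalar_mx [in X in X - _]linearB /=.
rewrite trmxK tr_scalar_mx raddfB /= mxtrace_tr mxtrace_scalar.
set h := _ * \tr U.
have -> : \tr U - h *+ 3 = - h.
  by rewrite mulrSr opprD -mulrnAr halfK addrA subrr add0r.
by rewrite raddfN /= opprK subrK.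
Qed.

Definition mxcross U n : mfield R := U *m mskw (cst n).

Definition PiF n : mfield R := cst (1%:M - n *m n^T).

(* u nabla_F^T: the derivative index is the column, as in [grad]. *)
Definition gradF n u : mfield R :=
  \matrix_(i, j) \sum_l PiF n j l * (u i 0)^`M(l).

Definition defF n u : mfield R := (2^-1)%:MP *: (gradF n u + (gradF n u)^T).

Definition dnormal n U : mfield R := \sum_l (n l 0)%:MP *: map_mx (mderiv l) U.

Definition tr1cott n U : mfield R := sym (mxcross (PiF n *m U) n).

Definition tr2cott n U : mfield R :=
  sym (mxcross (2 *: defF n (PiF n *m U *m cst n)
                - PiF n *m dnormal n U *m PiF n) n).

Definition tr3cott n U : mfield R :=
  2 *: defF n (PiF n *m sym (curl U) *m cst n)
  - PiF n *m dnormal n (sym (curl U)) *m PiF n.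

Definition cott U : mfield R := curl (opSinv (curl (opSinv (curl U)))).

End Operators.

Section Tetrahedron.
Variables (R : realType) (v : 'I_4 -> 'cV[R]_3).

Definition affinely_independent : Prop :=
  forall t : 'I_4 -> R, \sum_i t i = 0 -> \sum_i t i *: v i = 0 ->
  forall i, t i = 0.

(* Row i is (1, v_i); since (1, x) = (lambda_0(x), ..., lambda_3(x)) *m vtx,   *)
(* column i of its inverse lists the coefficients of lambda_i.                *)
Definition vtx : 'M[R]_4 :=
  \matrix_(i, j) if unlift ord0 j is Some l then v i l 0 else 1.

Definition gradbary (i : 'I_4) : 'cV[R]_3 :=
  \col_l invmx vtx (lift ord0 l) i.

Definition bary (i : 'I_4) : {mpoly R[3]} :=
  (invmx vtx ord0 i)%:MP + \sum_l gradbary i l 0 *: 'X_l.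

Definition bubble : {mpoly R[3]} := \prod_i bary i.

(* The face opposite to the vertex v_i. *)
Definition face (i : 'I_4) : set 'cV[R]_3 :=
  [set x | exists t : 'I_4 -> R,
     [/\ forall j, 0 <= t j, \sum_j t j = 1, t i = 0
       & x = \sum_j t j *: v j]].

(* lambda_i vanishes on the face i and is positive inside, so its gradient is *)
(* an inward normal there.                                                    *)
Definition normal (i : 'I_4) : 'cV[R]_3 :=
  - (Num.sqrt (\sum_l gradbary i l 0 ^+ 2))^-1 *: gradbary i.

Lemma vtx_unit : affinely_independent -> vtx \in unitmx.
Proof.
move=> vI; rewrite -row_free_unit -kermx_eq0; apply/eqP/row_matrixP => i.
rewrite row0; have : row i (kermx vtx) *m vtx = 0.
  by apply/sub_kermxP; rewrite row_sub.
move: (row i _) => t tV; apply/rowP => j; rewrite mxE; apply: (vI (t 0)).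
  move/matrixP/(_ 0 ord0): tV; rewrite !mxE => tV; rewrite -[RHS]tV.
  by apply: eq_bigr => l _; rewrite mxE unlift_none mulr1.
apply/matrixP => l m; rewrite (ord1 m) summxE.
move/matrixP/(_ 0 (lift ord0 l)): tV; rewrite !mxE => tV; rewrite -[RHS]tV.
by apply: eq_bigr => h _; rewrite !mxE liftK.
Qed.

Lemma baryE (x : 'cV[R]_3) i :
  (bary i).@[fun l => x l 0] =
  invmx vtx ord0 i + \sum_l gradbary i l 0 * x l 0.
Proof.
rewrite /bary mevalD mevalC raddf_sum /=; congr +%R.
by apply: eq_bigr => l _; rewrite mevalZ mevalXU.
Qed.

Lemma bary_vtx i j :
  affinely_independent -> (bary i).@[fun l => v j l 0] = (j == i)%:R.
Proof.
move=> vI; have /matrixP/(_ j i) := mulmxV (vtx_unit vI).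
rewrite baryE !mxE big_ord_recl !mxE unlift_none mul1r => <-; congr +%R.
by apply: eq_bigr => l _; rewrite !mxE liftK mulrC.
Qed.

Lemma gradbaryB i j k : affinely_independent ->
  \sum_l gradbary i l 0 * (v j - v k) l 0 = (j == i)%:R - (k == i)%:R.
Proof.
move=> vI; rewrite -!(bary_vtx _ _ vI) !baryE opprD addrACA subrr add0r.
by rewrite -sumrB; apply: eq_bigr => l _; rewrite !mxE mulrBr.
Qed.

Lemma normalP i : affinely_independent ->
  [/\ \sum_l normal i l 0 ^+ 2 = 1,
      forall j k, j != i -> k != i ->
        \sum_l normal i l 0 * (v j - v k) l 0 = 0
    & forall j, j != i -> \sum_l normal i l 0 * (v i - v j) l 0 < 0].
Proof.
move=> vI; set s := \sum_l gradbary i l 0 ^+ 2.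
have s0 : 0 < s.
  have ss : 0 <= s by apply: sumr_ge0 => l _; exact: sqr_ge0.
  rewrite lt_neqAle ss andbT eq_sym; apply/eqP => /eqP.
  rewrite psumr_eq0 => [/allP g0|l _]; last exact: sqr_ge0.
  have [j ji] : exists j, j != i by exists (i + 1); case: i {s ss g0} => -[|[|[|[|]]]].
  have := gradbaryB i i j vI; rewrite eqxx (negPf ji) subr0 big1 => [/eqP|l _].
    by rewrite eq_sym oner_eq0.
  have := g0 l (mem_index_enum _); rewrite sqrf_eq0 => /eqP ->.
  by rewrite mul0r.
have nE x : \sum_l normal i l 0 * x l 0
    = - (Num.sqrt s)^-1 * \sum_l gradbary i l 0 * x l 0.
  by rewrite mulr_sumr; apply: eq_bigr => l _; rewrite mxE mulrA.
split=> [|j k ji ki|j ji].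
- under eq_bigr do rewrite mxE exprMn.
  by rewrite -mulr_sumr sqrrN exprVn sqr_sqrtr ?ltW// mulVf// gt_eqF.
- by rewrite nE gradbaryB// (negPf ji) (negPf ki) subr0 mulr0.
- by rewrite nE gradbaryB// eqxx (negPf ji) subr0 mulr1 oppr_lt0 invr_gt0
    sqrtr_gt0.
Qed.

End Tetrahedron.

Section Spaces.
Variable R : realType.

(* The degree bound d may be negative, in which case only 0 qualifies; recall *)
(* that msize is the degree plus one, and msize 0 = 0.                        *)
Definition degree_le (d : int) (p : {mpoly R[3]}) : bool :=
  if d is Posz n then (msize p <= n.+1)%N else p == 0.

Definition Pvec (d : int) : set (vfield R) :=
  [set u : vfield R | forall i, degree_le d (u i 0)].

Definition PST (d : int) : set (mfield R) :=
  [set U : mfield R | [/\ forall i j, degree_le d (U i j), U^T = U & \tr U = 0]].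

Variable v : 'I_4 -> 'cV[R]_3.

Definition Bdiv (d : int) : set (mfield R) :=
  PST d `&`
  [set U : mfield R | forall i, vanishes_on (face v i) (U *m cst (normal v i))].

Definition Bcott (d : int) : set (mfield R) :=
  PST d `&`
  [set U : mfield R | forall i,
     [/\ vanishes_on (face v i) (tr1cott (normal v i) U),
         vanishes_on (face v i) (tr2cott (normal v i) U)
       & vanishes_on (face v i) (tr3cott (normal v i) U)]].

(* B1cott and B2cott are indexed by the degree of their elements, so the      *)
(* products lie in degree d + 4 and d + 8.                                    *)
Definition B1cott (d : int) : set (mfield R) :=
  PST d `&` [set U : mfield R | Bcott (d + 4) (bubble v *: U)].

Definition B2cott (d : int) : set (mfield R) :=
  PST d `&` [set U : mfield R | Bcott (d + 8) (bubble v ^+ 2 *: U)].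

Definition scale_set m n (q : {mpoly R[3]}) (A : set 'M[{mpoly R[3]}]_(m, n)) :
  set 'M[{mpoly R[3]}]_(m, n) := [set q *: U | U in A].

Definition kernel (V W : zmodType) (f : V -> W) : set V := [set x | f x = 0].

(* Exactness of 0 -> A -f-> B -g-> C -h-> 0, node by node. *)
Definition exact_sequence (V1 V2 V3 V4 : zmodType) (A : set V1) (f : V1 -> V2)
    (B : set V2) (g : V2 -> V3) (C : set V3) (h : V3 -> V4) : Prop :=
  [/\ A `&` kernel f = [set 0], f @` A = B `&` kernel g,
      g @` B = C `&` kernel h & h @` C = [set 0]].

End Spaces.

(* Main.v *)
Require Import Defs.
From HB Require Import structures.
From mathcomp Require Import all_boot all_order all_algebra.
From mathcomp Require Import boolp classical_sets reals.
From mathcomp Require Import mpoly ring lra zify.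

Set Implicit Arguments.
Unset Strict Implicit.
Unset Printing Implicit Defensive.
Import Order.TTheory GRing.Theory Num.Theory.
Local Open Scope classical_set_scope.
Local Open Scope ring_scope.

(** Everything is algebraic: a polynomial vanishes on the face opposite to [v i] exactly
    when it is a multiple of [bary v i] ([face_vanishP]), so boundary conditions are
    divisibility conditions. The ideals of the faces and edges are prime, being the
    kernels of projections along edges of the tetrahedron, and this is what allows one
    to divide by the other barycentric coordinates.

    The three traces of a symmetric traceless field vanish on a face, with coordinate
    [l], exactly when the field is [devdef (l *: u) + l ^+ 3 *: Z] ([traces_vanishP]):
    each trace controls one more order in [l], by killing the tangential part of the
    remainder, and the normal part of a symmetric traceless field is the leading term of
    the conformal strain of a displacement. Since [cott] annihilates conformal strains
    and takes three curls, such a field is mapped to one without normal trace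
    ([cott_cube_normal]). The three spaces of bubbles become the fields of this form
    divisible by [b ^+ m] for [m = 0], [1], [2], and the three sequences are treated
    together ([bubbles_exact]); the inclusions are then clear.

    Exactness at the second node. If [cott U = 0] then [U = devdef u] with [u] polynomial
    ([cott_free_devdef]): one undoes the three curls. On a face,
    [devdef (u - l *: z)] vanishes to third order, and because [devdef] is of finite
    type, with all second derivatives of the dilation determined by the strain, [u]
    agrees on the face with a conformal Killing field ([killing_of_strain]). The four
    Killing fields agree on the edges; their differences are rotations about the edges,
    and rotations about the three edges at a vertex are independent, so they coincide
    ([killing_agree]). Hence [u] is a Killing field plus [b *: w]. If [devdef (b *: w)]
    is divisible by [b ^+ m], so is [w], because the leading term of the strain is a dyad
    of the displacement with the gradient of [b] ([strain_order_exp]). Injectivity of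
    [devdef] holds because Killing fields have degree at most two and [b] has degree four.

    Surjectivity of [cott]. A symmetric traceless field without normal trace vanishes on
    the edges, since there two independent vectors are in its kernel and its trace
    vanishes ([sym_traceless_edge_free]). A divergence-free vector field without normal
    trace that vanishes on the edges is the curl of a multiple of [b]
    ([bubble_potential]), and the curl of a multiple of [b ^+ 2] if it is itself a
    multiple of [b] with quotient vanishing on the edges ([bubble2_potential]). Inverting
    the three curls of [cott] in this way gives [U = cott (b ^+ 2 *: D)]. On each face
    the symmetric traceless part of [D] is a dyad with the normal
    ([cott_potential_face]), so [b ^+ 2 *: devsym D] is to third order a conformal strain,
    and already the smallest of the three spaces maps onto the target. *)

(** * Polynomials in three variables *)

Section Coordinates.
Variable R : realType.
Implicit Types (p f g : {mpoly R[3]}) (i j l : 'I_3).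

Lemma ord3D : ((0 + 1 = 1 :> 'I_3)%R * (1 + 1 = 2 :> 'I_3)%R *
  (2 + 1 = 0 :> 'I_3)%R * (0 + 2 = 2 :> 'I_3)%R * (1 + 2 = 0 :> 'I_3)%R *
  (2 + 2 = 1 :> 'I_3)%R)%type.
Proof. by do ?split; apply/val_inj. Qed.

Lemma ord3_eq : (((0 == 1 :> 'I_3)%R = false) * ((0 == 2 :> 'I_3)%R = false) *
  ((1 == 0 :> 'I_3)%R = false) * ((1 == 2 :> 'I_3)%R = false) *
  ((2 == 0 :> 'I_3)%R = false) * ((2 == 1 :> 'I_3)%R = false))%type.
Proof. by []. Qed.

Lemma ord3_ind (Q : 'I_3 -> Prop) : Q 0 -> Q 1 -> Q 2 -> forall i, Q i.
Proof.
move=> Q0 Q1 Q2 [[|[|[|//]]] hi].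
- by rewrite (_ : Ordinal hi = 0) //; apply/val_inj.
- by rewrite (_ : Ordinal hi = 1) //; apply/val_inj.
- by rewrite (_ : Ordinal hi = 2) //; apply/val_inj.
Qed.

Lemma sum3 (V : nmodType) (F : 'I_3 -> V) : \sum_i F i = F 0 + F 1 + F 2.
Proof.
rewrite !big_ord_recl big_ord0 addr0 addrA.
by congr (_ + _ + _); congr F; apply/val_inj.
Qed.

Lemma msize_leP p d :
  (forall m : 'X_{1..3}, (d <= mdeg m)%N -> p@_m = 0) -> (msize p <= d)%N.
Proof.
move=> p0; rewrite msizeE; apply/bigmax_leqP_seq => m; rewrite mcoeff_msupp => pm _.
by rewrite ltnNge; apply: contra pm => /p0 ->.
Qed.

Lemma mcoeff_msize p (m : 'X_{1..3}) : (msize p <= mdeg m)%N -> p@_m = 0.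
Proof. by move/msize_mdeg_ge/memN_msupp_eq0. Qed.

Lemma msize_leD d p q :
  (msize p <= d -> msize q <= d -> msize (p + q)%R <= d)%N.
Proof.
move=> pd qd; apply: leq_trans (mmeasureD_le _ _ _) _.
by rewrite geq_max pd.
Qed.

Lemma msize_leN d p : (msize p <= d -> msize (- p)%R <= d)%N.
Proof. by rewrite mmeasureN. Qed.

Lemma msize_leB d p q :
  (msize p <= d -> msize q <= d -> msize (p - q)%R <= d)%N.
Proof. by move=> pd qd; apply: msize_leD; rewrite ?mmeasureN. Qed.

Lemma msize_le_sum d (I : Type) (r : seq I) (Q : pred I) (F : I -> {mpoly R[3]}) :
  (forall x, Q x -> msize (F x) <= d)%N -> (msize (\sum_(x <- r | Q x) F x)%R <= d)%N.
Proof.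
move=> Fd; elim/big_ind: _ => //; first by rewrite msize0.
exact: msize_leD.
Qed.

Lemma msize_leM d e p q :
  (msize p <= d.+1 -> msize q <= e -> msize (p * q)%R <= d + e)%N.
Proof.
move=> pd qe; have [->|p0] := eqVneq p 0; first by rewrite mul0r msize0.
have [->|q0] := eqVneq q 0; first by rewrite mulr0 msize0.
by rewrite msizeM // -subn1 leq_subLR addnA add1n; exact: leq_add.
Qed.

Lemma msize_leC c : (msize (c%:MP : {mpoly R[3]}) <= 1)%N.
Proof. by rewrite msizeC; case: eqP. Qed.

Lemma msize_leMC d c p : (msize p <= d -> msize (c%:MP * p)%R <= d)%N.
Proof. by move/(@msize_leM 0 d c%:MP p (msize_leC c)). Qed.

Lemma msize_leZ d c p : (msize p <= d -> msize (c *: p)%R <= d)%N.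
Proof. by rewrite -mul_mpolyC; exact: msize_leMC. Qed.

Lemma msize_deriv d l p : (msize p <= d -> msize p^`M(l) <= d.-1)%N.
Proof.
move=> pd; apply: msize_leP => m md; rewrite mcoeff_mderiv mcoeff_msize ?mul0rn //.
by rewrite mdegD mdeg1; apply: leq_trans pd _; lia.
Qed.

Lemma msize_divl d e p q : (d < msize p -> msize (p * q)%R <= d + e -> msize q <= e)%N.
Proof.
move=> pd; have [->|q0] := eqVneq q 0; first by rewrite msize0.
have p0 : p != 0 by apply: contraTneq pd => ->; rewrite msize0.
rewrite msizeM //; move: (msize p) (msize q) pd => x y; lia.
Qed.

Lemma mpoly_fun_ind (Q : {mpoly R[3]} -> Prop) :
  (forall c, Q c%:MP) -> (forall l, Q 'X_l) ->
  (forall f g, Q f -> Q g -> Q (f + g)) ->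
  (forall f g, Q f -> Q g -> Q (f * g)) -> forall f, Q f.
Proof.
move=> QC QX QD QM f; elim/mpolyind: f => [|c m f _ _ Qf]; first exact: (QC 0).
apply: QD => //; rewrite -mul_mpolyC; apply: (QM) => //.
rewrite mpolyXE_id; apply: (big_ind Q) => [|//|l _]; first exact: (QC 1).
by elim: (m l) => [|k Qk]; rewrite ?expr0 ?exprS; [exact: (QC 1)|exact: QM].
Qed.

Lemma mderivXU i j : ('X_j : {mpoly R[3]})^`M(i) = (i == j)%:R.
Proof.
apply/mpolyP => m; rewrite mcoeff_mderiv mcoeffX -mpolyC_nat mcoeffC.
have [->|ij] := eqVneq i j; last first.
  rewrite mul0r; case: eqP => [|_]; last by rewrite mul0rn.
  by move/mnmP/(_ i); rewrite !mnmE eqxx eq_sym (negPf ij) addn1.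
rewrite -[X in X == _]add0m eqm_add2r eq_sym; case: eqP => [->|_]; last by rewrite mul0rn mulr0.
by rewrite mnmE mulr1.
Qed.

Lemma deriv0_const f : (forall l, f^`M(l) = 0) -> f = (f@_0%MM)%:MP.
Proof.
move=> df; apply/mpolyP => m; rewrite mcoeffC.
have [->|m0] := eqVneq m 0%MM; first by rewrite mulr1.
rewrite mulr0.
have [l ml] : exists l, m l != 0%N.
  apply/existsP; rewrite -negb_forall; apply: contra m0 => /forallP h.
  by apply/eqP/mnmP => l; rewrite mnmE; apply/eqP/h.
have /mpolyP/(_ (m - U_(l))%MM) := df l; rewrite mcoeff_mderiv mcoeff0 submK; last first.
  by apply/mnm_lepP => k; rewrite mnm1E; case: eqP => [<-|//]; rewrite lt0n.
by move/eqP; rewrite mulrn_eq0 /= => /eqP.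
Qed.

End Coordinates.

(** * The Euler operator at a base point *)

Section Euler.
Variables (R : realType) (a : 'cV[R]_3).
Implicit Types (p f g : {mpoly R[3]}) (i j l : 'I_3).

Definition shift l : {mpoly R[3]} := 'X_l - (a l 0)%:MP.

Definition euler f : {mpoly R[3]} := \sum_l shift l * f^`M(l).

Lemma deriv_shift i l : (shift l)^`M(i) = (i == l)%:R.
Proof. by rewrite mderivB mderivC subr0 mderivXU. Qed.

Lemma msize_shift l : (msize (shift l) <= 2)%N.
Proof.
apply: msize_leB; first by rewrite msizeX mdeg1.
exact: leq_trans (msize_leC _) _.
Qed.

Lemma eulerD f g : euler (f + g) = euler f + euler g.
Proof. by rewrite /euler !sum3 !mderivD; ring. Qed.

Lemma eulerC c : euler c%:MP = 0.
Proof. by rewrite /euler !sum3 !mderivC; ring. Qed.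

Lemma eulerM f g : euler (f * g) = euler f * g + f * euler g.
Proof. by rewrite /euler !sum3 !mderivM; ring. Qed.

Lemma eulerB f g : euler (f - g) = euler f - euler g.
Proof. by rewrite /euler !sum3 !mderivB; ring. Qed.

Lemma deriv_euler i f : (euler f)^`M(i) = euler f^`M(i) + f^`M(i).
Proof.
rewrite /euler !sum3 !mderivD !mderivM !deriv_shift !(mderiv_comm i).
move: i; apply: ord3_ind; rewrite !ord3_eq !eqxx /=; ring.
Qed.

Lemma eulerX_origin (m : 'X_{1..3}) :
  \sum_l 'X_l * ('X_[R, m])^`M(l) = (mdeg m)%:R *: 'X_[m].
Proof.
rewrite mdegE natr_sum scaler_suml; apply: eq_bigr => l _.
rewrite mderivX -scalerAr; have [->|ml] := eqVneq (m l) 0%N; first by rewrite !scale0r.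
rewrite -mpolyXD addmC submK //.
by apply/mnm_lepP => k; rewrite mnm1E; case: eqP => [<-|//]; rewrite lt0n.
Qed.

Lemma euler_solve_origin m f : exists2 g : {mpoly R[3]},
  \sum_l 'X_l * g^`M(l) + m.+1%:R *: g = f & (msize g <= msize f)%N.
Proof.
pose c (e : 'X_{1..3}) := f@_e / (mdeg e + m.+1)%:R.
exists (\sum_(e <- msupp f) c e *: 'X_[e]); last first.
  rewrite big_seq; apply: msize_le_sum => e ef; apply: msize_leZ.
  by rewrite msizeX; exact: msize_mdeg_lt.
rewrite [RHS]mpolyE -[X in X + _](_ : \sum_(e <- msupp f) (c e * (mdeg e)%:R) *: 'X_[e] = _); last first.
  transitivity (\sum_(e <- msupp f) c e *: \sum_l 'X_l * ('X_[R, e])^`M(l)).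
    by apply: eq_bigr => e _; rewrite eulerX_origin scalerA.
  under eq_bigr => e _ do rewrite scaler_sumr.
  rewrite exchange_big; apply: eq_bigr => l _ /=.
  rewrite raddf_sum /= mulr_sumr; apply: eq_bigr => e _.
  by rewrite mderivZ scalerAr.
rewrite scaler_sumr -big_split; apply: eq_bigr => e _ /=.
rewrite scalerA -scalerDl; congr (_ *: _).
rewrite [_ * c e]mulrC -mulrDr -natrD /c divfK //.
by rewrite pnatr_eq0 addnS.
Qed.

(** At the origin the operator is diagonal in the monomials with positive eigenvalues;
    moving the base point perturbs it by first derivatives, which lower the degree. *)
Lemma euler_solve m f : exists2 g : {mpoly R[3]},
  euler g + m.+1%:R *: g = f & (msize g <= msize f)%N.
Proof.
suff H n : forall f, (msize f <= n)%N -> exists2 g : {mpoly R[3]},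
    euler g + m.+1%:R *: g = f & (msize g <= n)%N by exact: H.
elim: n => [|n IH] {}f fn.
  exists 0; last by rewrite msize0.
  move: fn; rewrite leqn0 msize_poly_eq0 => /eqP ->.
  by rewrite -mpolyC0 eulerC mpolyC0 scaler0 addr0.
have [g0 g0E g0f] := euler_solve_origin m f.
have g0n := leq_trans g0f fn.
have [g1 g1E g1n] : exists2 g1 : {mpoly R[3]},
    euler g1 + m.+1%:R *: g1 = \sum_l (a l 0)%:MP * g0^`M(l) & (msize g1 <= n)%N.
  apply: IH; apply: msize_le_sum => l _; apply: msize_leMC.
  by have := msize_deriv l g0n.
exists (g0 + g1); last by apply: msize_leD => //; exact: leqW.
rewrite eulerD scalerDr addrACA g1E -g0E /euler addrAC -big_split /=.
by congr (_ + _); apply: eq_bigr => l _; rewrite /shift; ring.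
Qed.

Lemma euler_inj m f : euler f + m.+1%:R *: f = 0 -> f = 0.
Proof.
suff H n : forall m f, (msize f <= n)%N -> euler f + m.+1%:R *: f = 0 -> f = 0 by exact: H.
elim: n => [|n IH] {}m {}f fn fE.
  by apply/eqP; rewrite -msize_poly_eq0 -leqn0.
have df l : f^`M(l) = 0.
  apply: (IH m.+1); first exact: (msize_deriv l fn).
  have := congr1 (mderiv l) fE; rewrite mderivD mderivZ deriv_euler mderiv0 => <-.
  by rewrite -addrA; congr (_ + _); rewrite -[in RHS](scale1r f^`M(l)) scalerA -scalerDl mulr1 nat1r.
move: fE; rewrite /euler big1 => [|l _]; last by rewrite df mulr0.
by rewrite add0r => /eqP; rewrite scaler_eq0 pnatr_eq0 => /eqP.
Qed.

Lemma euler0_const f : euler f = 0 -> f = (f@_0%MM)%:MP.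
Proof.
move=> fE; apply: deriv0_const => l; apply: (@euler_inj 0).
by rewrite scale1r -deriv_euler fE mderiv0.
Qed.

End Euler.

(** * Cross products over a commutative ring *)

Section CrossProduct.
Variable T : comNzRingType.
Implicit Types (a c x y z : 'cV[T]_3) (p q : T).

Lemma crossDr x y z : cross x (y + z) = cross x y + cross x z.
Proof. by apply/matrixP => i j; rewrite !mxE; ring. Qed.

Lemma crossB x y z : cross x (y - z) = cross x y - cross x z.
Proof. by apply/matrixP => i j; rewrite !mxE; ring. Qed.

Lemma crossDl x y z : cross (x + y) z = cross x z + cross y z.
Proof. by apply/matrixP => i j; rewrite !mxE; ring. Qed.

Lemma crossZ p x y : cross x (p *: y) = p *: cross x y.
Proof. by apply/matrixP => i j; rewrite !mxE; ring. Qed.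

Lemma crossZl p x y : cross (p *: x) y = p *: cross x y.
Proof. by apply/matrixP => i j; rewrite !mxE; ring. Qed.

(** The fields that [curl_bubble_edge_free] crosses are the gradient of the bubble
    [A * A' * B] and a field without tangential trace, both expanded about the edge
    [A = A' = 0]; the product is divisible by [A * A'], and the quotient is explicit. *)
Lemma cross_on_edge (A A' B p p' : T) a a' c z l :
  cross ((A' * B) *: a + (A * B) *: a' + (A * A') *: c)
        ((A' * B * p) *: a + (A * B * p') *: a' + (A * A') *: z) l 0 =
  A * A' * (B * (B * (p' - p)) * cross a a' l 0
    + A' * (B * cross a z l 0 + B * p * cross c a l 0)
    + A * (B * cross a' z l 0 + B * p' * cross c a' l 0)
    + A * A' * cross c z l 0).
Proof. by rewrite !mxE; ring. Qed.

(** Restriction to the edge of the quotient found in [cross_on_edge]: it is [B] times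
    the curl there, by the formula for the curl on an edge. *)
Lemma rmorph_edge (rho : {rmorphism T -> T}) (A A' B p p' ca cb s t u r k cy : T) :
  rho A = 0 -> rho A' = 0 -> rho k = k ->
  rho cy = rho B * rho (p' - p) * k ->
  rho (B * cy - (B * (B * (p' - p)) * k
    + A' * (B * ca + B * p * cb) + A * (B * s + B * p' * t) + A * A' * u)) = 0.
Proof.
move=> A0 A'0 kE cE.
by rewrite !(rmorphB, rmorphD, rmorphM) cE A0 A'0 kE !rmorphB; ring.
Qed.

End CrossProduct.

(** * Ideals generated by one or two polynomials *)

Section Ideals.
Variable R : realType.
Implicit Types (p q f g h : {mpoly R[3]}) (a : 'cV[R]_3).

Definition ev a p : R := p.@[fun l => a l 0].

Definition multiple g p : Prop := exists q, p = g * q.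

Definition ideal2 g h p : Prop := exists q r, p = g * q + h * r.

Lemma multiple_ideal2 g p : multiple g p <-> ideal2 g 0 p.
Proof.
split=> [[q ->]|[q [r ->]]]; last by exists q; rewrite mul0r addr0.
by exists q, 0; rewrite mul0r addr0.
Qed.

Lemma multiple0 g : multiple g 0.
Proof. by exists 0; rewrite mulr0. Qed.

Lemma multipleD g p q : multiple g p -> multiple g q -> multiple g (p + q).
Proof. by move=> [p' ->] [q' ->]; exists (p' + q'); rewrite mulrDr. Qed.

Lemma multipleMl g p q : multiple g p -> multiple g (q * p).
Proof. by move=> [p' ->]; exists (q * p'); rewrite mulrCA. Qed.

Lemma multipleN g p : multiple g p -> multiple g (- p).
Proof. by move=> [p' ->]; exists (- p'); rewrite mulrN. Qed.

Lemma multipleB g p q : multiple g p -> multiple g q -> multiple g (p - q).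
Proof. by move=> pg qg; apply: multipleD => //; exact: multipleN. Qed.

Lemma multiple_sum g (I : Type) (r : seq I) (Q : pred I) (F : I -> {mpoly R[3]}) :
  (forall x, Q x -> multiple g (F x)) -> multiple g (\sum_(x <- r | Q x) F x).
Proof.
by move=> Fg; elim/big_ind: _ => //; [exact: multiple0|exact: multipleD].
Qed.

Lemma multiple_refl g q : multiple g (g * q).
Proof. by exists q. Qed.

Lemma ev_shift a l : ev a (shift a l) = 0.
Proof. by rewrite /ev mevalB mevalXU mevalC subrr. Qed.

Lemma ev_euler a f : ev a (euler a f) = 0.
Proof.
rewrite /ev /euler raddf_sum big1 // => l _ /=.
by rewrite mevalM [X in X * _]ev_shift mul0r.
Qed.

Lemma evC a c : ev a c%:MP = c. Proof. exact: mevalC. Qed.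

(** The generators are homogeneous of degree one at the base point, so that
    [euler (g * q) = g * (euler q + q)], and [euler + 1] is onto. *)
Lemma euler_ideal2 a g h f : euler a g = g -> euler a h = h ->
  ideal2 g h (euler a f) -> ideal2 g h (f - (ev a f)%:MP).
Proof.
move=> gE hE [q [r fE]].
have [q' q'E _] := euler_solve a 0 q; have [r' r'E _] := euler_solve a 0 r.
rewrite !scale1r in q'E r'E; exists q', r'.
have s0 : euler a (f - (g * q' + h * r')) = 0.
  by rewrite eulerB eulerD !eulerM fE gE hE -q'E -r'E; ring.
have g0 : ev a g = 0 by rewrite -gE ev_euler.
have h0 : ev a h = 0 by rewrite -hE ev_euler.
have := euler0_const s0; set c := _@_0%MM => fc.
have -> : f = c%:MP + (g * q' + h * r') by rewrite -fc subrK.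
rewrite /ev !(mevalD, mevalM) -/(ev a g) -/(ev a h) g0 h0 !mul0r !addr0 mevalC.
by rewrite addrAC subrr add0r.
Qed.

Lemma euler_multiple a g f : euler a g = g ->
  multiple g (euler a f) -> multiple g (f - (ev a f)%:MP).
Proof.
move=> gE /multiple_ideal2 fg; apply/multiple_ideal2; apply: euler_ideal2 fg => //.
by rewrite -mpolyC0 eulerC.
Qed.

(** By the previous lemma, since the radial derivative is a combination of the
    partial derivatives. With [g = 0] it says that a function with zero gradient is
    constant, so that exact and approximate statements have a common proof. *)
Lemma grad_multiple a g f : euler a g = g ->
  (forall l, multiple g f^`M(l)) -> multiple g (f - (ev a f)%:MP).
Proof.
move=> gE df; apply: euler_multiple => //.
by apply: multiple_sum => l _; exact: multipleMl.
Qed.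

End Ideals.

(** * Vector calculus and radial potentials *)

Section VectorCalculus.
Variable R : realType.
Implicit Types (f g : {mpoly R[3]}) (v w : vfield R) (a c : 'cV[R]_3) (d : nat).

Definition vec f0 f1 f2 : vfield R :=
  \col_i (if i == 0 then f0 else if i == 1 then f1 else f2).

Definition gradv f : vfield R := \col_l f^`M(l).

Definition curlv v : vfield R :=
  \col_i ((v (i + 2) 0)^`M(i + 1) - (v (i + 1) 0)^`M(i + 2)).

Definition divv v : {mpoly R[3]} := \sum_l (v l 0)^`M(l).

Definition position a : vfield R := \col_l shift a l.

Definition dot v w : {mpoly R[3]} := \sum_l v l 0 * w l 0.

Definition vmsize_le d v := forall l, (msize (v l 0%R) <= d)%N.

Lemma entryD m n (A B : 'M[{mpoly R[3]}]_(m, n)) i j : (A + B) i j = A i j + B i j.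
Proof. by rewrite mxE. Qed.

Lemma entryN m n (A : 'M[{mpoly R[3]}]_(m, n)) i j : (- A) i j = - A i j.
Proof. by rewrite mxE. Qed.

Lemma entryZ m n p (A : 'M[{mpoly R[3]}]_(m, n)) i j : (p *: A) i j = p * A i j.
Proof. by rewrite mxE. Qed.

Lemma entry0 m n i j : (0 : 'M[{mpoly R[3]}]_(m, n)) i j = 0.
Proof. by rewrite mxE. Qed.

Lemma entryC m n (A : 'M[R]_(m, n)) i j : cst A i j = (A i j)%:MP.
Proof. by rewrite mxE. Qed.

Lemma entry_cross v w i j : cross v w i j =
  v (i + 1) 0 * w (i + 2) 0 - v (i + 2) 0 * w (i + 1) 0.
Proof. by rewrite mxE. Qed.

Lemma entry_grad f i j : gradv f i j = f^`M(i).
Proof. by rewrite mxE. Qed.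

Lemma entry_curl v i j : curlv v i j =
  (v (i + 2) 0)^`M(i + 1) - (v (i + 1) 0)^`M(i + 2).
Proof. by rewrite mxE. Qed.

Lemma entry_position a i j : position a i j = shift a i.
Proof. by rewrite mxE. Qed.

(** Entrywise evaluation that, unlike [mxE], does not unfold the data. *)
Definition entryE := (entryD, entryN, entryZ, entry0, entryC, entry_cross,
  entry_grad, entry_curl, entry_position).

Lemma vec3P v w : v 0 0 = w 0 0 -> v 1 0 = w 1 0 -> v 2 0 = w 2 0 -> v = w.
Proof.
by move=> e0 e1 e2; apply/matrixP => i j; rewrite (ord1 j); move: i; apply: ord3_ind.
Qed.

Lemma curlv_grad f : curlv (gradv f) = 0.
Proof.
by apply/matrixP => i j; rewrite !mxE mderiv_comm subrr.
Qed.

Lemma divv_curl v : divv (curlv v) = 0.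
Proof.
rewrite /divv sum3 !mxE !ord3D !mderivB (mderiv_comm 1 0) (mderiv_comm 2 0) (mderiv_comm 2 1).
ring.
Qed.

Lemma curlvB v w : curlv (v - w) = curlv v - curlv w.
Proof. by apply/matrixP => i j; rewrite !mxE !mderivB; ring. Qed.

Lemma curlvM f v : curlv (f *: v) = cross (gradv f) v + f *: curlv v.
Proof. by apply/matrixP => i j; rewrite !mxE !mderivM; ring. Qed.

Lemma gradvM f g : gradv (f * g) = g *: gradv f + f *: gradv g.
Proof. by apply/matrixP => i j; rewrite !mxE !mderivM; ring. Qed.

Lemma gradvB f g : gradv (f - g) = gradv f - gradv g.
Proof. by apply/matrixP => i j; rewrite !mxE !mderivB. Qed.

Lemma solve_vec a m v d : vmsize_le d v -> exists2 w : vfield R,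
  vmsize_le d w & forall i, euler a (w i 0) + m.+1%:R *: w i 0 = v i 0.
Proof.
move=> vd.
have [w0 e0 s0] := euler_solve a m (v 0 0); have [w1 e1 s1] := euler_solve a m (v 1 0).
have [w2 e2 s2] := euler_solve a m (v 2 0).
exists (vec w0 w1 w2); apply: ord3_ind; rewrite mxE ?ord3_eq ?eqxx //.
- exact: leq_trans s0 (vd 0).
- exact: leq_trans s1 (vd 1).
- exact: leq_trans s2 (vd 2).
Qed.

(** The Koszul homotopy at the base point [a]: the radial potential [phi] of [v]
    recovers [v] up to a term built from [curlv v], which is explicit enough to
    see when it has no tangential part on a plane through [a]. *)
Lemma poincare a v d : vmsize_le d v -> exists phi (c : vfield R),
  [/\ (msize phi <= d.+1)%N, v = gradv phi + cross c (position a),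
      forall i, euler a (c i 0) + 2%:R *: c i 0 = curlv v i 0,
      euler a phi = dot (position a) v & ev a phi = 0].
Proof.
move=> vd; have [w wd wE] := solve_vec a 0 vd.
have {}wE i : v i 0 = euler a (w i 0) + w i 0 by rewrite -wE scale1r.
(* Here [w] solves [euler w + w = v], so [dot (position a) w] is the integral of
   [v] along the rays from [a]. *)
exists (dot (position a) w), (curlv w); split.
- apply: msize_le_sum => l _; rewrite -[d.+1]add1n.
  by apply: msize_leM => //; rewrite mxE; exact: msize_shift.
- apply: vec3P; rewrite !mxE wE /dot /euler !sum3 !mxE !mderivD !mderivM !deriv_shift;
    rewrite !ord3D !ord3_eq !eqxx /=; ring.
- move=> i; rewrite !mxE !wE !mderivD !deriv_euler eulerB -!mul_mpolyC; ring.
- rewrite /dot !sum3 !mxE !eulerD !eulerM !wE.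
  by rewrite /euler !sum3 !deriv_shift !ord3_eq !eqxx /=; ring.
- rewrite /ev /dot raddf_sum big1 // => l _ /=.
  by rewrite mevalM !mxE [X in X * _]ev_shift mul0r.
Qed.

Lemma curl_free_grad v d : vmsize_le d v -> curlv v = 0 ->
  exists2 phi, v = gradv phi & (msize phi <= d.+1)%N.
Proof.
move=> vd cv; have [phi [c [ps vE cE _ _]]] := poincare 0 vd.
exists phi => //; rewrite vE; suff -> : c = 0 by apply: vec3P; rewrite !mxE !mul0r subrr addr0.
apply/matrixP => i j; rewrite (ord1 j) mxE; apply: (@euler_inj _ 0 1).
by rewrite cE cv mxE.
Qed.

(** The Koszul homotopy in the next degree: the potential is [cross w x], where [w]
    solves [euler w + 2 w = v]. *)
Lemma div_free_curl v d : vmsize_le d v -> divv v = 0 ->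
  exists2 w, curlv w = v & vmsize_le d.+1 w.
Proof.
move=> vd dv; have [w wd wE] := solve_vec 0 1 vd.
have {}wE i : v i 0 = euler 0 (w i 0) + 2%:MP * w i 0 by rewrite -wE -mul_mpolyC.
have dw : divv w = 0.
  apply: (@euler_inj _ 0 2); rewrite -[RHS]dv /divv !sum3 !wE.
  rewrite !eulerD !mderivD !mderivM !deriv_euler !mderivC -!mul_mpolyC; ring.
exists (cross w (position 0)); last first.
  move=> l; rewrite !mxE -[d.+1]add1n ![_ * shift 0 _]mulrC.
  by apply: msize_leB; apply: msize_leM => //; exact: msize_shift.
move: dw; rewrite /divv sum3 => /eqP; rewrite -addrA addr_eq0 => /eqP dw.
have dw' : (w 2 0)^`M(2) = - (w 0 0)^`M(0) - (w 1 0)^`M(1) by rewrite dw; ring.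
apply: vec3P; rewrite !mxE !ord3D wE /euler !sum3 !mderivB !mderivM !deriv_shift;
  rewrite !ord3_eq !eqxx /= dw'; ring.
Qed.

End VectorCalculus.

(** * Projection onto a plane *)

Section Projection.
Variable R : realType.
Implicit Types (p q l : {mpoly R[3]}) (d : 'cV[R]_3).

(** Substituting [x - l(x) d], where [l] is affine with slope 1 along [d], is the
    projection along [d] onto the plane [l = 0]: on polynomials it is a ring
    morphism that realizes the quotient by the ideal of [l]. *)
Definition project l d p : {mpoly R[3]} :=
  p \mPo [tuple 'X_j - (d j 0)%:MP * l | j < 3].

HB.instance Definition _ l d := GRing.RMorphism.copy (project l d)
  (comp_mpoly [tuple 'X_j - (d j 0)%:MP * l | j < 3]).

Lemma projectX l d j : project l d 'X_j = 'X_j - (d j 0)%:MP * l.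
Proof.
rewrite /project comp_mpolyXU -(tnth_nth 0 [tuple _ | j < 3] j).
by rewrite tnth_mktuple.
Qed.

Lemma projectC l d c : project l d c%:MP = c%:MP.
Proof. exact: comp_mpolyC. Qed.

Lemma project_multiple l d p : multiple l (p - project l d p).
Proof.
elim/mpoly_fun_ind: p => [c|j|f g [f' fE] [g' gE]|f g [f' fE] [g' gE]].
- by exists 0; rewrite projectC subrr mulr0.
- by exists (d j 0)%:MP; rewrite projectX; ring.
- exists (f' + g'); rewrite rmorphD mulrDr -fE -gE; ring.
- exists (f' * g + project l d f * g'); rewrite rmorphM /=.
  transitivity ((f - project l d f) * g + project l d f * (g - project l d g)).
    by ring.
  by rewrite fE gE; ring.
Qed.

Lemma msize_project l d p k : (msize l <= 2)%N -> (msize p <= k)%N ->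
  (msize (project l d p) <= k)%N.
Proof.
move=> l2 pk; rewrite /project comp_mpolyEX big_seq.
apply: msize_le_sum => m mp; apply: msize_leZ.
apply: leq_trans (leq_trans (msize_mdeg_lt mp) pk).
have H e (f : {mpoly R[3]}) : (msize f <= 2 -> msize (f ^+ e)%R <= e.+1)%N.
  move=> f2; elim: e => [|e IH]; first by rewrite expr0 msize1.
  rewrite exprS -[e.+2]add1n; exact: msize_leM.
have t2 j : (msize ('X_j - (d j 0)%:MP * l : {mpoly R[3]})%R <= 2)%N.
  apply: msize_leB; first by rewrite msizeX mdeg1.
  exact: msize_leMC.
rewrite comp_mpolyX mdegE; elim/big_ind2: _ => [|e1 f1 e2 f2 h1 h2|j _].
- by rewrite msize1.
- rewrite -addnS; exact: msize_leM.
- by apply: H; rewrite tnth_mktuple.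
Qed.

End Projection.

(** * Restriction to a segment *)

Section Segments.
Variable R : realType.
Implicit Types (p q : {mpoly R[3]}) (x d : 'cV[R]_3).

Definition segment x d p : {poly R} :=
  mmap (@polyC R) (fun l => (x l 0)%:P + (d l 0)%:P * 'X) p.

HB.instance Definition _ x d := GRing.RMorphism.copy (segment x d)
  (mmap (@polyC R) (fun l => (x l 0)%:P + (d l 0)%:P * 'X)).

Lemma segmentC x d c : segment x d c%:MP = c%:P.
Proof. exact: mmapC. Qed.

Lemma segmentX x d l : segment x d 'X_l = (x l 0)%:P + (d l 0)%:P * 'X.
Proof. by rewrite /segment mmapX mmap1U. Qed.

Lemma horner_segment x d p s : (segment x d p).[s] = ev (x + s *: d) p.
Proof.
elim/mpoly_fun_ind: p => [c|l|f g fE gE|f g fE gE].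
- by rewrite segmentC hornerC evC.
- by rewrite segmentX !hornerE /ev mevalXU !mxE mulrC.
- by rewrite rmorphD hornerD fE gE /ev mevalD.
- by rewrite rmorphM hornerM fE gE /ev mevalM.
Qed.

Lemma deriv_segment x d p :
  (segment x d p)^`() = \sum_l (d l 0)%:P * segment x d p^`M(l).
Proof.
elim/mpoly_fun_ind: p => [c|l|f g fE gE|f g fE gE].
- by rewrite segmentC derivC big1 // => l _; rewrite mderivC rmorph0 mulr0.
- rewrite segmentX !derivE !sum3 !mderivXU.
  by move: l; apply: ord3_ind; rewrite ?ord3_eq ?eqxx ?rmorph1 ?rmorph0; ring.
- rewrite rmorphD derivD fE gE !sum3 !mderivD !rmorphD; ring.
- rewrite rmorphM derivM fE gE !sum3 !mderivM !rmorphD !rmorphM; ring.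
Qed.

Lemma poly_zero_on_unit (f : {poly R}) : (forall s, 0 <= s <= 1 -> f.[s] = 0) -> f = 0.
Proof.
move=> f0; pose r := [seq (n.+1%:R : R)^-1 | n <- iota 0 (size f)].
apply: (@roots_geq_poly_eq0 _ f r); last by rewrite size_map size_iota.
  apply/allP => _ /mapP [n _ ->]; rewrite rootE f0 //.
  by rewrite invr_ge0 ler0n invf_le1 ?ltr0n // ler1n.
rewrite map_inj_uniq ?iota_uniq // => m n /invr_inj /eqP.
by rewrite eqr_nat => /eqP [].
Qed.

Lemma deriv_on_segment x d p : (forall s, 0 <= s <= 1 -> ev (x + s *: d) p = 0) ->
  \sum_l d l 0 * ev x p^`M(l) = 0.
Proof.
move=> p0; have s0 : segment x d p = 0.
  by apply: poly_zero_on_unit => s s01; rewrite horner_segment p0.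
have := deriv_segment x d p; rewrite s0 deriv0 => /(congr1 (horner^~ 0)).
rewrite horner0 horner_sum => {2}->; apply: eq_bigr => l _.
by rewrite hornerM hornerC horner_segment scale0r addr0.
Qed.

End Segments.

(** * Ideals of the faces and edges of a tetrahedron *)

Section Tetra.
Variables (R : realType) (v : 'I_4 -> 'cV[R]_3).
Hypothesis vI : affinely_independent v.
Implicit Types (i j k : 'I_4) (p q r f : {mpoly R[3]}).

Local Notation L := (bary v).
Local Notation g := (gradbary v).

Lemma ev_bary i j : ev (v j) (L i) = (j == i)%:R.
Proof. exact: bary_vtx. Qed.

Lemma deriv_bary i l : (L i)^`M(l) = (g i l 0)%:MP.
Proof.
rewrite /bary mderivD mderivC add0r sum3 !mderivD !mderivZ !mderivXU.
by move: l; apply: ord3_ind; rewrite ?ord3_eq ?eqxx /= ?scaler0 -!mul_mpolyC ?mulr1; ring.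
Qed.

Lemma gradv_bary i : gradv (L i) = cst (g i).
Proof. by apply/matrixP => l j; rewrite (ord1 j) [LHS]mxE deriv_bary /cst [RHS]mxE. Qed.

Lemma msize_bary i : (msize (L i) <= 2)%N.
Proof.
apply: msize_leD; first exact: leq_trans (msize_leC _) _.
by apply: msize_le_sum => l _; apply: msize_leZ; rewrite msizeX mdeg1.
Qed.

Lemma other i : exists j, j != i.
Proof. by exists (i + 1); case: i => -[|[|[|[|]]]]. Qed.

Lemma other2 i j : exists2 k, k != i & k != j.
Proof.
have : (0 < #|[predC [:: i; j]]|)%N.
  rewrite -subn_gt0 subn0 -(ltn_add2l #|[:: i; j]|) cardC addn0 card_ord.
  by apply: leq_ltn_trans (card_size _) _.
by case/card_gt0P => k; rewrite !inE negb_or => /andP [ki kj]; exists k.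
Qed.

Lemma other3 i j k : exists l, [/\ l != i, l != j & l != k].
Proof.
have : (0 < #|[predC [:: i; j; k]]|)%N.
  rewrite -subn_gt0 subn0 -(ltn_add2l #|[:: i; j; k]|) cardC addn0 card_ord.
  by apply: leq_ltn_trans (card_size _) _.
by case/card_gt0P => l; rewrite !inE !negb_or => /and3P [li lj lk]; exists l.
Qed.

Lemma bary_nonconst i : (1 < msize (L i))%N.
Proof.
rewrite ltnNge; apply/negP => /msize1_polyC Lc; have [j ji] := other i.
have := ev_bary i i; have := ev_bary i j; rewrite Lc /ev !mevalC (negPf ji) eqxx.
by move=> -> /eqP; rewrite eq_sym oner_eq0.
Qed.

Lemma bary_neq0 i : L i != 0.
Proof. by apply: contraTneq (bary_nonconst i) => ->; rewrite msize0. Qed.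

Lemma euler_bary i j : i != j -> euler (v j) (L i) = L i.
Proof.
move=> ij; have := ev_bary i j; rewrite eq_sym (negPf ij).
rewrite /ev baryE sum3 => /eqP; rewrite addr_eq0 => /eqP e0.
rewrite /euler !sum3 !deriv_bary /shift /bary sum3 e0 -!mul_mpolyC.
rewrite !(mpolyCD, mpolyCN, mpolyCM); ring.
Qed.

Lemma sum_bary_vtx (c : 'I_4) : \sum_b L b * (vtx v b c)%:MP =
  (ord0 == c)%:R + \sum_l 'X_l * (lift ord0 l == c)%:R.
Proof.
have iv (r : 'I_4) : \sum_b invmx (vtx v) r b * vtx v b c = (r == c)%:R.
  have /matrixP/(_ r c) := mulVmx (vtx_unit vI); rewrite !mxE => <-.
  by [].
rewrite -[(ord0 == c)%:R]mpolyC_nat -iv rmorph_sum /=.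
under [X in _ = _ + X]eq_bigr => l _ do rewrite -mpolyC_nat -iv rmorph_sum mulr_sumr.
rewrite exchange_big -big_split; apply: eq_bigr => b _ /=.
rewrite /bary mulrDl mulr_suml -mpolyCM; congr (_ + _); apply: eq_bigr => l _.
by rewrite /gradbary mxE -mul_mpolyC mpolyCM; ring.
Qed.

Lemma sum_bary : \sum_b L b = 1.
Proof.
transitivity (\sum_b L b * (vtx v b ord0)%:MP).
  by apply: eq_bigr => b _; rewrite mxE unlift_none mpolyC1 mulr1.
rewrite sum_bary_vtx eqxx big1 ?addr0 // => l _.
by rewrite eq_sym (negPf (neq_lift _ _)) mulr0.
Qed.

Lemma sum_bary_coord l : \sum_b L b * (v b l 0)%:MP = 'X_l.
Proof.
transitivity (\sum_b L b * (vtx v b (lift ord0 l))%:MP).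
  by apply: eq_bigr => b _; rewrite mxE liftK.
rewrite sum_bary_vtx (negPf (neq_lift _ _)) add0r (bigD1 l) //= eqxx mulr1.
rewrite big1 ?addr0 // => m ml.
by rewrite (inj_eq (@lift_inj _ _)) (negPf ml) mulr0.
Qed.

Lemma shift_bary a l :
  shift (v a) l = \sum_b L b * ((v b - v a) l 0)%:MP.
Proof.
under eq_bigr => b _ do rewrite !mxE mpolyCB mulrBr.
by rewrite sumrB sum_bary_coord -mulr_suml sum_bary mul1r.
Qed.

Lemma project_bary i k d : project (L i) d (L k) =
  L k - (\sum_l g k l 0 * d l 0)%:MP * L i.
Proof.
rewrite [in X in project _ _ X]/bary rmorphD rmorph_sum /= projectC.
under eq_bigr => l _ do rewrite -mul_mpolyC rmorphM /= projectC projectX.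
rewrite /bary !sum3 !mpolyCD !mpolyCM -!mul_mpolyC; ring.
Qed.

(** As the kernel of a ring morphism to a domain, the ideal of a plane is prime. The
    projection is along an edge that leaves the face. *)
Lemma face_hom i : exists rho : {rmorphism {mpoly R[3]} -> {mpoly R[3]}},
  forall p, rho p = 0 <-> multiple (L i) p.
Proof.
have [m mi] := other i; exists (project (L i) (v i - v m)) => p.
split=> [p0|[q ->]]; last first.
  by rewrite rmorphM /= project_bary gradbaryB // eqxx (negPf mi) subr0 mpolyC1 mul1r subrr mul0r.
by have := project_multiple (L i) (v i - v m) p; rewrite p0 subr0.
Qed.

(** The same for the line in which two planes meet: project successively along two
    edges that end at a common third vertex, so that the first projection preserves
    the second coordinate. Following a polynomial through the projections also splits it
    with quotients of smaller degree. *)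
Lemma edge_hom_split i j : i != j ->
  exists rho : {rmorphism {mpoly R[3]} -> {mpoly R[3]}},
  [/\ forall c, rho c%:MP = c%:MP, forall p, rho p = 0 <-> ideal2 (L i) (L j) p
    & forall d p, rho p = 0 -> (msize p <= d)%N -> exists q r,
      [/\ p = L i * q + L j * r, (msize q <= d.-1)%N & (msize r <= d.-1)%N]].
Proof.
move=> ij; have [m mi mj] := other2 i j.
pose pi := project (L i) (v i - v m); pose pj := project (L j) (v j - v m).
have Li : pi (L i) = 0.
  by rewrite /pi project_bary gradbaryB // eqxx (negPf mi) subr0 mpolyC1 mul1r subrr.
have Lj : pi (L j) = L j.
  by rewrite /pi project_bary gradbaryB // (negPf ij) (negPf mj) subr0 mpolyC0 mul0r subr0.
have Lj0 : pj (L j) = 0.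
  by rewrite /pj project_bary gradbaryB // eqxx (negPf mj) subr0 mpolyC1 mul1r subrr.
have S d p : pj (pi p) = 0 -> (msize p <= d)%N -> exists q r,
      [/\ p = L i * q + L j * r, (msize q <= d.-1)%N & (msize r <= d.-1)%N].
  move=> p0 pd; have [q qE] := project_multiple (L i) (v i - v m) p.
  have [r rE] := project_multiple (L j) (v j - v m) (pi p).
  have pid : (msize (pi p) <= d)%N by apply: msize_project => //; exact: msize_bary.
  have rE' : pi p = L j * r by rewrite -rE [project _ _ _]p0 subr0.
  have dd (e h : {mpoly R[3]}) : (1 < msize h)%N -> (msize (h * e)%R <= d)%N -> (msize e <= d.-1)%N.
    move=> h1 he; apply: (msize_divl h1); rewrite add1n; apply: leq_trans he _.
    by rewrite leqSpred.
  exists q, r; split.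
  - by rewrite -rE' -qE addrC /pi; ring.
  - by apply: (dd _ (L i)); rewrite ?bary_nonconst // -qE; exact: msize_leB.
  - by apply: (dd _ (L j)); rewrite ?bary_nonconst // -rE'.
exists (pj \o pi); split=> //.
- by move=> c /=; rewrite /pi /pj !projectC.
- move=> p; split=> [p0|[q [r ->]]].
    by have [q [r [-> _ _]]] := S _ p p0 (leqnn _); exists q, r.
  have pE : pi (L i * q + L j * r) = L j * pi r.
    by rewrite -[in RHS]Lj -[RHS]add0r -[0](mul0r (pi q)) -Li /pi rmorphD !rmorphM.
  have pE' : pj (L j * pi r) = 0 by rewrite /pj rmorphM -/pj /= [project _ _ _]Lj0 mul0r.
  by rewrite -[LHS]/(pj (pi _)) pE pE'.
Qed.

Lemma edge_hom i j : i != j ->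
  exists rho : {rmorphism {mpoly R[3]} -> {mpoly R[3]}},
  [/\ forall c, rho c%:MP = c%:MP & forall p, rho p = 0 <-> ideal2 (L i) (L j) p].
Proof. by move=> /edge_hom_split [rho [rc rp _]]; exists rho. Qed.

Lemma ideal2_split d i j p : i != j -> ideal2 (L i) (L j) p -> (msize p <= d)%N ->
  exists q r, [/\ p = L i * q + L j * r, (msize q <= d.-1)%N & (msize r <= d.-1)%N].
Proof. by move=> /edge_hom_split [rho [_ rp H]] /rp; exact: H. Qed.

(** [L k] takes the value 1 at its vertex, which lies on the plane, so it is not in
    the ideal. *)
Lemma face_prime i k p : k != i -> multiple (L i) (L k * p) -> multiple (L i) p.
Proof.
move=> ki; have [rho rp] := face_hom i => /rp /eqP.
rewrite rmorphM mulf_eq0 => /orP [/eqP/rp [q LE]|/eqP/rp //].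
have := ev_bary k k; rewrite LE /ev mevalM -!/(ev _ _) ev_bary (negPf ki) mul0r eqxx.
by move=> /esym/eqP; rewrite oner_eq0.
Qed.

Lemma edge_prime i j k p : i != j -> k != i -> k != j ->
  ideal2 (L i) (L j) (L k * p) -> ideal2 (L i) (L j) p.
Proof.
move=> ij ki kj; have [rho [_ rp]] := edge_hom ij => /rp /eqP.
rewrite rmorphM mulf_eq0 => /orP [/eqP/rp [q [r LE]]|/eqP/rp //].
have := ev_bary k k; rewrite LE /ev mevalD !mevalM -!/(ev _ _) !ev_bary.
rewrite (negPf ki) (negPf kj) !mul0r eqxx addr0.
by move=> /esym/eqP; rewrite oner_eq0.
Qed.

Lemma multiple_prod (s : seq 'I_4) p : uniq s ->
  (forall i, i \in s -> multiple (L i) p) -> multiple (\prod_(i <- s) L i) p.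
Proof.
elim: s p => [|i s IH] p /=; first by move=> _ _; exists p; rewrite big_nil mul1r.
move=> /andP [is_ us] ps; have [q pE] := ps i (mem_head _ _).
have [r qE] : multiple (\prod_(i <- s) L i) q.
  apply: IH => // j js; apply: (@face_prime j i); last first.
    by rewrite -pE; apply: ps; rewrite in_cons js orbT.
  by apply: contraNneq is_ => ->.
by exists r; rewrite big_cons -mulrA -qE.
Qed.

Definition coface i : {mpoly R[3]} := \prod_(j | j != i) L j.

Definition coedge i j : {mpoly R[3]} := \prod_(k | (k != i) && (k != j)) L k.

Lemma bubbleE i : bubble v = L i * coface i.
Proof. by rewrite /bubble (bigD1 i). Qed.

Lemma cofaceE i j : i != j -> coface i = L j * coedge i j.
Proof. by move=> ij; rewrite /coface (bigD1 j) // eq_sym. Qed.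

Lemma coedgeC i j : coedge i j = coedge j i.
Proof. by rewrite /coedge; apply: eq_bigl => k; rewrite andbC. Qed.

Lemma bubble_edge i j : i != j -> bubble v = L i * L j * coedge i j.
Proof. by move=> ij; rewrite (bubbleE i) (cofaceE ij) mulrA. Qed.

Lemma multiple_bubble p : (forall i, multiple (L i) p) -> multiple (bubble v) p.
Proof.
by move=> pL; apply: multiple_prod => //; exact: index_enum_uniq.
Qed.

Lemma face_prime_prod (s : seq 'I_4) i p : i \notin s ->
  multiple (L i) ((\prod_(j <- s) L j) * p) -> multiple (L i) p.
Proof.
elim: s => [|j s IH]; first by rewrite big_nil mul1r.
rewrite in_cons negb_or => /andP [ij is_]; rewrite big_cons -mulrA => /face_prime h.
by apply: IH => //; apply: h; rewrite eq_sym.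
Qed.

Lemma face_prime_coface i p : multiple (L i) (coface i * p) -> multiple (L i) p.
Proof.
rewrite /coface -big_filter; apply: face_prime_prod.
by rewrite mem_filter eqxx.
Qed.

Lemma edge_prime_coedge i j p : i != j ->
  ideal2 (L i) (L j) (coedge i j * p) -> ideal2 (L i) (L j) p.
Proof.
move=> ij; rewrite /coedge -big_filter; set s := filter _ _.
have : {subset s <= [pred k | (k != i) && (k != j)]} by move=> k; rewrite mem_filter => /andP [].
elim: s => [|k s IH] sP; first by rewrite big_nil mul1r.
have /andP [/= ki kj] := sP k (mem_head _ _).
rewrite big_cons -mulrA => /(edge_prime ij ki kj); apply: IH => h hs.
by apply: sP; rewrite in_cons hs orbT.
Qed.

(** The edges in the plane of [L i] are cut out by distinct primes, so that the factors
    can be divided off one by one, each lowering the degree. *)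
Lemma edge_division (s : seq 'I_4) i d p : uniq s -> i \notin s ->
  (forall j, j \in s -> ideal2 (L i) (L j) p) -> (msize p <= d)%N ->
  exists q r, p = (\prod_(j <- s) L j) * q + L i * r /\ (msize q <= d - size s)%N.
Proof.
elim: s d p => [|j s IH] d p /=.
  by move=> _ _ _ pd; exists p, 0; rewrite big_nil mul1r mulr0 addr0 subn0.
move=> /andP [js us]; rewrite in_cons negb_or => /andP [ij is_] ps pd.
have [r [q [pE _ qd]]] := ideal2_split ij (ps j (mem_head _ _)) pd.
have [q' [r' [qE q'd]]] : exists q' r', q = (\prod_(j <- s) L j) * q' + L i * r' /\
    (msize q' <= d.-1 - size s)%N.
  apply: IH => // k ks; have kj : k != j by apply: contraNneq js => <-.
  have ik : i != k by apply: contraNneq is_ => ->.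
  (* On the edge of [L i] and [L k] the product [L j * q] vanishes, and [L j] can be
     cancelled there. *)
  apply: (@edge_prime i k j) => //; rewrite ?(eq_sym j) //.
  have [a [b pkE]] : ideal2 (L i) (L k) p by apply: ps; rewrite in_cons ks orbT.
  exists (a - r), b; rewrite mulrBr addrAC -pkE pE; ring.
exists q', (r + L j * r'); split; first by rewrite big_cons pE qE; ring.
by move: q'd; rewrite -subn1 -subnDA add1n.
Qed.

Lemma msize_prod_bary (s : seq 'I_4) : (msize (\prod_(j <- s) L j)%R <= (size s).+1)%N.
Proof.
elim: s => [|j s IH]; first by rewrite big_nil msize1.
by rewrite big_cons /= -[(size s).+2]add1n; apply: msize_leM => //; exact: msize_bary.
Qed.

(** The planes are added one at a time, correcting by a multiple of the product of those
    already treated; agreement on the edges makes the correction divisible by it. *)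
Lemma extend_faces d (f : 'I_4 -> {mpoly R[3]}) : (forall i, (msize (f i) <= d)%N) ->
  (forall i j, i != j -> ideal2 (L i) (L j) (f i - f j)) ->
  exists2 h, (msize h <= d)%N & forall i, multiple (L i) (h - f i).
Proof.
move=> fd fc; suff H (s : seq 'I_4) : uniq s -> exists2 h, (msize h <= d)%N &
    forall i, i \in s -> multiple (L i) (h - f i).
  have [h hd hf] := H _ (index_enum_uniq _); exists h => // i.
  by apply: hf; rewrite mem_index_enum.
elim: s => [|j s IH] /=; first by exists 0; rewrite ?msize0.
move=> /andP [js us]; have [h hd hf] := IH us.
have [q [r [qE qd]]] : exists q r, f j - h = (\prod_(k <- s) L k) * q + L j * r /\
    (msize q <= d - size s)%N.
  apply: edge_division => //; last exact: msize_leB.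
  move=> i is_; have ij : j != i by apply: contraNneq js => ->.
  have [a [b abE]] := fc _ _ ij; have [c cE] := hf i is_.
  by exists a, (b - c); rewrite mulrBr addrA -abE -cE; ring.
exists (h + (\prod_(k <- s) L k) * q).
  apply: msize_leD => //; have [sd|ds] := leqP (size s) d.
    by rewrite -(subnKC sd); apply: msize_leM => //; exact: msize_prod_bary.
  move: qd; rewrite (eqP (ltnW ds : _ - _ == 0)%N) leqn0 msize_poly_eq0 => /eqP ->.
  by rewrite mulr0 msize0.
move=> i; rewrite in_cons => /orP [/eqP ->|is_].
  by exists (- r); rewrite -[f j](subrK h) qE; ring.
rewrite addrAC; apply: multipleD; first exact: hf.
by rewrite (big_rem i) //= -mulrA; exact: multiple_refl.
Qed.

Lemma ev_comb (t : 'I_4 -> R) i : \sum_j t j = 1 ->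
  ev (\sum_j t j *: v j) (L i) = t i.
Proof.
move=> t1; rewrite /ev baryE.
transitivity (\sum_j t j * ev (v j) (L i)); last first.
  rewrite (bigD1 i) //= ev_bary eqxx mulr1 big1 ?addr0 // => j ji.
  by rewrite ev_bary (negPf ji) mulr0.
under [RHS]eq_bigr => j _ do rewrite /ev baryE mulrDr.
rewrite big_split -mulr_suml t1 mul1r; congr (_ + _).
rewrite sum3 !summxE !mulr_sumr -!big_split; apply: eq_bigr => j _ /=.
by rewrite sum3 !mxE; ring.
Qed.

Lemma face_vtx i j : j != i -> face v i (v j).
Proof.
move=> ji; exists (fun k => (k == j)%:R); split=> [k||//|].
- by rewrite ler0n.
- by rewrite (bigD1 j) //= eqxx big1 ?addr0 // => k /negPf ->.
- by rewrite eq_sym (negPf ji).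
- rewrite (bigD1 j) //= eqxx scale1r big1 ?addr0 // => k /negPf ->.
  by rewrite scale0r.
Qed.

Lemma face_segment i j x s : j != i -> face v i x -> 0 <= s <= 1 ->
  face v i (x + s *: (v j - x)).
Proof.
move=> ji [t [t0 t1 ti ->]] /andP [s0 s1].
exists (fun k => (1 - s) * t k + s * (k == j)%:R); split.
- by move=> k; rewrite addr_ge0 // mulr_ge0 // ?subr_ge0 ?ler0n.
- rewrite big_split -!mulr_sumr t1 (bigD1 j) //= eqxx big1 ?addr0 /=; first by ring.
  by move=> k /negPf ->.
- by rewrite ti eq_sym (negPf ji) /=; ring.
- under [RHS]eq_bigr => k _ do rewrite scalerDl -!scalerA.
  rewrite big_split -!scaler_sumr /= [in RHS](_ : \sum_k (k == j)%:R *: v k = v j).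
    by rewrite scalerBl scale1r scalerBr addrA addrAC.
  by rewrite (bigD1 j) //= eqxx scale1r big1 ?addr0 // => k /negPf ->; rewrite scale0r.
Qed.

(** If [p] vanishes on the face, so does its radial derivative about each vertex of the
    face, hence so do its tangential derivatives. By induction on the degree the latter
    are multiples of [L i], and so is the radial one. *)
Lemma face_vanishP i p :
  (forall x, face v i x -> ev x p = 0) <-> multiple (L i) p.
Proof.
split; last first.
  by move=> [q ->] x [t [_ t1 ti ->]]; rewrite /ev mevalM -/(ev _ _) ev_comb // ti mul0r.
move=> p0; suff H n : forall p, (msize p <= n)%N ->
    (forall x, face v i x -> ev x p = 0) -> multiple (L i) p by exact: H (leqnn _) p0.
elim: n => [|n IH] {p0}p pn p0.
  by move: pn; rewrite leqn0 msize_poly_eq0 => /eqP ->; exact: multiple0.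
have rad a x : a != i -> face v i x -> ev x (euler (v a) p) = 0.
  move=> ai xF; have := @deriv_on_segment _ x (v a - x) p.
  rewrite /ev /euler raddf_sum /= => h; apply/eqP; rewrite -oppr_eq0; apply/eqP.
  rewrite -[RHS]h => [|s s01]; last by apply: p0; exact: face_segment.
  rewrite -sumrN; apply: eq_bigr => l _.
  by rewrite mevalM mevalB mevalXU mevalC !mxE; ring.
have [a ai] := other i.
have tang b : b != i -> multiple (L i) (\sum_l ((v b - v a) l 0)%:MP * p^`M(l)).
  move=> bi; apply: IH => [|x xF].
    by apply: msize_le_sum => l _; apply: msize_leMC; exact: (msize_deriv l pn).
  have -> : \sum_l ((v b - v a) l 0)%:MP * p^`M(l) = euler (v a) p - euler (v b) p.
    by rewrite /euler !sum3 /shift !mxE !mpolyCB; ring.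
  by rewrite /ev mevalB -!/(ev _ _) !rad // subrr.
have pE : multiple (L i) (euler (v a) p).
  rewrite /euler; under eq_bigr => l _ do rewrite shift_bary mulr_suml.
  rewrite exchange_big; apply: multiple_sum => b _ /=.
  under eq_bigr => l _ do rewrite -mulrA.
  rewrite -mulr_sumr; have [->|bi] := eqVneq b i; first exact: multiple_refl.
  by apply: multipleMl; exact: tang.
have ia : i != a by rewrite eq_sym.
have := euler_multiple (euler_bary ia) pE.
by rewrite p0 ?mpolyC0 ?subr0 //; exact: face_vtx.
Qed.

End Tetra.

(** * Potentials with boundary conditions *)

Section RelativeDeRham.
Variables (R : realType) (v : 'I_4 -> 'cV[R]_3).
Hypothesis vI : affinely_independent v.
Implicit Types (i j k : 'I_4) (p q r f : {mpoly R[3]}) (w y z : vfield R).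

Local Notation L := (bary v).
Local Notation g := (gradbary v).
Local Notation b := (bubble v).

Definition vmultiple p w := forall l, multiple p (w l 0).

(** Zero tangential trace on every face; [g i] is an unnormalized normal. *)
Definition tangent_free w := forall i, vmultiple (L i) (cross (cst (g i)) w).

Definition normal_free w := forall i, multiple (L i) (dot (cst (g i)) w).

Definition edge_free w := forall i j, i != j -> forall l, ideal2 (L i) (L j) (w l 0).

Lemma dot_grad_position i a : a != i -> dot (cst (g i)) (position (v a)) = L i.
Proof.
move=> ai; rewrite -[RHS](@euler_bary _ _ vI i a) 1?eq_sym // /dot /euler.
by apply: eq_bigr => l _; rewrite !entryE deriv_bary // mulrC.
Qed.

Lemma dot_grad_edge i j k : dot (cst (g i)) (cst (v j - v k)) = ((j == i)%:R - (k == i)%:R)%:MP.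
Proof.
rewrite -(gradbaryB i j k vI) rmorph_sum; apply: eq_bigr => l _.
by rewrite !entryC rmorphM.
Qed.

Lemma sqnorm_grad_neq0 i : \sum_l g i l 0 ^+ 2 != 0.
Proof.
apply/eqP => /eqP; rewrite psumr_eq0 => [/allP g0|l _]; last exact: sqr_ge0.
have [j ji] := other i; have := gradbaryB i i j vI.
rewrite eqxx (negPf ji) subr0 big1 => [/eqP|l _]; first by rewrite eq_sym oner_eq0.
by have := g0 l (mem_index_enum _); rewrite sqrf_eq0 => /eqP ->; rewrite mul0r.
Qed.

Lemma vmultipleD p w z : vmultiple p w -> vmultiple p z -> vmultiple p (w + z).
Proof. by move=> wp zp l; rewrite mxE; exact: multipleD. Qed.

Lemma vmultipleB p w z : vmultiple p w -> vmultiple p z -> vmultiple p (w - z).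
Proof. by move=> wp zp l; rewrite !entryE; exact: multipleB. Qed.

Lemma vmultiple_refl p w : vmultiple p (p *: w).
Proof. by move=> l; rewrite mxE; exact: multiple_refl. Qed.

Lemma vmultipleP p w : vmultiple p w <-> exists z, w = p *: z.
Proof.
split=> [wp|[z ->]]; last exact: vmultiple_refl.
have [q0 e0] := wp 0; have [q1 e1] := wp 1; have [q2 e2] := wp 2.
by exists (vec q0 q1 q2); apply: vec3P; rewrite !mxE ?ord3_eq ?eqxx.
Qed.

Lemma cross_grad_multiple i f : vmultiple (L i) (cross (cst (g i)) (gradv (L i * f))).
Proof.
apply/vmultipleP; exists (cross (cst (g i)) (gradv f)).
apply: vec3P; rewrite !entryE !mderivM !deriv_bary // ?ord3D; ring.
Qed.

(** By the double cross product formula; [om] is the normal component. *)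
Lemma tangent_free_face d i w : vmsize_le d w -> vmultiple (L i) (cross (cst (g i)) w) ->
  exists om z, w = om *: cst (g i) + L i *: z /\ (msize om <= d)%N.
Proof.
move=> wd /vmultipleP [z zE].
pose s := \sum_l g i l 0 ^+ 2; have s0 : s != 0 := sqnorm_grad_neq0 i.
exists ((s^-1)%:MP * dot (cst (g i)) w), (- (s^-1)%:MP *: cross (cst (g i)) z); split.
  have sE : s%:MP = dot (cst (g i)) (cst (g i)).
    by rewrite rmorph_sum; apply: eq_bigr => l _; rewrite entryC rmorphM.
  have H : s%:MP *: w = dot (cst (g i)) w *: cst (g i) - L i *: cross (cst (g i)) z.
    rewrite -crossZ -zE sE; apply: vec3P; rewrite !entryE /dot !sum3 ?ord3D ?entryE; ring.
  have -> : w = (s^-1)%:MP *: (s%:MP *: w) by rewrite scalerA -mpolyCM mulVf // mpolyC1 scale1r.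
  rewrite [in LHS]H -!/(dot _ _) (_ : dot _ (_ *: (s%:MP *: w)) = dot (cst (g i)) w); last first.
    by rewrite scalerA -mpolyCM mulVf // mpolyC1 scale1r.
  by apply/matrixP => l m; rewrite !entryE; ring.
apply: msize_leMC; apply: msize_le_sum => l _; rewrite entryC; exact: msize_leMC.
Qed.

Lemma euler2_multiple a f p q : euler a f = f -> euler a p + 2%:R *: p = f * q ->
  multiple f p.
Proof.
move=> fE pE; have [q' q'E _] := euler_solve a 2 q; exists q'.
apply/eqP; rewrite -subr_eq0; apply/eqP; apply: (@euler_inj _ a 1).
rewrite eulerB eulerM fE scalerBr.
transitivity ((euler a p + 2%:R *: p) - (f * q' + f * euler a q' + 2%:R *: (f * q'))).
  by ring.
rewrite pE -q'E -!mul_mpolyC; ring.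
Qed.

(** Radial potentials from a vertex preserve planes through it. If [curlv w] has no
    normal part on such a plane, neither has the field [c] of [poincare], and then
    [cross c (position (v a))] has no tangential part, by the double cross product
    formula. *)
Lemma poincare_vertex a d w : vmsize_le d w ->
  exists phi, [/\ (msize phi <= d.+1)%N, ev (v a) phi = 0,
    euler (v a) phi = dot (position (v a)) w
    & forall j, j != a -> multiple (L j) (dot (cst (g j)) (curlv w)) ->
      vmultiple (L j) (cross (cst (g j)) (w - gradv phi))].
Proof.
move=> wd; have [phi [c [ps wE cE pE p0]]] := poincare (v a) wd.
exists phi; split=> // j ja [q qE].
have jE : euler (v a) (L j) = L j by apply: euler_bary => //.
have [r rE] : multiple (L j) (dot (cst (g j)) c).
  apply: (@euler2_multiple (v a) _ _ q) => //; rewrite -qE /dot !sum3 !entryC -!cE.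
  by rewrite !eulerD !eulerM !eulerC -!mul_mpolyC; ring.
have -> : w - gradv phi = cross c (position (v a)) by rewrite wE addrAC subrr add0r.
have -> : cross (cst (g j)) (cross c (position (v a))) =
    dot (cst (g j)) (position (v a)) *: c - dot (cst (g j)) c *: position (v a).
  apply: vec3P; rewrite !entryE /dot !sum3 ?ord3D ?entryE; ring.
rewrite dot_grad_position 1?eq_sym // rE; apply: vmultipleB; first exact: vmultiple_refl.
by rewrite -scalerA; exact: vmultiple_refl.
Qed.

Lemma dot_multiple i a d w : a != i -> vmsize_le d w ->
  vmultiple (L i) (cross (cst (g i)) w) -> multiple (L i) (dot (position (v a)) w).
Proof.
move=> ai wd wt; have [om [z [-> _]]] := tangent_free_face wd wt.
have -> : dot (position (v a)) (om *: cst (g i) + L i *: z) =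
  om * dot (cst (g i)) (position (v a)) + L i * dot (position (v a)) z.
  by rewrite /dot !sum3 !entryE; ring.
rewrite dot_grad_position //; apply: multipleD; last exact: multiple_refl.
by apply: multipleMl; exists 1; rewrite mulr1.
Qed.

(** Radial potentials centred at a vertex remove the tangential trace on the three faces
    that contain it; a second one, centred at a vertex of the remaining face, vanishes
    on the three edges of that face, so it can be replaced by one that vanishes on the
    other faces. *)
Lemma relative_potential d y : (1 <= d)%N -> vmsize_le d y -> divv y = 0 -> normal_free y ->
  exists w, [/\ vmsize_le d.+1 w, curlv w = y & tangent_free w].
Proof.
move=> d1 yd dy yn; have [w0 w0E w0d] := div_free_curl yd dy.
have [phi [phid _ _ phiT]] := poincare_vertex 0 w0d.
pose w1 := w0 - gradv phi.
have w1d : vmsize_le d.+1 w1.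
  move=> l; rewrite !entryE; apply: msize_leB; first exact: w0d.
  exact: (msize_deriv l phid).
have w1E : curlv w1 = y by rewrite curlvB curlv_grad subr0.
have w1T j : j != 0 -> vmultiple (L j) (cross (cst (g j)) w1).
  by move=> j0; apply: phiT => //; rewrite w0E.
have [psi [psid psi1 psiE psiT]] := poincare_vertex 1 w1d.
have w2d : vmsize_le d.+1 (w1 - gradv psi).
  move=> l; rewrite [X in msize X]entryD; apply: msize_leD; first exact: w1d.
  by rewrite !entryE; apply: msize_leN; exact: (msize_deriv l psid).
have T0 : vmultiple (L 0) (cross (cst (g 0)) (w1 - gradv psi)) by apply: psiT; rewrite ?w1E.
have psiM j : j != 0 -> j != 1 -> multiple (L j) psi.
  move=> j0 j1; have -> : psi = psi - (ev (v 1) psi)%:MP by rewrite psi1 mpolyC0 subr0.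
  apply: euler_multiple; first by apply: euler_bary.
  by rewrite psiE; apply: (dot_multiple _ w1d); [rewrite eq_sym|exact: w1T].
(* The radial derivative of [psi] about a vertex common to the faces 0 and 1 lies in
   the ideal of their edge, by the trace conditions of [w1] on the one and of
   [w1 - gradv psi] on the other. *)
have psi01 : ideal2 (L 0) (L 1) psi.
  have e0 : ev (v 2) psi = 0.
    have [q ->] : multiple (L 3) psi by apply: psiM.
    by rewrite /ev mevalM -/(ev _ _) ev_bary // mul0r.
  have -> : psi = psi - (ev (v 2) psi)%:MP by rewrite e0 mpolyC0 subr0.
  apply: euler_ideal2; [exact: euler_bary|exact: euler_bary|].
  have -> : euler (v 2) psi = dot (position (v 2)) w1 - dot (position (v 2)) (w1 - gradv psi).
    by rewrite /euler /dot !sum3 !entryE; ring.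
  have [q ->] : multiple (L 1) (dot (position (v 2)) w1).
    by apply: (dot_multiple _ w1d); [|exact: w1T].
  have [r ->] : multiple (L 0) (dot (position (v 2)) (w1 - gradv psi)).
    exact: (dot_multiple _ w2d).
  by exists (- r), q; ring.
pose s : seq 'I_4 := [:: 1; 2; 3].
have s3 j : j != 0 -> j \in s by case: j => -[|[|[|[|]]]].
have [q [r [psiD qd]]] : exists q r, psi = (\prod_(j <- s) L j) * q + L 0 * r /\
    (msize q <= d.+2 - size s)%N.
  apply: edge_division => // j; rewrite !inE => /or3P [] /eqP -> //.
    have [q ->] : multiple (L 2) psi by apply: psiM.
    by exists 0, q; ring.
  have [q ->] : multiple (L 3) psi by apply: psiM.
  by exists 0, q; ring.
(* [h] agrees with [psi] on the face 0 and vanishes on the others, so it corrects the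
   tangential trace on the face 0 and preserves it elsewhere. *)
pose h := (\prod_(j <- s) L j) * q.
have hd : (msize h <= d.+2)%N.
  rewrite -(subnKC (_ : 3 <= d.+2)%N) //; apply: msize_leM => //.
  exact: (msize_prod_bary v s).
exists (w1 - gradv h); split.
- move=> l; rewrite [X in msize X]entryD; apply: msize_leD; first exact: w1d.
  by rewrite !entryE; apply: msize_leN; exact: (msize_deriv l hd).
- by rewrite curlvB curlv_grad subr0.
- move=> j; have [->|j0] := eqVneq j 0.
    have -> : h = psi - L 0 * r by rewrite psiD /h addrK.
    rewrite gradvB opprB addrC -addrA [_ + w1]addrC crossDr.
    by apply: vmultipleD; [exact: cross_grad_multiple|exact: T0].
  rewrite crossB; apply: vmultipleB; first exact: w1T.
  have -> : h = L j * ((\prod_(k <- rem j s) L k) * q).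
    by rewrite /h (big_rem j (s3 j j0)) /= mulrA.
  exact: cross_grad_multiple.
Qed.

(** On each plane a field without tangential trace is a multiple of the normal;
    the coefficient vanishes on the edges of the face, because two normals are
    independent there. *)
Lemma tangent_free_decomposition d w : vmsize_le d w -> tangent_free w ->
  exists2 om : 'I_4 -> {mpoly R[3]}, forall i, (msize (om i) <= d - 3)%N &
  forall i, exists z, w = (coface v i * om i) *: cst (g i) + L i *: z.
Proof.
move=> wd wT.
have H i : exists om, (msize om <= d)%N /\ exists z, w = om *: cst (g i) + L i *: z.
  by have [om [z [wE omd]]] := tangent_free_face wd (wT i); exists om; split=> //; exists z.
have [om omP] := fin_all_exists H.
have omE i j : i != j -> ideal2 (L i) (L j) (om i).
  move=> ij; have [m mi mj] := other2 i j.
  have [_ [zi wi]] := omP i; have [_ [zj wj]] := omP j.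
  pose t := cst (v i - v m).
  have ti : dot (cst (g i)) t = 1.
    by rewrite dot_grad_edge eqxx (negPf mi) subr0 mpolyC1.
  have tj : dot (cst (g j)) t = 0.
    by rewrite dot_grad_edge (negPf ij) (negPf mj) subr0 mpolyC0.
  exists (- dot zi t), (dot zj t).
  have dE p k z : dot (p *: cst (g k) + L k *: z) t = p * dot (cst (g k)) t + L k * dot z t.
    by rewrite /dot !sum3 !entryE; ring.
  have wti : dot w t = om i + L i * dot zi t by rewrite {1}wi dE ti mulr1.
  have wtj : dot w t = L j * dot zj t by rewrite {1}wj dE tj mulr0 add0r.
  by rewrite -wtj wti; ring.
have H' i : exists om', (msize om' <= d - 3)%N /\
    exists z, w = (coface v i * om') *: cst (g i) + L i *: z.
  have [omd [z wE]] := omP i.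
  pose s := [seq j <- index_enum 'I_4 | j != i].
  have ss : size s = 3.
    rewrite /s size_filter; have := count_predC (pred1 i) (index_enum 'I_4).
    have -> : count (pred1 i) (index_enum 'I_4) = 1%N.
      by rewrite count_uniq_mem ?index_enum_uniq // mem_index_enum.
    by rewrite (_ : size (index_enum 'I_4) = 4) ?add1n => [[//]|]; rewrite -[index_enum _]enumT -cardE card_ord.
  have [q [r [qE qd]]] : exists q r, om i = (\prod_(j <- s) L j) * q + L i * r /\
      (msize q <= d - size s)%N.
    apply: edge_division => //.
    - by rewrite filter_uniq ?index_enum_uniq.
    - by rewrite mem_filter eqxx.
    - by move=> j; rewrite mem_filter => /andP [ji _]; apply: omE; rewrite eq_sym.
  exists q; split; first by rewrite ss in qd.
  exists (r *: cst (g i) + z).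
  rewrite wE qE /coface big_filter scalerDl scalerDr -!scalerA addrA.
  by rewrite (scalerA (L i)).
have [om' om'P] := fin_all_exists H'; exists om' => i; by case: (om'P i).
Qed.

Lemma coface_multiple i j : i != j -> multiple (L i) (coface v j).
Proof. by move=> ij; rewrite (@cofaceE _ _ j i) 1?eq_sym //; exact: multiple_refl. Qed.

Lemma split3 (V : zmodType) (x y z : V) : x = y + z + (x - y - z).
Proof. by rewrite -[x - y - z]addrA -opprD [RHS]addrC subrK. Qed.

(** Near an edge the normal parts on its two faces can be subtracted together, because
    the coefficient for one face vanishes on the other. *)
Lemma edge_form w (om : 'I_4 -> {mpoly R[3]}) i j : i != j ->
  (forall i, exists z, w = (coface v i * om i) *: cst (g i) + L i *: z) ->
  exists z, w = (coface v i * om i) *: cst (g i) + (coface v j * om j) *: cst (g j)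
                + (L i * L j) *: z.
Proof.
move=> ij wE.
pose u := w - (coface v i * om i) *: cst (g i) - (coface v j * om j) *: cst (g j).
suff /vmultipleP [z zE] : vmultiple (L i * L j) u.
  by exists z; rewrite -zE; exact: split3.
move=> l; have ui : multiple (L i) (u l 0).
  have [z zE] := wE i; have [c cE] := coface_multiple ij.
  exists (z l 0 - c * om j * cst (g j) l 0); rewrite /u {1}zE cE.
  move: (coface v i * om i) (L i) (om j) (cst (g i)) (cst (g j)) => p A q x y.
  by rewrite !entryE; ring.
have uj : multiple (L j) (u l 0).
  have [z zE] := wE j; have [c cE] : multiple (L j) (coface v i).
    by apply: coface_multiple; rewrite eq_sym.
  exists (z l 0 - c * om i * cst (g i) l 0); rewrite /u {1}zE cE.
  move: (coface v j * om j) (L j) (om i) (cst (g i)) (cst (g j)) => p A q x y.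
  by rewrite !entryE; ring.
rewrite (_ : L i * L j = \prod_(k <- [:: i; j]) L k); last first.
  by rewrite !big_cons big_nil mulr1.
apply: (multiple_prod vI) => [|k]; first by rewrite /= inE ij.
by rewrite !inE => /orP [] /eqP ->.
Qed.

(** A vector dual to the cross product of two normals; it makes that product cancellable. *)
Lemma cross_grad_unit i j m : i != j -> m != i -> m != j ->
  dot (cross (cst (v i - v m)) (cst (v j - v m))) (cross (cst (g i)) (cst (g j))) = 1.
Proof.
move=> ij mi mj.
have H (x x' a a' : vfield R) : dot (cross x x') (cross a a') =
    dot a x * dot a' x' - dot a x' * dot a' x.
  by rewrite /dot !sum3 !entryE ?ord3D; ring.
rewrite H !dot_grad_edge !eqxx (negPf mi) (negPf mj) (negPf ij) eq_sym (negPf ij).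
by rewrite !subr0 mpolyC0 mpolyC1; ring.
Qed.

(** Only the terms that differentiate one of the two vanishing factors survive. *)
Lemma curl_on_edge w z (om : 'I_4 -> {mpoly R[3]}) i j
    (rho : {rmorphism {mpoly R[3]} -> {mpoly R[3]}}) l : i != j ->
  (forall c, rho c%:MP = c%:MP) -> rho (L i) = 0 -> rho (L j) = 0 ->
  w = (coface v i * om i) *: cst (g i) + (coface v j * om j) *: cst (g j)
      + (L i * L j) *: z ->
  rho (curlv w l 0) = rho (coedge v i j) * rho (om j - om i) *
                      cross (cst (g i)) (cst (g j)) l 0.
Proof.
move=> ij rc ri rj ->; rewrite (cofaceE _ ij) (@cofaceE _ _ j i) 1?eq_sym // (coedgeC _ j i).
have di := deriv_bary v i; have dj := deriv_bary v j.
move: (L i) (L j) (g i) (g j) (coedge v i j) (om i) (om j) ri rj di dj.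
move=> A B a c be o1 o2 rA rB dA dB.
rewrite !entryE !(mderivD, mderivM, mderivC, dA, dB).
rewrite !(rmorphB, rmorphD, rmorphM) /= !rA !rB !rc; ring.
Qed.

Lemma tangent_free_edge_free w : tangent_free w -> edge_free w.
Proof.
move=> wT i j ij l.
have [d wd] : exists d, vmsize_le d w.
  by exists (\max_l msize (w l 0%R))%N => m; exact: (leq_bigmax m).
have [om _ wE] := tangent_free_decomposition wd wT.
have [z ->] := edge_form ij wE.
rewrite (cofaceE _ ij) (@cofaceE _ _ j i) 1?eq_sym //.
exists (coedge v j i * om j * cst (g j) l 0 + L j * z l 0),
  (coedge v i j * om i * cst (g i) l 0).
move: (L i) (L j) (coedge v j i) (coedge v i j) (om i) (om j) (cst (g i)) (cst (g j)).
by move=> A B be be' p q x y; rewrite !entryE; ring.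
Qed.

Lemma grad_bubble i : gradv b = coface v i *: cst (g i) + L i *: gradv (coface v i).
Proof. by rewrite (bubbleE v i) gradvM gradv_bary. Qed.

(** If moreover the curl vanishes on the edges, the normal coefficients on the four
    faces, divided by the normal derivative of the bubble, agree on the edges, hence
    come from one polynomial [phi]. *)
Lemma tangent_free_bubble d w : vmsize_le d w -> tangent_free w -> edge_free (curlv w) ->
  exists phi z, w = phi *: gradv b + b *: z /\ (msize phi <= d - 3)%N.
Proof.
move=> wd wT cw; have [om omd wE] := tangent_free_decomposition wd wT.
have omC i j : i != j -> ideal2 (L i) (L j) (om i - om j).
  move=> ij; have [rho [rc rp]] := edge_hom vI ij; apply/rp.
  have ri : rho (L i) = 0 by apply/rp; exists 1, 0; ring.
  have rj : rho (L j) = 0 by apply/rp; exists 0, 1; ring.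
  have [z zE] := edge_form ij wE; have [m mi mj] := other2 i j.
  have e l : rho (coedge v i j) * rho (om j - om i) * cross (cst (g i)) (cst (g j)) l 0 = 0.
    by rewrite -(curl_on_edge l ij rc ri rj zE); apply/rp; exact: cw.
  have : rho (coedge v i j) * rho (om j - om i) = 0.
    rewrite -[LHS]mulr1 -(cross_grad_unit ij mi mj) /dot mulr_sumr big1 // => l _.
    by rewrite mulrCA e mulr0.
  rewrite -rmorphM => /rp /(edge_prime_coedge vI ij) /rp.
  by rewrite !rmorphB => /eqP; rewrite subr_eq0 => /eqP ->; rewrite subrr.
have [phi phid phiE] := extend_faces vI omd omC.
exists phi; suff /vmultipleP [z zE] : vmultiple b (w - phi *: gradv b).
  by exists z; split=> //; rewrite -zE addrC subrK.
move=> l; apply: multiple_bubble => // i.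
have [z ->] := wE i; rewrite (grad_bubble i); have [q qE] := phiE i.
have -> : phi = om i + L i * q by rewrite -qE addrC subrK.
exists (z l 0 - q * coface v i * cst (g i) l 0 - (om i + L i * q) * gradv (coface v i) l 0).
move: (L i) (om i) (coface v i) (cst (g i)) (gradv (coface v i)) => A p co x y.
by rewrite !entryE; ring.
Qed.

Lemma msize_bubble_le : (msize b <= 5)%N.
Proof.
have := msize_prod_bary v (index_enum 'I_4).
by rewrite (_ : size (index_enum 'I_4) = 4) // -[index_enum _]enumT -cardE card_ord.
Qed.

Lemma msize_bubble : msize b = 5.
Proof.
have H (s : seq 'I_4) : (size s < msize (\prod_(j <- s) L j)%R)%N.
  elim: s => [|j s IH]; first by rewrite big_nil msize1.
  have L1 := bary_nonconst vI j.
  rewrite big_cons msizeM ?bary_neq0 //; last by apply: contraTneq IH => ->; rewrite msize0.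
  by move: L1 IH; rewrite /=; move: (msize _) (msize _) (size s) => a c e; lia.
apply/eqP; rewrite eqn_leq msize_bubble_le.
have := H (index_enum 'I_4).
by rewrite (_ : size (index_enum 'I_4) = 4) // -[index_enum _]enumT -cardE card_ord.
Qed.

Lemma bubble_neq0 : b != 0.
Proof. by apply/eqP => b0; have := msize_bubble; rewrite b0 msize0. Qed.

Lemma msize_bubbleM d p : (msize p <= d)%N -> (msize (b * p)%R <= 4 + d)%N.
Proof. by move=> pd; apply: msize_leM => //; rewrite msize_bubble. Qed.

Lemma msize_bubble_div d p : (msize (b * p)%R <= 4 + d)%N -> (msize p <= d)%N.
Proof. by apply: msize_divl; rewrite msize_bubble. Qed.

Lemma vmsize_bubble_div d w : vmsize_le (4 + d) (b *: w) -> vmsize_le d w.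
Proof. by move=> wd l; apply: msize_bubble_div; have := wd l; rewrite mxE. Qed.

(** Write a potential without tangential trace as [phi *: gradv b + b *: z] and subtract
    the gradient of [b * phi]. *)
Lemma bubble_potential d y : vmsize_le d.+4 y -> divv y = 0 -> normal_free y ->
  edge_free y -> exists2 w, curlv (b *: w) = y & vmsize_le d.+1 w.
Proof.
move=> yd dy yn ye; have [//|w [wd wE wT]] := relative_potential _ yd dy yn.
rewrite -wE in ye; have [phi [z [zE phid]]] := tangent_free_bubble wd wT ye.
have e : b *: (z - gradv phi) = w - gradv (b * phi).
  rewrite gradvM scalerBr zE; move: (b *: z) (phi *: gradv b) (b *: gradv phi) => x x' x''.
  by rewrite opprD addrA [x' + x]addrC addrK.
exists (z - gradv phi); first by rewrite e curlvB curlv_grad subr0.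
apply: vmsize_bubble_div; rewrite e => l; rewrite !entryE; apply: msize_leB; first exact: wd.
apply: (@msize_deriv _ d.+4.+2); rewrite -[d.+4.+2]/(4 + d.+2)%N; apply: msize_bubbleM.
by apply: leq_trans phid _; rewrite !subSS subn0.
Qed.

(** On a face the hypothesis leaves only the cross product of [w] with the gradient of
    the bubble, which there is a multiple of the normal. *)
Lemma curl_bubble_tangent_free w y : curlv (b *: w) = b *: y -> tangent_free w.
Proof.
move=> wE i l; apply: (face_prime_coface vI).
have /matrixP/(_ l 0) := wE; rewrite curlvM (grad_bubble i) => e.
exists (coface v i * y l 0 - coface v i * curlv w l 0 - cross (gradv (coface v i)) w l 0).
move: e; rewrite (bubbleE v i); move: (L i) (coface v i) (gradv _) (curlv w) (cst (g i)).
move=> A B dB c a; rewrite !entryE => e.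
by rewrite !mulrBr (mulrA A) -e; ring.
Qed.

Lemma gradvM3 p q r : gradv (p * q * r) =
  (q * r) *: gradv p + (p * r) *: gradv q + (p * q) *: gradv r.
Proof.
rewrite (gradvM (p * q)) (gradvM p) scalerDr !scalerA (mulrC r q) (mulrC r p).
by [].
Qed.

(** Divided by the two planes of an edge, the gradient of the bubble crossed with [w]
    leaves there a copy of [curlv w]; together with the other term of [curlv (b *: w)]
    this gives twice the curl. *)
Lemma curl_bubble_edge_free w y : curlv (b *: w) = b *: y -> edge_free y ->
  edge_free (curlv w).
Proof.
move=> wE ye i j ij l; have wT := curl_bubble_tangent_free wE.
have [d wd] : exists d, vmsize_le d w.
  by exists (\max_l msize (w l 0%R))%N => m; exact: (leq_bigmax m).
have [om _ omE] := tangent_free_decomposition wd wT.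
have [z zE] := edge_form ij omE.
have [rho [rc rp]] := edge_hom vI ij.
have ri : rho (L i) = 0 by apply/rp; exists 1, 0; ring.
have rj : rho (L j) = 0 by apply/rp; exists 0, 1; ring.
have cE := curl_on_edge l ij rc ri rj zE.
have /matrixP/(_ l 0) := wE; rewrite curlvM (bubble_edge v ij).
rewrite gradvM3 !gradv_bary //.
rewrite {1}zE (cofaceE _ ij) (@cofaceE _ _ j i) 1?eq_sym // (coedgeC _ j i).
set B := coedge v i j in cE *; set c := curlv w in cE *.
rewrite entryD cross_on_edge !entryZ.
set X := (X in L i * L j * X + _) => e.
have XE : X + B * c l 0 = B * y l 0.
  apply: (mulfI (mulf_neq0 (bary_neq0 vI i) (bary_neq0 vI j))).
  by rewrite mulrDr !mulrA.
have : rho (B * (2%:R * c l 0)) = 0.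
  have -> : B * (2%:R * c l 0) = B * y l 0 + (B * c l 0 - X) by rewrite -XE; ring.
  have yl : rho (y l 0) = 0 by apply/rp; exact: ye.
  rewrite rmorphD rmorphM yl mulr0 add0r.
  by rewrite /X; apply: rmorph_edge => //; rewrite !entryE !(rmorphB, rmorphM) !rc.
move/rp/(edge_prime_coedge vI ij) => [q [r e']].
exists ((2^-1)%:MP * q), ((2^-1)%:MP * r).
transitivity ((2^-1)%:MP * (2%:R * c l 0)); first by rewrite mulr_natl Defs.halfK.
by rewrite e'; ring.
Qed.

Lemma normal_free_bubble w : normal_free (b *: w).
Proof.
move=> i; exists (coface v i * dot (cst (g i)) w); rewrite mulrA -bubbleE.
by rewrite /dot mulr_sumr; apply: eq_bigr => l _; rewrite entryZ mulrCA.
Qed.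

Lemma edge_free_bubble w : edge_free (b *: w).
Proof.
move=> i j ij l; rewrite entryZ (bubbleE v i).
by exists (coface v i * w l 0), 0; ring.
Qed.

(** As in [bubble_potential], from a potential [b *: w0] with [w0] of the form
    [phi *: gradv b + b *: z]; now half the gradient of [b ^+ 2 * phi] is subtracted. *)
Lemma bubble2_potential d y : vmsize_le d.+3 y -> divv (b *: y) = 0 ->
  edge_free y -> exists2 w, curlv (b ^+ 2 *: w) = b *: y & vmsize_le d w.
Proof.
move=> yd dy ye.
have [w0 w0E w0d] : exists2 w, curlv (b *: w) = b *: y & vmsize_le d.+4 w.
  apply: bubble_potential => //.
  - by move=> l; rewrite mxE; have := msize_bubbleM (yd l).
  - exact: normal_free_bubble.
  - exact: edge_free_bubble.
have w0T := curl_bubble_tangent_free w0E.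
have [phi [z [zE phid]]] := tangent_free_bubble w0d w0T (curl_bubble_edge_free w0E ye).
pose h : {mpoly R[3]} := (2^-1)%:MP.
have h2 : h * 2%:R = 1 by rewrite -[2%:R]mulr1 mulr_natl /h Defs.halfK.
have e : b ^+ 2 *: (z - h *: gradv phi) = b *: w0 - gradv (b ^+ 2 * (h * phi)).
  have -> : w0 = (h * 2%:R * phi) *: gradv b + b *: z by rewrite h2 mul1r.
  rewrite expr2 !gradvM; have -> : gradv h = 0.
    by apply/matrixP => l m; rewrite !entryE mderivC.
  have H (T : comNzRingType) (B p k : T) (dB dp x : 'cV[T]_3) :
      B * B *: (x - k *: dp) = B *: ((k * 2%:R * p) *: dB + B *: x) -
      ((k * p) *: (B *: dB + B *: dB) + B * B *: (p *: 0 + k *: dp)).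
    by apply/matrixP => l m; rewrite !mxE; ring.
  exact: H.
exists (z - h *: gradv phi); first by rewrite e curlvB curlv_grad subr0.
have phid' : (msize phi <= d.+1)%N by apply: leq_trans phid _; rewrite !subSS subn0.
have zd : vmsize_le d z.
  apply: vmsize_bubble_div => l.
  rewrite (_ : (b *: z) l 0 = w0 l 0 - phi * (gradv b) l 0); last first.
    by rewrite zE !entryE; ring.
  apply: msize_leB; first exact: w0d.
  rewrite mulrC -[(4 + d)%N]/(3 + d.+1)%N; apply: msize_leM => //.
  by rewrite mxE; apply: (@msize_deriv _ 5); rewrite msize_bubble.
move=> l; rewrite !entryE; apply: msize_leB; first exact: zd.
by apply: msize_leMC; exact: (msize_deriv l phid').
Qed.

End RelativeDeRham.

(** * Maps that preserve differences *)

Section SubtractiveMaps.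
Variables U V W : zmodType.
Implicit Types (f : U -> V) (g : V -> W).

Lemma subr_morph_comp g f : {morph g : x y / x - y} -> {morph f : x y / x - y} ->
  {morph (fun x => g (f x)) : x y / x - y}.
Proof. by move=> gB fB x y; rewrite fB gB. Qed.

Lemma subr_morph0 f : {morph f : x y / x - y} -> f 0 = 0.
Proof. by move=> fB; rewrite -(subrr 0) fB subrr. Qed.

Lemma subr_morphN f : {morph f : x y / x - y} -> {morph f : x / - x}.
Proof. by move=> fB x; rewrite -[- x]sub0r fB (subr_morph0 fB) sub0r. Qed.

Lemma subr_morphD f : {morph f : x y / x - y} -> {morph f : x y / x + y}.
Proof. by move=> fB x y; rewrite -{1}[y]opprK fB (subr_morphN fB) opprK. Qed.

Lemma subr_morph_can f (f' : V -> U) : cancel f f' -> cancel f' f ->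
  {morph f : x y / x - y} -> {morph f' : x y / x - y}.
Proof. by move=> fK f'K fB x y; apply: (can_inj fK); rewrite fB !f'K. Qed.

End SubtractiveMaps.

(** * The operators of the conformal complex *)

Section MatrixCalculus.
Variable R : realType.
Implicit Types (f p : {mpoly R[3]}) (u w : vfield R) (U V W : mfield R) (i j h l : 'I_3).

(** Twice the axial vector of the skew part: [vsk (mskw a)] is [2 a]. *)
Definition vsk U : vfield R := \col_i (U (i + 2) (i + 1) - U (i + 1) (i + 2)).

Definition rowv U h : vfield R := \col_j U h j.

Definition mmsize_le d U := forall i j, (msize (U i j) <= d)%N.

Lemma mat3P U V : (forall h, rowv U h = rowv V h) -> U = V.
Proof.
by move=> UV; apply/matrixP => i j; have /matrixP/(_ j 0) := UV i; rewrite !mxE.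
Qed.

Lemma rowv_curl U h : rowv (curl U) h = curlv (rowv U h).
Proof. by apply/matrixP => i j; rewrite !mxE. Qed.

Lemma rowv_grad u h : rowv (grad u) h = gradv (u h 0).
Proof. by apply/matrixP => i j; rewrite !mxE. Qed.

Lemma rowvB U V h : rowv (U - V) h = rowv U h - rowv V h.
Proof. by apply/matrixP => i j; rewrite !mxE. Qed.

Lemma rowvZ p U h : rowv (p *: U) h = p *: rowv U h.
Proof. by apply/matrixP => i j; rewrite !mxE. Qed.

Lemma rowv0 h : rowv 0 h = 0.
Proof. by apply/matrixP => i j; rewrite !mxE. Qed.

Lemma div_row U h : div U h 0 = divv (rowv U h).
Proof. by rewrite mxE; apply: eq_bigr => l _; rewrite mxE. Qed.

Lemma curlmB U V : curl (U - V) = curl U - curl V.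
Proof. by apply: mat3P => h; rewrite !(rowvB, rowv_curl) curlvB. Qed.

Lemma curlmD U V : curl (U + V) = curl U + curl V.
Proof. exact: (subr_morphD curlmB). Qed.

Lemma curlm0 : curl (0 : mfield R) = 0.
Proof. exact: (subr_morph0 curlmB). Qed.

Lemma curl_grad u : curl (grad u) = 0.
Proof. by apply: mat3P => h; rewrite rowv_curl rowv_grad curlv_grad rowv0. Qed.

Lemma div_curl U : div (curl U) = 0.
Proof.
apply/matrixP => h l; rewrite (ord1 l) div_row rowv_curl divv_curl mxE.
by [].
Qed.

Lemma divmB U V : div (U - V) = div U - div V.
Proof.
apply/matrixP => h l; rewrite !mxE -sumrB; apply: eq_bigr => i _.
by rewrite !mxE mderivB.
Qed.

Lemma div_opS U : div (opS U) = vsk (curl U).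
Proof.
apply/matrixP => h l; rewrite !mxE sum3 !mxE /mxtrace !sum3 !(mderivB, mderivD, mderivN).
move: h; apply: ord3_ind; rewrite !ord3D !ord3_eq ?eqxx /=;
  rewrite ?mulr0n ?mulr1n ?mderiv0 !(mderivB, mderivD, mderivN); ring.
Qed.

Lemma tr_curl U : \tr (curl U) = divv (vsk U).
Proof.
rewrite /mxtrace /divv !sum3 !mxE !ord3D !mderivB; ring.
Qed.

Lemma curl_mskw w : curl (mskw w) = - opS (grad w).
Proof.
apply/matrixP => h l; rewrite !mxE /mxtrace !sum3 !mxE.
move: h l; apply: ord3_ind; apply: ord3_ind; rewrite !ord3D !ord3_eq ?eqxx /=;
  rewrite ?mulr0n ?mulr1n ?mderiv0 ?mderivN; ring.
Qed.

Lemma curl_scalar f : curl (f%:M) = - mskw (gradv f).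
Proof.
apply/matrixP => h l; rewrite !mxE.
move: h l; apply: ord3_ind; apply: ord3_ind; rewrite !ord3D !ord3_eq ?eqxx /=;
  rewrite ?mulr0n ?mulr1n ?mderiv0 ?mderivN; ring.
Qed.

Lemma div_mskw w : div (mskw w) = - curlv w.
Proof.
apply/matrixP => h l; rewrite !mxE !sum3 !mxE.
move: h; apply: ord3_ind; rewrite !ord3D !ord3_eq ?eqxx /= ?mderiv0 ?mderivN; ring.
Qed.

Lemma mskw_tr w : (mskw w)^T = - mskw w.
Proof.
apply/matrixP => h l; rewrite !mxE.
move: h l; apply: ord3_ind; apply: ord3_ind; rewrite !ord3D !ord3_eq ?eqxx /=; ring.
Qed.

Lemma tr_mskw w : \tr (mskw w) = 0.
Proof.
by rewrite /mxtrace sum3 !mxE !ord3D !ord3_eq !addr0.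
Qed.

Lemma opS_mskw w : opS (mskw w) = - mskw w.
Proof. by rewrite /opS mskw_tr tr_mskw raddf0 subr0. Qed.

Lemma entry_opS U h l : opS U h l = U l h - \tr U *+ (h == l).
Proof. by rewrite !mxE. Qed.

Lemma opSB U V : opS (U - V) = opS U - opS V.
Proof.
apply/matrixP => h l; rewrite (entryD (opS U)) (entryN (opS V)) !entry_opS [\tr (U - V)]raddfB.
by rewrite mulrnBl (entryD U) (entryN V) /=; ring.
Qed.

Lemma opSD U V : opS (U + V) = opS U + opS V.
Proof. exact: (subr_morphD opSB). Qed.

Lemma opSN U : opS (- U) = - opS U.
Proof. exact: (subr_morphN opSB). Qed.

Lemma opSinvB U V : opSinv (U - V) = opSinv U - opSinv V.
Proof. exact: (subr_morph_can (@opSK R) (@opSinvK R) opSB). Qed.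

Lemma opSinvN U : opSinv (- U) = - opSinv U.
Proof. exact: (subr_morphN opSinvB). Qed.

Lemma opSinv0 : opSinv (0 : mfield R) = 0.
Proof. exact: (subr_morph0 opSinvB). Qed.

Lemma opSinv_mskw w : opSinv (mskw w) = - mskw w.
Proof. by apply: (can_inj (@opSK R)); rewrite opSN !opSinvK opS_mskw opprK. Qed.

Lemma opSZ p U : opS (p *: U) = p *: opS U.
Proof. by rewrite /opS linearZ /= mxtraceZ scalerBr scale_scalar_mx. Qed.

Lemma mskwZ p w : mskw (p *: w) = p *: mskw w.
Proof.
apply/matrixP => h l; rewrite !mxE; case: ifP => _ //; case: ifP => _.
  by rewrite mulrN.
by rewrite mulr0.
Qed.

Lemma vskZ p U : vsk (p *: U) = p *: vsk U.
Proof. by apply/matrixP => h l; rewrite !mxE mulrBr. Qed.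

Lemma vsk_opS U : vsk (opS U) = - vsk U.
Proof.
apply/matrixP => h l; rewrite !mxE.
move: h; apply: ord3_ind; rewrite !ord3D !ord3_eq /= !mulr0n; ring.
Qed.

Lemma vsk0P U : vsk U = 0 <-> U^T = U.
Proof.
split=> [/matrixP U0|/matrixP US].
  have e h : U (h + 2) (h + 1) = U (h + 1) (h + 2).
    by have := U0 h 0; rewrite !mxE => /eqP; rewrite subr_eq0 => /eqP.
  have := e 0; have := e 1; have := e 2; rewrite !ord3D => e2 e1 e0.
  by apply/matrixP; apply: ord3_ind; apply: ord3_ind; rewrite mxE.
apply/matrixP => h l; have := US (h + 1) (h + 2).
by rewrite !mxE => ->; rewrite subrr.
Qed.

(** [cott] is blind to skew and to scalar fields: one curl turns the former into
    [opS] of a gradient and the latter into a skew field. *)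
Lemma inc_mskw w : curl (opSinv (curl (mskw w))) = 0.
Proof. by rewrite curl_mskw opSinvN opSK -sub0r curlmB curl_grad subr0 curlm0. Qed.

Lemma cott_mskw w : cott (mskw w) = 0.
Proof.
transitivity (curl (opSinv (0 : mfield R))); last by rewrite opSinv0 curlm0.
exact: (congr1 (fun V => curl (opSinv V)) (inc_mskw w)).
Qed.

Lemma cott_scalar f : cott (f%:M) = 0.
Proof.
by rewrite /cott curl_scalar opSinvN opSinv_mskw opprK inc_mskw.
Qed.

Lemma cottB U V : cott (U - V) = cott U - cott V.
Proof.
exact: (subr_morph_comp curlmB (subr_morph_comp opSinvB
  (subr_morph_comp curlmB (subr_morph_comp opSinvB curlmB)))).
Qed.

Lemma cottD U V : cott (U + V) = cott U + cott V.
Proof. exact: (subr_morphD cottB). Qed.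

Lemma cott_grad u : cott (grad u) = 0.
Proof.
by rewrite /cott curl_grad !(opSinv0, curlm0).
Qed.

(** Sealed, because conversion would otherwise unfold it at every comparison of two
    matrix fields. *)
Definition devsym : mfield R -> mfield R := locked (fun U => dev (sym U)).

Lemma devsymE U : devsym U = dev (sym U). Proof. by rewrite /devsym -lock. Qed.

Lemma devdefE u : devdef u = devsym (grad u). Proof. by rewrite devsymE. Qed.

Lemma entry_devsym U h l : devsym U h l =
  (2^-1)%:MP * (U h l + U l h) - (3^-1)%:MP * (\tr U *+ (h == l)).
Proof.
rewrite devsymE !mxE [\tr (sym U)]mxtraceZ mxtraceD mxtrace_tr -mulr2n Defs.halfK.
by [].
Qed.

Lemma devsymB U V : devsym (U - V) = devsym U - devsym V.
Proof.
apply/matrixP => h l; rewrite (entryD (devsym U)) (entryN (devsym V)).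
rewrite (entry_devsym (U - V)) (entry_devsym U) (entry_devsym V).
by rewrite [\tr (U - V)]raddfB /= mulrnBl 2!(entryD U) 2!(entryN V); ring.
Qed.

Lemma devsymD U V : devsym (U + V) = devsym U + devsym V.
Proof. exact: (subr_morphD devsymB). Qed.

Lemma devsymZ p U : devsym (p *: U) = p *: devsym U.
Proof.
apply/matrixP => h l; rewrite (entryZ p (devsym U)) (entry_devsym (p *: U)) (entry_devsym U).
by rewrite mxtraceZ -mulrnAr 2!(entryZ p U); ring.
Qed.

Lemma devsym_trmx U : devsym U^T = devsym U.
Proof.
apply/matrixP => h l; rewrite (entry_devsym U^T) (entry_devsym U) mxtrace_tr.
have E m n : U^T m n = U n m by rewrite mxE.
by rewrite 2!E [U l h + _]addrC.
Qed.

Lemma thirdK p : (3^-1)%:MP * (p *+ 3) = p.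
Proof.
rewrite -[p *+ 3]mulr_natl mulrA -mpolyC_nat -mpolyCM mulVf ?pnatr_eq0 //.
by rewrite mpolyC1 mul1r.
Qed.

Lemma tr_devsym U : \tr (devsym U) = 0.
Proof.
rewrite {1}/mxtrace sum3 3!entry_devsym !eqxx !mulr1n -!mulr2n !Defs.halfK.
transitivity (\tr U - (3^-1)%:MP * (\tr U *+ 3)); last by rewrite thirdK subrr.
by rewrite {4}/mxtrace sum3; ring.
Qed.

Lemma devsym_sym U : (devsym U)^T = devsym U.
Proof.
apply/matrixP => h l; rewrite mxE !entry_devsym eq_sym; ring.
Qed.

Lemma devsym_id U : U^T = U -> \tr U = 0 -> devsym U = U.
Proof.
move=> US Ut; apply/matrixP => h l; rewrite entry_devsym Ut mul0rn mulr0 subr0.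
by rewrite -[in U l h]US mxE -mulr2n Defs.halfK.
Qed.

Lemma devsym_mskw w : devsym (mskw w) = 0.
Proof.
apply/matrixP => h l; rewrite entry_devsym tr_mskw mul0rn mulr0 subr0.
have -> : mskw w l h = - mskw w h l.
  by have /matrixP/(_ h l) := mskw_tr w; rewrite mxE entryN.
by rewrite subrr mulr0 entry0.
Qed.

Lemma devsym_scalar f : devsym (f%:M) = 0.
Proof.
apply/matrixP => h l; rewrite entry_devsym mxtrace_scalar entry0.
have E m n : (f%:M : mfield R) m n = f *+ (m == n) by rewrite mxE.
by rewrite !E [l == h]eq_sym -mulr2n Defs.halfK mulrnAC thirdK subrr.
Qed.

(** What [devsym] removes is a skew and a scalar field, and [cott] annihilates both;
    so [cott] need not distinguish a field from its symmetric traceless part. *)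
Lemma devsym_split U : exists w f, U = devsym U + mskw w + f%:M.
Proof.
exists (\col_i ((2^-1)%:MP * (U (i + 2) (i + 1) - U (i + 1) (i + 2)))), ((3^-1)%:MP * \tr U).
apply/matrixP => h l; rewrite !entryD entry_devsym [X in _ + X]mxE mulrnAr.
rewrite [LHS](_ : _ = (2^-1)%:MP * (2%:R * U h l)); last first.
  by rewrite mulr_natl Defs.halfK.
rewrite mxE; move: h l; apply: ord3_ind; apply: ord3_ind;
  rewrite !ord3D !ord3_eq ?eqxx /= ?mxE ?ord3D; ring.
Qed.

Lemma cott_devsym U : cott (devsym U) = cott U.
Proof.
have [w [f {2}->]] := devsym_split U.
by rewrite !cottD cott_mskw cott_scalar !addr0.
Qed.

Lemma cott_devdef u : cott (devdef u) = 0.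
Proof. by rewrite devdefE cott_devsym cott_grad. Qed.

(** A field is symmetric exactly when [vsk] annihilates it, and the [vsk] of a curl is
    the divergence of an [opS]; here [opS] cancels the preceding [opSinv]. *)
Lemma cott_sym U : (cott U)^T = cott U.
Proof. by apply/vsk0P; rewrite /cott -div_opS opSinvK div_curl. Qed.

(** The trace of a curl is the divergence of a [vsk], which is again a divergence of a
    curl, as in [cott_sym]. *)
Lemma cott_tr U : \tr (cott U) = 0.
Proof.
rewrite /cott tr_curl; set Y := opSinv (curl U).
have -> : vsk (opSinv (curl Y)) = - div (opS Y).
  by rewrite div_opS -[in RHS](opSinvK (curl Y)) vsk_opS opprK.
rewrite /Y opSinvK div_curl oppr0 /divv big1 // => l _.
by rewrite mxE mderiv0.
Qed.

Lemma div_cott U : div (cott U) = 0.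
Proof. exact: div_curl. Qed.

Lemma mmsize_curl d U : mmsize_le d U -> mmsize_le d.-1 (curl U).
Proof. by move=> Ud h l; rewrite mxE; apply: msize_leB; exact: msize_deriv. Qed.

Lemma mmsize_tr d U : mmsize_le d U -> (msize (\tr U) <= d)%N.
Proof. by move=> Ud; apply: msize_le_sum => h _; exact: Ud. Qed.

Lemma msize_leMn d p (c : bool) : (msize p <= d)%N -> (msize (p *+ c)%R <= d)%N.
Proof. by case: c; rewrite ?mulr1n ?mulr0n ?msize0. Qed.

Lemma mmsize_opSinv d U : mmsize_le d U -> mmsize_le d (opSinv U).
Proof.
move=> Ud h l; rewrite !mxE; apply: msize_leB; first exact: Ud.
by apply: msize_leMC; apply: msize_leMn; exact: mmsize_tr.
Qed.

Lemma mmsize_opS d U : mmsize_le d U -> mmsize_le d (opS U).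
Proof.
move=> Ud h l; rewrite entry_opS; apply: msize_leB; first exact: Ud.
by apply: msize_leMn; exact: mmsize_tr.
Qed.

Lemma mmsize_devsym d U : mmsize_le d U -> mmsize_le d (devsym U).
Proof.
move=> Ud h l; rewrite entry_devsym; apply: msize_leB; apply: msize_leMC.
  exact: msize_leD.
by apply: msize_leMn; exact: mmsize_tr.
Qed.

Lemma mmsize_cott d U : mmsize_le d U -> mmsize_le (d - 3) (cott U).
Proof.
move=> Ud; have -> : (d - 3)%N = d.-1.-1.-1 by lia.
by do 2![apply: mmsize_curl; apply: mmsize_opSinv]; exact: mmsize_curl.
Qed.

Lemma mmsize_devdef d u : vmsize_le d u -> mmsize_le d.-1 (devdef u).
Proof.
by move=> ud; rewrite devdefE; apply: mmsize_devsym => h l; rewrite mxE; exact: msize_deriv.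
Qed.

Lemma rows_choice (Q : 'I_3 -> vfield R -> Prop) : (forall h, exists w, Q h w) ->
  exists U, forall h, Q h (rowv U h).
Proof.
move=> H; have [F FP] := fin_all_exists H.
exists (\matrix_(h, l) F h l 0) => h.
by rewrite (_ : rowv _ h = F h) //; apply/matrixP => l m; rewrite !mxE (ord1 m).
Qed.

Lemma mmsize_rows d U : (forall h, vmsize_le d (rowv U h)) <-> mmsize_le d U.
Proof. by split=> Ud h l; have := Ud h l; rewrite mxE. Qed.

Lemma curl_free_gradm d U : mmsize_le d U -> curl U = 0 ->
  exists2 u, U = grad u & vmsize_le d.+1 u.
Proof.
move=> /mmsize_rows Ud U0.
have H h : exists f, rowv U h = gradv f /\ (msize f <= d.+1)%N.
  have [|f fE fd] := @curl_free_grad _ (rowv U h) d (Ud h).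
    by rewrite -rowv_curl U0 rowv0.
  by exists f.
have [F FP] := fin_all_exists H.
exists (\col_h F h).
  by apply: mat3P => h; rewrite rowv_grad mxE; case: (FP h).
by move=> h; rewrite mxE; case: (FP h).
Qed.

(** The polynomial conformal complex is exact at its second term. Each curl is undone by
    a gradient; what [opSinv] leaves over is a skew field, absorbed one step further
    up, and finally a scalar field. [devsym] discards both. *)
Lemma cott_free_devdef d U : mmsize_le d.+2 U -> U^T = U -> \tr U = 0 -> cott U = 0 ->
  exists2 u, U = devdef u & vmsize_le d.+3 u.
Proof.
move=> Ud US Ut; rewrite /cott; set Y := opSinv (curl U); set X := opSinv (curl Y) => X0.
have Yd : mmsize_le d.+1 Y by apply: mmsize_opSinv; exact: (mmsize_curl Ud).
have Xd : mmsize_le d X by apply: mmsize_opSinv; exact: (mmsize_curl Yd).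
have [f fE fd] := curl_free_gradm Xd X0.
have mskwd e w : vmsize_le e w -> mmsize_le e (mskw w).
  move=> wd h l; rewrite mxE; case: ifP => _ //; case: ifP => _; last by rewrite msize0.
  by apply: msize_leN.
have [g gE gd] : exists2 g, Y + mskw f = grad g & vmsize_le d.+2 g.
  apply: curl_free_gradm => [h l|].
    by rewrite entryD; apply: msize_leD; [exact: Yd|exact: mskwd].
  by rewrite curlmD curl_mskw -fE opSinvK subrr.
have UE : curl (U + mskw g) = mskw f.
  rewrite curlmD curl_mskw -gE opSD opS_mskw opSinvK.
  by rewrite opprD opprK addrA subrr add0r.
have cf : curlv f = 0.
  by apply/eqP; rewrite -oppr_eq0 -div_mskw -UE div_curl.
have [psi psiE psid] := curl_free_grad fd cf.
have [u uE ud] : exists2 u, U + mskw g + psi%:M = grad u & vmsize_le d.+3 u.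
  apply: curl_free_gradm => [h l|].
    rewrite !entryD; apply: msize_leD; first by apply: msize_leD; [exact: Ud|exact: mskwd].
    by rewrite mxE; exact: msize_leMn.
  by rewrite curlmD UE curl_scalar psiE subrr.
exists u => //; rewrite devdefE -uE !devsymD devsym_mskw devsym_scalar !addr0.
by rewrite devsym_id.
Qed.

End MatrixCalculus.

(** * Linear algebra at edges and faces *)

Section MatrixAlgebra.
Variable T : comNzRingType.
Implicit Types (a g w x : 'cV[T]_3) (M D Q : 'M[T]_3).

Lemma cross_cross_row g a x l : cross x (cross g a) l 0 =
  g l 0 * (\sum_m a m 0 * x m 0) - a l 0 * (\sum_m g m 0 * x m 0).
Proof.
rewrite !sum3 !mxE; move: l; apply: ord3_ind; rewrite !ord3D; ring.
Qed.

Lemma mskwD w x : mskw (w + x) = mskw w + mskw x.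
Proof.
apply/matrixP => h l; rewrite !mxE; case: ifP => _ //; case: ifP => _.
  by rewrite opprD.
by rewrite addr0.
Qed.

(** A symmetric matrix whose rows are orthogonal to [g] and [a] is a multiple of the
    square of [t = cross g a]; the trace of that multiple is what must vanish. *)
Lemma sym_traceless_kernel M g a (t := cross g a) (s := \sum_l t l 0 ^+ 2) :
  M^T = M -> \tr M = 0 ->
  (forall h, \sum_l g l 0 * M h l = 0) -> (forall h, \sum_l a l 0 * M h l = 0) ->
  forall h l, s ^+ 3 * M h l = 0.
Proof.
move=> MS Mt Mg Ma.
have sy h l : M h l = M l h by rewrite -[in LHS]MS mxE.
have par h m n : t m 0 * M h n = t n 0 * M h m.
  have colE k : (\col_m M h m) k 0 = M h k by rewrite mxE.
  have c0 (l : 'I_3) : cross (\col_m M h m) t l 0 = 0.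
    rewrite /t cross_cross_row.
    under eq_bigr => k _ do rewrite colE.
    under [in X in _ - X]eq_bigr => k _ do rewrite colE.
    by rewrite Ma Mg !mulr0 subrr.
  have e (l : 'I_3) : M h (l + 1) * t (l + 2) 0 = M h (l + 2) * t (l + 1) 0.
    by have := c0 l; rewrite [LHS]mxE !colE => /eqP; rewrite subr_eq0 => /eqP.
  have := e 0; have := e 1; have := e 2; rewrite !ord3D => e2 e1 e0.
  move: m n; apply: ord3_ind; apply: ord3_ind; rewrite // ![t _ 0 * _]mulrC //.
pose q := \sum_m \sum_n t m 0 * t n 0 * M m n.
have q2 h l : s ^+ 2 * M h l = t h 0 * t l 0 * q.
  rewrite expr2 -mulrA /q /s !sum3.
  have e m n : t m 0 ^+ 2 * (t n 0 ^+ 2 * M h l) = t h 0 * t l 0 * (t m 0 * t n 0 * M n m).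
    transitivity (t m 0 * t n 0 * (t m 0 * (t n 0 * M h l))); first by ring.
    rewrite par (mulrCA (t m 0)) sy par; ring.
  rewrite !mulrDl !mulrDr !e; ring.
have q1 : s * q = 0.
  have := congr1 (fun y : T => s ^+ 2 * y) Mt; rewrite mulr0 /mxtrace mulr_sumr => <-.
  by rewrite /s mulr_suml; apply: eq_bigr => l _; rewrite q2 expr2.
by move=> h l; rewrite exprSr -mulrA mulrCA q2 mulrCA q1 mulr0.
Qed.

(** The hypothesis prescribes the part of each row of [D] orthogonal to [g]. Crossing
    once more with [g] recovers [D]: a dyad with [g] in its second factor, up to a skew
    matrix, a scalar matrix and a multiple of [r]. *)
Lemma rank_one_rows g (beta : 'cV[T]_3) (om c r : T) D Q
    (s := \sum_l g l 0 ^+ 2) (bg := \sum_l beta l 0 * g l 0) :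
  (forall h l, c * cross g (\col_m D h m) l 0 =
    g h 0 * beta l 0 - bg *+ (h == l) - om * mskw g h l + r * Q h l) ->
  (s * c) *: D = (\col_h (c * \sum_l g l 0 * D h l) - cross g beta - om *: g) *m g^T
    + (cross g beta *m g^T - g *m (cross g beta)^T)
    + mskw (- bg *: g) + (om * s)%:M
    + r *: \matrix_(h, l) - cross g (\col_m Q h m) l 0.
Proof.
move=> H; apply/matrixP => h l.
have e : (s * c) * D h l = c * (\sum_m g m 0 * D h m) * g l 0 -
    (g (l + 1) 0 * (c * cross g (\col_m D h m) (l + 2) 0) -
     g (l + 2) 0 * (c * cross g (\col_m D h m) (l + 1) 0)).
  rewrite /s !sum3 !mxE; move: l; apply: ord3_ind; rewrite !ord3D; ring.
have O (y z : 'cV[T]_3) : (y *m z^T) h l = y h 0 * z l 0.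
  by rewrite mxE big_ord1 mxE.
rewrite [LHS]mxE e !H {e H} /bg /s.
have A (V W : 'M[T]_3) : (V + W) h l = V h l + W h l by rewrite mxE.
have N (V : 'M[T]_3) : (- V) h l = - V h l by rewrite mxE.
rewrite !(A, N, O) !sum3 !mxE !sum3 {A N O}.
move: h l; apply: ord3_ind; apply: ord3_ind;
  rewrite !ord3D !ord3_eq ?eqxx /= ?mulr1n ?mulr0n ?sum3; ring.
Qed.

End MatrixAlgebra.

(** * Potentials for the Cotton-York operator *)

Section Surjectivity.
Variables (R : realType) (v : 'I_4 -> 'cV[R]_3).
Hypothesis vI : affinely_independent v.
Implicit Types (i j k : 'I_4) (p q r f : {mpoly R[3]}) (w y z : vfield R).
Implicit Types (U V W : mfield R) (h l : 'I_3).

Local Notation L := (bary v).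
Local Notation g := (gradbary v).
Local Notation b := (bubble v).

Lemma ideal2D p q f r : ideal2 p q f -> ideal2 p q r -> ideal2 p q (f + r).
Proof. by move=> [f1 [f2 ->]] [r1 [r2 ->]]; exists (f1 + r1), (f2 + r2); ring. Qed.

Lemma ideal2N p q f : ideal2 p q f -> ideal2 p q (- f).
Proof. by move=> [f1 [f2 ->]]; exists (- f1), (- f2); ring. Qed.

Lemma ideal2_0 p q : ideal2 p q 0.
Proof. by exists 0, 0; ring. Qed.

Lemma bubble_potential_mx d U : mmsize_le d.+4 U -> div U = 0 ->
  (forall h, normal_free v (rowv U h)) -> (forall h, edge_free v (rowv U h)) ->
  exists2 W, curl (b *: W) = U & mmsize_le d.+1 W.
Proof.
move=> /mmsize_rows Ud dU Un Ue.
have [W WP] : exists W, forall h, curlv (b *: rowv W h) = rowv U h /\ vmsize_le d.+1 (rowv W h).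
  apply: (@rows_choice _ (fun h w => curlv (b *: w) = rowv U h /\ vmsize_le d.+1 w)) => h.
  have [|w wE wd] := bubble_potential vI (Ud h) _ (Un h) (Ue h); last by exists w.
  by rewrite -div_row dU entry0.
exists W; last by apply/mmsize_rows => h; case: (WP h).
by apply: mat3P => h; rewrite rowv_curl rowvZ; case: (WP h).
Qed.

Lemma bubble2_potential_mx d U : mmsize_le d.+3 U -> div (b *: U) = 0 ->
  (forall h, edge_free v (rowv U h)) ->
  exists2 W, curl (b ^+ 2 *: W) = b *: U & mmsize_le d W.
Proof.
move=> /mmsize_rows Ud dU Ue.
have [W WP] : exists W, forall h, curlv (b ^+ 2 *: rowv W h) = b *: rowv U h /\
    vmsize_le d (rowv W h).
  apply: (@rows_choice _ (fun h w => curlv (b ^+ 2 *: w) = b *: rowv U h /\ vmsize_le d w)) => h.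
  have [|w wE wd] := bubble2_potential vI (Ud h) _ (Ue h); last by exists w.
  by rewrite -rowvZ -div_row dU entry0.
exists W; last by apply/mmsize_rows => h; case: (WP h).
by apply: mat3P => h; rewrite rowv_curl !rowvZ; case: (WP h).
Qed.

Lemma cst_cross (a c : 'cV[R]_3) : cross (cst a) (cst c) = cst (cross a c).
Proof. by apply/matrixP => h l; rewrite !mxE mpolyCB !mpolyCM. Qed.

Lemma sqnorm_cross_neq0 i j : i != j ->
  \sum_l cross (g i) (g j) l 0 ^+ 2 != 0 :> R.
Proof.
move=> ij; apply/eqP => /eqP; rewrite psumr_eq0 => [/allP t0|l _]; last exact: sqr_ge0.
have {}t0 l : cross (g i) (g j) l 0 = 0.
  by have := t0 l (mem_index_enum _); rewrite sqrf_eq0 => /eqP.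
have [m mi mj] := other2 i j; have := cross_grad_unit vI ij mi mj.
rewrite /dot big1 => [/eqP|l _]; first by rewrite eq_sym oner_eq0.
have -> : cross (cst (g i)) (cst (g j)) = 0; last by rewrite entry0 mulr0.
by rewrite cst_cross; apply/matrixP => h n; rewrite (ord1 n) entryC t0 entry0.
Qed.

(** On an edge the rows are orthogonal to both normals, which are independent. *)
Lemma sym_traceless_edge_free U : U^T = U -> \tr U = 0 ->
  (forall h, normal_free v (rowv U h)) -> forall h, edge_free v (rowv U h).
Proof.
move=> US Ut Un h i j ij l; have [rho [rc rp]] := edge_hom vI ij.
rewrite mxE; apply/rp; pose M := map_mx rho U.
have MS : M^T = M by rewrite /M map_trmx US.
have Mt : \tr M = 0 by rewrite /M trace_map_mx Ut rmorph0.
have K k : rho (L k) = 0 -> forall n, \sum_m cst (g k) m 0 * M n m = 0.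
  move=> rk n; have [q qE] := Un n k; have := congr1 rho qE.
  rewrite rmorphM rk mul0r rmorph_sum => {2}<-; apply: eq_bigr => m _.
  by rewrite rmorphM entryC rc !mxE.
have ri : rho (L i) = 0 by apply/rp; exists 1, 0; ring.
have rj : rho (L j) = 0 by apply/rp; exists 0, 1; ring.
have := sym_traceless_kernel MS Mt (K i ri) (K j rj) h l.
have -> : \sum_m cross (cst (g i)) (cst (g j)) m 0 ^+ 2 =
    (\sum_m cross (g i) (g j) m 0 ^+ 2)%:MP.
  rewrite rmorph_sum; apply: eq_bigr => m _ /=.
  by rewrite cst_cross entryC rmorphXn.
move/eqP; rewrite mulf_eq0 expf_eq0 /= mpolyC_eq0 (negPf (sqnorm_cross_neq0 ij)) /=.
by rewrite /M mxE => /eqP.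
Qed.

(** The curls of [cott] are inverted one at a time, each time with a potential in the
    ideal of the bubble. The last field, [opS B] corrected by a skew field to make it
    divergence free, vanishes on the edges because [B] and [w] have no tangential trace;
    this gains a second factor of the bubble. *)
Lemma cott_bubble_potential d U : mmsize_le d.+4.+1 U -> U^T = U -> \tr U = 0 ->
  div U = 0 -> (forall h, normal_free v (rowv U h)) ->
  exists D B w, [/\ mmsize_le d D, cott (b ^+ 2 *: D) = U,
    curl (b ^+ 2 *: D) = b *: (opS B - mskw w), forall h, tangent_free v (rowv B h)
    & tangent_free v w].
Proof.
move=> Ud US Ut dU Un.
have [A AE Ad] := bubble_potential_mx Ud dU Un (sym_traceless_edge_free US Ut Un).
have Bex : exists2 B, curl (b *: B) = b *: opS A & mmsize_le d.+3 B.
  apply: bubble_potential_mx.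
  - by move=> h l; rewrite entryZ; apply: (@msize_bubbleM _ _ vI d.+2); exact: mmsize_opS.
  - by rewrite -opSZ div_opS AE; apply/vsk0P.
  - by move=> h; rewrite rowvZ; exact: normal_free_bubble.
  - by move=> h; rewrite rowvZ; exact: edge_free_bubble.
have [B BE Bd] := Bex.
have wex : exists2 w, curlv (b *: w) = b *: vsk A & vmsize_le d.+3 w.
  apply: bubble_potential => //.
  - move=> l; rewrite entryZ; apply: (@msize_bubbleM _ _ vI d.+2).
    by rewrite mxE; apply: msize_leB; exact: Ad.
  - by rewrite -vskZ -tr_curl AE.
  - exact: normal_free_bubble.
  - exact: edge_free_bubble.
have [w wE wd] := wex.
have BT h : tangent_free v (rowv B h).
  apply: (@curl_bubble_tangent_free _ _ vI _ (rowv (opS A) h)).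
  by rewrite -!rowvZ -rowv_curl BE.
have wT : tangent_free v w := curl_bubble_tangent_free vI wE.
have XE : b *: (opS B - mskw w) = opS (b *: B) - mskw (b *: w).
  by rewrite opSZ mskwZ scalerBr.
have Dex : exists2 D, curl (b ^+ 2 *: D) = b *: (opS B - mskw w) & mmsize_le d D.
  apply: bubble2_potential_mx.
  - move=> h l; rewrite entryD entryN entry_opS; apply: msize_leB.
      by apply: msize_leB; [exact: Bd|apply: msize_leMn; exact: mmsize_tr].
    rewrite mxE; case: ifP => _ //; case: ifP => _; last by rewrite msize0.
    by apply: msize_leN.
  - rewrite XE divmB div_opS BE div_mskw wE vskZ vsk_opS scalerN.
    by rewrite opprK addrC subrr.
  - move=> h i j ij l; rewrite mxE entryD entryN entry_opS.
    have eB m n : ideal2 (L i) (L j) (B m n).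
      by have := tangent_free_edge_free vI (BT m) ij n; rewrite mxE.
    have ew m : ideal2 (L i) (L j) (w m 0) by apply: tangent_free_edge_free.
    apply: ideal2D; first apply: ideal2D; first exact: eB.
      apply: ideal2N; case: (h == l); last exact: ideal2_0.
      by rewrite mulr1n /mxtrace sum3; apply: ideal2D; first apply: ideal2D.
    apply: ideal2N; rewrite mxE; case: ifP => _ //; case: ifP => _; last exact: ideal2_0.
    exact: ideal2N.
have [D DE Dd] := Dex; exists D, B, w; split=> //.
(* Going back up, the skew correction turns into a gradient, which the next curl kills. *)
have e2 : opSinv (curl (b ^+ 2 *: D)) = b *: B + mskw (b *: w).
  by rewrite DE XE opSinvB opSK opSinv_mskw opprK.
have e3 : opSinv (curl (b *: B + mskw (b *: w))) = b *: A - grad (b *: w).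
  by rewrite curlmD BE curl_mskw -opSZ -opSB opSK.
by rewrite /cott e2 e3 curlmB curl_grad subr0.
Qed.

Lemma devsym_skew w y : devsym (w *m y^T - y *m w^T) = 0.
Proof.
have -> : y *m w^T = (w *m y^T)^T by rewrite trmx_mul trmxK.
by rewrite devsymB devsym_trmx subrr.
Qed.

Definition dyad w (n : vfield R) : mfield R := devsym (w *m n^T).

Lemma rowv_dot_mulmx U (a : vfield R) h : dot a (rowv U h) = (U *m a) h 0.
Proof. by rewrite mxE; apply: eq_bigr => l _; rewrite mxE mulrC. Qed.

(** The curl of [b ^+ 2 *: D], divided by [b], prescribes on the face the cross product
    of the rows of [D] with the normal, and the traces of [B] and [w] give it the form
    required by [rank_one_rows]. [devsym] removes the skew and scalar parts. *)
Lemma cott_potential_face D B w i :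
  curl (b ^+ 2 *: D) = b *: (opS B - mskw w) ->
  (forall h, tangent_free v (rowv B h)) -> tangent_free v w ->
  exists y Z, coface v i *: devsym D = dyad y (cst (g i)) + L i *: Z.
Proof.
move=> DE BT wT.
have bigd (x : vfield R) : exists d, vmsize_le d x.
  by exists (\max_l msize (x l 0%R))%N => m; exact: (leq_bigmax m).
have [dw wd] := bigd w; have [om [z [wE _]]] := tangent_free_face vI wd (wT i).
have Bex h : exists p : {mpoly R[3]}, exists x, rowv B h = p *: cst (g i) + L i *: x.
  have [dB Bd] := bigd (rowv B h).
  by have [p [x [pE _]]] := tangent_free_face vI Bd (BT h i); exists p, x.
have [be beE] := fin_all_exists Bex.
have [N NE] := @rows_choice _ (fun h x => rowv B h = be h *: cst (g i) + L i *: x) beE.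
pose beta : vfield R := \col_h be h.
have BE h l : B h l = beta h 0 * cst (g i) l 0 + L i * N h l.
  by have /matrixP/(_ l 0) := NE h; rewrite entryD !entryZ !mxE.
have DE' h : (2%:R : {mpoly R[3]}) *: cross (gradv b) (rowv D h) + b *: curlv (rowv D h) =
    rowv (opS B - mskw w) h.
  have := congr1 (fun U => rowv U h) DE; rewrite rowv_curl !rowvZ curlvM expr2 gradvM => e.
  apply/matrixP => l m; apply: (mulfI (bubble_neq0 vI)).
  have /matrixP/(_ l m) := e; rewrite [in X in _ = X -> _]entryZ => <-.
  rewrite crossDl !crossZl.
  move: (cross (gradv b) (rowv D h)) (curlv (rowv D h)) => x x'.
  by rewrite !entryD !entryZ; ring.
pose Q : mfield R := \matrix_(h, l) (N l h - \tr N *+ (h == l) - mskw z h l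
  - 2%:R * cross (gradv (coface v i)) (rowv D h) l 0 - coface v i * curlv (rowv D h) l 0).
have key h l : (2%:R * coface v i) * cross (cst (g i)) (\col_m D h m) l 0 =
    cst (g i) h 0 * beta l 0 - (\sum_m beta m 0 * cst (g i) m 0) *+ (h == l)
    - om * mskw (cst (g i)) h l + L i * Q h l.
  have /matrixP/(_ l 0) := DE' h; rewrite (grad_bubble v i) crossDl !crossZl (bubbleE v i).
  rewrite [RHS]mxE (entryD (opS B)) (entryN (mskw w)) entry_opS.
  have -> : \tr B = \sum_m beta m 0 * cst (g i) m 0 + L i * \tr N.
    by rewrite /mxtrace mulr_sumr -big_split; apply: eq_bigr => m _; exact: BE.
  have -> : mskw w h l = om * mskw (cst (g i)) h l + L i * mskw z h l.
    by rewrite wE mskwD !mskwZ entryD !entryZ.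
  rewrite BE [Q h l]mxE mulrnDl -mulrnAr.
  rewrite -[\col_m D h m]/(rowv D h).
  move: (\tr N *+ _) (_ *+ (h == l)) (cross _ _) (cross _ _) (curlv _) => t t' x x' x''.
  move: (L i) (coface v i) (mskw _ h l) (mskw z h l) => A co k k'.
  rewrite !(entryD, entryZ) => e.
  apply/eqP; rewrite -subr_eq0; apply/eqP; move/eqP: e; rewrite -subr_eq0 => /eqP <-; ring.
have := rank_one_rows key.
set s := \sum_l _ ^+ 2; set d1 := (_ - om *: _); set d2 := cross _ _; set Z := \matrix_(_, _) _.
move/(congr1 (@devsym R)).
rewrite 4!devsymD !devsymZ devsym_mskw devsym_scalar devsym_skew !addr0 => e.
have sE : s = (\sum_l g i l 0 ^+ 2)%:MP.
  by rewrite /s rmorph_sum; apply: eq_bigr => l _; rewrite entryC rmorphXn.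
pose k := \sum_l g i l 0 ^+ 2 : R; have k0 : k != 0 := sqnorm_grad_neq0 vI i.
have kk : ((k * 2%:R)^-1)%:MP * (s * (2%:R * coface v i)) = coface v i.
  rewrite sE -/k (_ : k%:MP * _ = (k * 2%:R)%:MP * coface v i); last first.
    by rewrite mpolyCM mpolyC_nat; ring.
  by rewrite mulrA -mpolyCM mulVf ?mpolyC1 ?mul1r // mulf_neq0 // pnatr_eq0.
move: kk; set c := (_^-1)%:MP => kk.
exists (c *: d1), (c *: devsym Z).
rewrite -[in LHS]kk -(scalerA c) e (scalerDr c) /dyad -scalemxAl devsymZ; congr (_ + _).
by rewrite !scalerA mulrC.
Qed.

End Surjectivity.

(** * Decomposition along a unit normal *)

Section SymmetricDyads.
Variables (T : comNzRingType) (half third : T) (n : 'cV[T]_3).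
Hypothesis half2 : half * 2%:R = 1.
Hypothesis third3 : third * 3%:R = 1.
Hypothesis n_unit : \sum_l n l 0 ^+ 2 = 1.
Implicit Types (M : 'M[T]_3) (w : 'cV[T]_3).

Local Notation J := (mskw n).
Local Notation Pi := (1%:M - n *m n^T).

(** Symmetric and deviatoric parts with the fractions as parameters, so that they make
    sense over a commutative ring with chosen inverses of 2 and 3. *)
Definition sym_part (k : T) M := k *: (M + M^T).

Definition dev_part (k : T) M := M - k *: (\tr M)%:M.

Lemma normal_sqr : n^T *m n = 1%:M.
Proof.
apply/matrixP => h l; rewrite mxE (ord1 h) (ord1 l) [RHS]mxE eqxx -n_unit.
by apply: eq_bigr => m _; rewrite mxE expr2.
Qed.

Lemma proj_normal : Pi *m n = 0.
Proof. by rewrite mulmxBl mul1mx -mulmxA normal_sqr mulmx1 subrr. Qed.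

Lemma proj_tr : Pi^T = Pi.
Proof. by rewrite linearB /= trmx1 trmx_mul trmxK. Qed.

Lemma normal_proj : n^T *m Pi = 0.
Proof. by rewrite mulmxBr mulmx1 mulmxA normal_sqr mul1mx subrr. Qed.

Lemma mskw_trmx : J^T = - J.
Proof.
apply/matrixP => h l; rewrite !mxE.
move: h l; apply: ord3_ind; apply: ord3_ind; rewrite !ord3D !ord3_eq ?eqxx /=; ring.
Qed.

Lemma mskw_normal : J *m n = 0.
Proof. by rewrite mskwE; apply/matrixP => h l; rewrite !mxE; ring. Qed.

Lemma normal_mskw : n^T *m J = 0.
Proof. by rewrite -[LHS]trmxK trmx_mul mskw_trmx trmxK mulNmx mskw_normal oppr0 trmx0. Qed.

Lemma proj_mskw : Pi *m J = J.
Proof. by rewrite mulmxBl mul1mx -mulmxA normal_mskw mulmx0 subr0. Qed.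

Lemma mskw_proj : J *m Pi = J.
Proof. by rewrite mulmxBr mulmx1 mulmxA mskw_normal mul0mx subr0. Qed.

Lemma mskw_sqr : J *m J = n *m n^T - 1%:M.
Proof.
move: n_unit; rewrite sum3 => n1.
apply/matrixP => h l; rewrite !mxE sum3 big_ord1 !mxE.
have -> : (1 *+ (h == l) : T) = (n 0 0 ^+ 2 + n 1 0 ^+ 2 + n 2 0 ^+ 2) *+ (h == l).
  by rewrite n1.
move: h l; apply: ord3_ind; apply: ord3_ind;
  rewrite !ord3D !ord3_eq ?eqxx /= ?mulr1n ?mulr0n; ring.
Qed.

(** The square of [J] is minus the projection orthogonal to [n], and the tangential block
    of [M] is two by two: up to sign, conjugating it by a quarter turn gives its
    adjugate. *)
Lemma mskw_conj M : M^T = M -> \tr M = 0 ->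
  J *m M *m J = M - (M *m n) *m n^T - n *m (M *m n)^T + ((n^T *m M *m n) 0 0)%:M.
Proof.
move=> MS Mt; move: n_unit; rewrite sum3 => n1.
have sy h l : M h l = M l h by rewrite -[in LHS]MS mxE.
have {}Mt : M 0 0 = - M 1 1 - M 2 2.
  by move: Mt; rewrite /mxtrace sum3 => /eqP; rewrite -addrA addr_eq0 opprD => /eqP.
suff -> : J *m M *m J = (n 0 0 ^+ 2 + n 1 0 ^+ 2 + n 2 0 ^+ 2) *: M -
    (M *m n) *m n^T - n *m (M *m n)^T + ((n^T *m M *m n) 0 0)%:M.
  by rewrite n1 scale1r.
apply/matrixP => h l; rewrite !mxE !big_ord1 !sum3 !mxE !sum3 !mxE ?sum3 ?mxE.
rewrite (sy 1 0) (sy 2 0) (sy 2 1) Mt.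
move: h l; apply: ord3_ind; apply: ord3_ind;
  rewrite ?(sy 1 0) ?(sy 2 0) ?(sy 2 1) ?Mt !ord3D !ord3_eq ?eqxx /= ?mulr1n ?mulr0n; ring.
Qed.

Lemma sym_part_mskw w : sym_part half (mskw w) = 0.
Proof.
rewrite /sym_part (_ : (mskw w)^T = - mskw w) ?subrr ?scaler0 //.
apply/matrixP => h l; rewrite !mxE.
by move: h l; apply: ord3_ind; apply: ord3_ind; rewrite !ord3D !ord3_eq ?eqxx /=; ring.
Qed.

Lemma dev_part_dyad w : dev_part third (sym_part half (w *m n^T)) =
  half *: (w *m n^T + n *m w^T) - (third * (\sum_l n l 0 * w l 0))%:M.
Proof.
have h x : half * (x + x) = x :> T by rewrite -mulr2n -mulr_natl mulrA half2 mul1r.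
rewrite /dev_part /sym_part trmx_mul trmxK scale_scalar_mx; congr (_ - (_ * _)%:M).
rewrite mxtraceZ /mxtrace !sum3 !mxE !big_ord1 !mxE -[RHS]h; ring.
Qed.

Lemma tangential_trace_dyad w :
  sym_part half (Pi *m dev_part third (sym_part half (w *m n^T)) *m J) = 0.
Proof.
rewrite dev_part_dyad; move: (third * _) => t.
have := proj_mskw; have := proj_normal; move: Pi => Q Qn QJ.
rewrite mulmxBr mulmxBl -scalemxAr -scalemxAl mulmxDr mulmxDl.
have -> : Q *m (w *m n^T) *m J = 0 by rewrite -!mulmxA normal_mskw !mulmx0.
have -> : Q *m (n *m w^T) *m J = 0 by rewrite (mulmxA Q) Qn !mul0mx.
rewrite addr0 scaler0 sub0r -mulmxA mul_scalar_mx -scalemxAr QJ.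
rewrite -scaleNr; have -> : - t *: J = mskw (- t *: n).
  apply/matrixP => h l; rewrite !mxE.
  by move: h l; apply: ord3_ind; apply: ord3_ind; rewrite !ord3D !ord3_eq ?eqxx /=; ring.
exact: sym_part_mskw.
Qed.

(** A symmetric traceless matrix is determined by its product with [n] and by its
    tangential traceless part. The former is carried by a dyad with [n]; the latter is
    the first trace turned by a right angle. *)
Lemma tangential_trace_split M (q := (n^T *m M *m n) 0 0)
    (w := 2%:R *: (M *m n) - (half * q) *: n) :
  M^T = M -> \tr M = 0 ->
  M = dev_part third (sym_part half (w *m n^T)) - sym_part half (Pi *m M *m J) *m J.
Proof.
move=> MS Mt; have JMJ := mskw_conj MS Mt; rewrite -/q in JMJ.
have e1 : Pi *m M *m J *m J = (M *m n) *m n^T - q *: (n *m n^T) - M + n *m (M *m n)^T.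
  rewrite -[_ *m J *m J]mulmxA mskw_sqr mulmxBr mulmx1 !mulmxBl !mul1mx !mulmxA.
  have -> : n *m n^T *m M *m n = q *: n.
    have qE : n^T *m (M *m n) = q%:M by rewrite mulmxA [LHS]mx11_scalar.
    by rewrite -!mulmxA qE mul_mx_scalar.
  have -> : n *m (M *m n)^T = n *m n^T *m M by rewrite trmx_mul MS mulmxA.
  by rewrite -scalemxAl opprB addrA addrAC.
have e2 : (Pi *m M *m J)^T *m J = - (J *m M *m J).
  by rewrite !trmx_mul mskw_trmx MS proj_tr !mulNmx -!mulmxA proj_mskw.
have wn : \sum_l n l 0 * w l 0 = 3%:R * (half * q).
  have : (n^T *m w) 0 0 = 3%:R * (half * q).
    rewrite /w mulmxBr -!scalemxAr normal_sqr mulmxA [LHS]mxE [X in _ + X]mxE.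
    have Z k (X : 'M[T]_1) : (k *: X) 0 0 = k * X 0 0 by rewrite mxE.
    rewrite !Z -/q [1%:M 0 0]mxE eqxx mulr1n.
    by rewrite -[X in _ * X - _](mul1r q) -half2; ring.
  move=> <-; rewrite [RHS]mxE; apply: eq_bigr => l _; congr (_ * _).
  by rewrite mxE.
have S1 : sym_part half (Pi *m M *m J) *m J =
    half *: (Pi *m M *m J *m J + (Pi *m M *m J)^T *m J).
  have S2 (X Y : 'M[T]_3) : sym_part half X *m Y = half *: (X *m Y + X^T *m Y).
    by rewrite /sym_part -scalemxAl mulmxDl.
  exact: S2.
rewrite dev_part_dyad wn S1 e1 e2 JMJ.
apply/matrixP => h l; rewrite /w; move: (M *m n) => u.
transitivity (half * 2%:R * (M h l - half * (q * (n h 0 * n l 0))) +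
    half * (q * (n h 0 * n l 0))); first by rewrite half2 mul1r subrK.
have O (x : 'cV[T]_3) : x l ord0 = x l 0 /\ x h ord0 = x h 0 by split; congr (x _ _); exact: val_inj.
rewrite !mxE !big_ord1 !mxE (mulrA third) third3 mul1r !(O _).1 !(O _).2.
by case: (h == l); rewrite ?mulr1n ?mulr0n; ring.
Qed.

Lemma conj_add (P A A' B B' : 'M[T]_3) :
  P *m (A + A' + (A + A')^T - (B + B')) *m P =
  P *m (A + A^T - B) *m P + P *m (A' + A'^T - B') *m P.
Proof.
rewrite -mulmxDl -mulmxDr; congr (P *m _ *m P).
by apply/matrixP => h l; rewrite !mxE; ring.
Qed.

Lemma conj_sub (P A B : 'M[T]_3) (p q : T) :
  P *m (p *: A - q *: B) *m P = p *: (P *m A *m P) - q *: (P *m B *m P).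
Proof. by rewrite mulmxBr mulmxBl -!scalemxAr -!scalemxAl. Qed.

Lemma conj_absorb (P M Q : 'M[T]_3) : Q *m P = Q -> P *m (M *m Q) *m P = P *m M *m Q.
Proof. by move=> QP; rewrite -!mulmxA QP. Qed.

Lemma conj_hessian (P H : 'M[T]_3) (e k : T) w : P *m n = 0 -> n^T *m P = 0 ->
  P *m ((k *: n) *m w^T + (e *: H + k *: (w *m n^T))) *m P = e *: (P *m H *m P).
Proof.
move=> Pn nP; rewrite -scalemxAl.
have c1 : P *m (n *m w^T) *m P = 0 by rewrite !mulmxA Pn !mul0mx.
have c2 : P *m (w *m n^T) *m P = 0 by rewrite -!mulmxA nP !mulmx0.
rewrite !mulmxDr !mulmxDl -!scalemxAr -!scalemxAl c1 c2 !scaler0.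
by rewrite add0r addr0.
Qed.

Lemma conj_scalar (P : 'M[T]_3) (k : T) w : P *m n = 0 -> n^T *m P = 0 -> P *m J = J ->
  P *m (n *m w^T + (n *m w^T)^T - k%:M) *m P *m J = - k *: J.
Proof.
move=> Pn nP PJ; rewrite trmx_mul trmxK.
have c1 : P *m (n *m w^T) *m P = 0 by rewrite !mulmxA Pn !mul0mx.
have c2 : P *m (w *m n^T) *m P = 0 by rewrite -!mulmxA nP !mulmx0.
rewrite mulmxBr mulmxBl mulmxDr mulmxDl c1 c2 addr0 sub0r mulNmx.
by rewrite mul_mx_scalar -!scalemxAl -mulmxA !PJ scaleNr.
Qed.

Lemma dot_cross_normal (u w : 'cV[T]_3) (h k e : T) :
  \sum_l (h *: (k *: cross n u) + h *: (e *: w)) l 0 * n l 0 =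
  e * (h * \sum_l w l 0 * n l 0).
Proof. by rewrite !sum3 !mxE !ord3D; ring. Qed.

Lemma dot_normal_curl (u w : 'cV[T]_3) (k e : T) :
  \sum_l n l 0 * (k *: cross n u + e *: w) l 0 = e * \sum_l n l 0 * w l 0.
Proof. by rewrite !sum3 !mxE !ord3D; ring. Qed.

Lemma scale_regroup (A B C : 'M[T]_3) (p k t : T) :
  p *: A - k *: (p *: B - t *: C) = p *: (A - k *: B) + (k * t) *: C.
Proof. by apply/matrixP => h l; rewrite !mxE; ring. Qed.

Lemma conj_normal_scale (P : 'M[T]_3) (e k : T) M A D : P *m n = 0 -> n^T *m P = 0 ->
  P *m ((e *: A + k *: (M *m n *m n^T)) + (e *: A + k *: (M *m n *m n^T))^T - (k *: M + e *: D)) *m P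
  = e *: (P *m (A + A^T - D) *m P) - k *: (P *m M *m P).
Proof.
move=> Pn nP; set B := M *m n *m n^T.
have cB : P *m B *m P = 0 by rewrite -!mulmxA nP !mulmx0.
have cBt : P *m B^T *m P = 0 by rewrite !trmx_mul trmxK !mulmxA Pn !mul0mx.
suff H (c : 'M[T]_3 -> 'M[T]_3) : (forall X Y, c (X + Y) = c X + c Y) ->
    (forall t X, c (t *: X) = t *: c X) -> c B = 0 -> c B^T = 0 ->
    c (e *: A + k *: B + (e *: A + k *: B)^T - (k *: M + e *: D)) =
    e *: c (A + A^T - D) - k *: c M.
  apply: (H (fun X => P *m X *m P)) => // [X Y|t X].
    by rewrite mulmxDr mulmxDl.
  by rewrite -scalemxAr -scalemxAl.
move=> cD cZ {}cB {}cBt; rewrite linearD /= !linearZ /= -!scaleN1r.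
rewrite !(cD, cZ) cB cBt; apply/matrixP => h l; rewrite !mxE; ring.
Qed.

Lemma sym_part_second (P X M : 'M[T]_3) (e k : T) : P *m J = J ->
  sym_part half ((e *: X - k *: (P *m M *m P)) *m J) =
  e *: sym_part half (X *m J) - k *: sym_part half (P *m M *m J).
Proof.
move=> PJ; rewrite /sym_part mulmxBl -!scalemxAl -[P *m M *m P *m J]mulmxA PJ.
move: (X *m J) (P *m M *m J) => A B.
by apply/matrixP => h l; rewrite !mxE; ring.
Qed.

Lemma sym_part_conj (P K : 'M[T]_3) : P^T = P ->
  P *m sym_part half K *m P = sym_part half (P *m K *m P).
Proof.
by move=> PT; rewrite /sym_part -scalemxAr -scalemxAl mulmxDr mulmxDl !trmx_mul PT mulmxA.
Qed.

End SymmetricDyads.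

Lemma split_trans (A : zmodType) (x y y' z z' s : A) :
  x = y + z -> z = y' + z' -> s = y + y' -> x = s + z'.
Proof. by move=> -> -> ->; rewrite addrA. Qed.

(** * The traces on one plane *)

Section LocalTraces.
Variables (R : realType) (ell : {mpoly R[3]}) (n : 'cV[R]_3) (c : R).
Hypothesis n_unit : \sum_l n l 0 ^+ 2 = 1.
Hypothesis c_neq0 : c != 0.
Hypothesis ell_neq0 : ell != 0.
Hypothesis ell_grad : gradv ell = c%:MP *: cst n.
Implicit Types (f p : {mpoly R[3]}) (u w x : vfield R) (U V Z : mfield R).

Local Notation N := (cst n).
Local Notation J := (mskw (cst n)).
Local Notation Pi := (PiF n).

Definition mmultiple p U := forall h l, multiple p (U h l).

Lemma mmultipleP p U : mmultiple p U <-> exists Z, U = p *: Z.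
Proof.
split=> [Up|[Z ->] h l]; last by rewrite entryZ; exact: multiple_refl.
have H h : exists w, rowv U h = p *: w.
  by apply/vmultipleP => l; rewrite mxE.
have [Z ZP] := rows_choice H; exists Z; apply: mat3P => h.
by rewrite rowvZ.
Qed.

Lemma mmultiple_mulr p U V : mmultiple p U -> mmultiple p (U *m V).
Proof.
by move=> /mmultipleP [Z ->]; apply/mmultipleP; exists (Z *m V); rewrite scalemxAl.
Qed.

Lemma mmultipleD p U V : mmultiple p U -> mmultiple p V -> mmultiple p (U + V).
Proof. by move=> Up Vp h l; rewrite entryD; exact: multipleD. Qed.

Lemma mmultipleN p U : mmultiple p U -> mmultiple p (- U).
Proof. by move=> Up h l; rewrite entryN; exact: multipleN. Qed.

Lemma mmultipleB p U V : mmultiple p U -> mmultiple p V -> mmultiple p (U - V).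
Proof. by move=> Up Vp; apply: mmultipleD => //; exact: mmultipleN. Qed.

Lemma mmultipleZ p q U : mmultiple p U -> mmultiple p (q *: U).
Proof. by move=> Up h l; rewrite entryZ; exact: multipleMl. Qed.

Lemma mmultiple_refl p U : mmultiple p (p *: U).
Proof. by apply/mmultipleP; exists U. Qed.

Lemma half_two : (2^-1)%:MP * 2%:R = 1 :> {mpoly R[3]}.
Proof. by rewrite -[2%:R]mulr1 mulr_natl Defs.halfK. Qed.

Lemma third_three : (3^-1)%:MP * 3%:R = 1 :> {mpoly R[3]}.
Proof. by rewrite -[3%:R]mulr1 mulr_natl thirdK. Qed.

Lemma cst_unit : \sum_l N l 0 ^+ 2 = 1.
Proof.
rewrite -[RHS]mpolyC1 -n_unit rmorph_sum; apply: eq_bigr => l _.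
by rewrite entryC rmorphXn.
Qed.

Lemma PiE : Pi = 1%:M - N *m N^T.
Proof. by rewrite /PiF /cst map_mxB map_mxM map_mx1 map_trmx. Qed.

Lemma Pi_N : Pi *m N = 0.
Proof. by rewrite PiE proj_normal // cst_unit. Qed.

Lemma Pi_tr : Pi^T = Pi.
Proof. by rewrite PiE proj_tr. Qed.

Lemma Nt_Pi : N^T *m Pi = 0.
Proof. by rewrite PiE normal_proj // cst_unit. Qed.

Lemma Pi_J : Pi *m J = J.
Proof. by rewrite PiE proj_mskw. Qed.

Lemma J_Pi : J *m Pi = J.
Proof. by rewrite PiE mskw_proj. Qed.

Lemma symE U : sym U = (2^-1)%:MP *: (U + U^T). Proof. by []. Qed.

Lemma symD U V : sym (U + V) = sym U + sym V.
Proof. by rewrite !symE -scalerDr; congr (_ *: _); rewrite linearD /= addrACA. Qed.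

Lemma symZ p U : sym (p *: U) = p *: sym U.
Proof. by rewrite !symE linearZ /= -scalerDr !scalerA mulrC. Qed.

Lemma symN U : sym (- U) = - sym U.
Proof. by rewrite -scaleN1r symZ scaleN1r. Qed.

Lemma sym_mskw w : sym (mskw w) = 0.
Proof. by rewrite symE mskw_tr subrr scaler0. Qed.

Lemma mmultiple_sym p U : mmultiple p U -> mmultiple p (sym U).
Proof. by move=> /mmultipleP [Z ->]; rewrite symZ; exact: mmultiple_refl. Qed.

Lemma tr1cottD U V : tr1cott n (U + V) = tr1cott n U + tr1cott n V.
Proof. by rewrite /tr1cott /mxcross mulmxDr mulmxDl symD. Qed.

Lemma tr1cottZ p U : tr1cott n (p *: U) = p *: tr1cott n U.
Proof. by rewrite /tr1cott /mxcross -scalemxAr -scalemxAl symZ. Qed.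

Lemma tr1_dyad w : tr1cott n (dyad w N) = 0.
Proof.
rewrite /tr1cott /mxcross /dyad devsymE PiE.
by apply: tangential_trace_dyad; [exact: half_two|exact: cst_unit].
Qed.

Lemma tr1_dyad_split U : U^T = U -> \tr U = 0 ->
  exists w, U = dyad w N - tr1cott n U *m J.
Proof.
move=> US Ut; have := tangential_trace_split half_two third_three cst_unit US Ut.
set w := (2%:R *: _ - _) => UE; exists w.
by rewrite /tr1cott /mxcross /dyad devsymE PiE.
Qed.

Lemma mmultiple_tr1 U : U^T = U -> \tr U = 0 -> mmultiple ell (tr1cott n U) ->
  exists w Z, U = dyad w N + ell *: Z.
Proof.
move=> US Ut U1; have [w UE] := tr1_dyad_split US Ut.
have /mmultipleP [Z ZE] : mmultiple ell (- (tr1cott n U *m J)).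
  by apply: mmultipleN; exact: mmultiple_mulr.
by exists w, Z; rewrite -ZE.
Qed.

Lemma dyadZ p w (m : vfield R) : dyad (p *: w) m = p *: dyad w m.
Proof. by rewrite /dyad -scalemxAl devsymZ. Qed.

Lemma dyadZr p w (m : vfield R) : dyad w (p *: m) = p *: dyad w m.
Proof. by rewrite /dyad linearZ /= -scalemxAr devsymZ. Qed.

Lemma gradD u w : grad (u + w) = grad u + grad w.
Proof. by apply/matrixP => h l; rewrite !mxE mderivD. Qed.

Lemma gradB u w : grad (u - w) = grad u - grad w.
Proof. by apply/matrixP => h l; rewrite !mxE mderivB. Qed.

Lemma gradM p u : grad (p *: u) = p *: grad u + u *m (gradv p)^T.
Proof.
apply/matrixP => h l; rewrite !mxE big_ord1 !mxE mderivM; ring.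
Qed.

Lemma devdefD u w : devdef (u + w) = devdef u + devdef w.
Proof. by rewrite !devdefE gradD devsymD. Qed.

Lemma devdefB u w : devdef (u - w) = devdef u - devdef w.
Proof. by rewrite !devdefE gradB devsymB. Qed.

Lemma devdefM p u : devdef (p *: u) = p *: devdef u + dyad u (gradv p).
Proof. by rewrite !devdefE gradM devsymD devsymZ. Qed.

Lemma gradv_pow m : gradv (ell ^+ m.+1) = ((m.+1%:R * c)%:MP * ell ^+ m) *: N.
Proof.
elim: m => [|m IH]; first by rewrite expr1 expr0 mulr1 mul1r ell_grad.
rewrite exprS gradvM IH ell_grad !scalerA -scalerDl; congr (_ *: _).
by rewrite exprS -[m.+2%:R]nat1r mulrDl mul1r mpolyCD; ring.
Qed.

Lemma devdef_pow m u : devdef (ell ^+ m.+1 *: u) =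
  ell ^+ m.+1 *: devdef u + ((m.+1%:R * c)%:MP * ell ^+ m) *: dyad u N.
Proof. by rewrite devdefM gradv_pow dyadZr. Qed.

Lemma sym_traceless_cancel p Z : p != 0 -> (p *: Z)^T = p *: Z -> \tr (p *: Z) = 0 ->
  Z^T = Z /\ \tr Z = 0.
Proof.
move=> p0 ZS Zt; split.
  apply/matrixP => h l; apply: (mulfI p0).
  by have /matrixP/(_ h l) := ZS; rewrite mxE !entryZ => <-; rewrite [X in _ * X]mxE.
by apply/eqP; move/eqP: Zt; rewrite mxtraceZ mulf_eq0 (negPf p0).
Qed.

(** A dyad with the normal is the leading term of the conformal strain of a
    displacement that vanishes to one order more. *)
Lemma absorb_dyad m Z : Z^T = Z -> \tr Z = 0 -> mmultiple ell (tr1cott n Z) ->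
  exists w Z', [/\ ell ^+ m *: Z = devdef (ell ^+ m.+1 *: w) + ell ^+ m.+1 *: Z',
    Z'^T = Z' & \tr Z' = 0].
Proof.
move=> ZS Zt Z1; have [w [Z0 ZE]] := mmultiple_tr1 ZS Zt Z1.
(* [k] is the factor produced by differentiating [ell ^+ m.+1] along the normal. *)
pose k := m.+1%:R * c; have k0 : k != 0 by rewrite mulf_neq0 // pnatr_eq0.
pose w' := (k^-1)%:MP *: w; exists w', (Z0 - devdef w').
have E : ell ^+ m *: Z = devdef (ell ^+ m.+1 *: w') + ell ^+ m.+1 *: (Z0 - devdef w').
  have -> : devdef (ell ^+ m.+1 *: w') = ell ^+ m.+1 *: devdef w' + ell ^+ m *: dyad w N.
    rewrite devdef_pow -/k /w' dyadZ (scalerA (k%:MP * _)); congr (_ + _ *: _).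
    by rewrite mulrAC -mpolyCM mulfV // mpolyC1 mul1r.
  rewrite ZE scalerDr scalerA -exprSr; move: (devdef w') => X.
  by rewrite (scalerBr _ Z0) [RHS]addrC addrA subrK addrC.
have [] := @sym_traceless_cancel (ell ^+ m.+1) (Z0 - devdef w').
- by rewrite expf_neq0.
- move/eqP: E; rewrite addrC -subr_eq => /eqP <-.
  by rewrite linearB /= linearZ /= ZS devdefE devsym_sym.
- move/eqP: E; rewrite addrC -subr_eq => /eqP <-.
  by rewrite raddfB /= mxtraceZ Zt mulr0 devdefE tr_devsym subr0.
by [].
Qed.

(** Applied to [U] it gives the second trace, and applied to [sym (curl U)] the third. *)
Definition second_form U := 2 *: defF n (Pi *m U *m N) - Pi *m dnormal n U *m Pi.

Lemma tr2cottE U : tr2cott n U = sym (second_form U *m J). Proof. by []. Qed.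

Lemma tr3cottE U : tr3cott n U = second_form (sym (curl U)). Proof. by []. Qed.

Lemma gradF_E u : gradF n u = grad u *m Pi.
Proof.
apply/matrixP => h l; rewrite !mxE; apply: eq_bigr => m _.
have -> : Pi l m = Pi m l by rewrite -[in LHS]Pi_tr mxE.
by rewrite mulrC [grad u h m]mxE.
Qed.

Lemma grad_cstM (A : 'M[R]_3) u : grad (cst A *m u) = cst A *m grad u.
Proof.
apply/matrixP => h l; rewrite !mxE raddf_sum; apply: eq_bigr => m _ /=.
by rewrite mderivM !mxE mderivC mul0r add0r.
Qed.

Lemma second_formE U : second_form U =
  Pi *m (grad (U *m N) + (grad (U *m N))^T - dnormal n U) *m Pi.
Proof.
rewrite /second_form /defF scalerA mulrC half_two scale1r gradF_E -mulmxA grad_cstM.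
by rewrite -/Pi !trmx_mul Pi_tr mulmxBr mulmxBl mulmxDr mulmxDl !mulmxA.
Qed.

Lemma entry_dnormal U h l : dnormal n U h l = \sum_m N m 0 * (U h l)^`M(m).
Proof.
by rewrite /dnormal summxE; apply: eq_bigr => m _; rewrite entryZ entryC [X in _ * X]mxE.
Qed.

Lemma dnormalM p U : dnormal n (p *: U) =
  (\sum_l N l 0 * p^`M(l)) *: U + p *: dnormal n U.
Proof.
apply/matrixP => h l.
rewrite entry_dnormal [RHS]mxE [X in X + _]mxE [X in _ + X]mxE entry_dnormal (entryZ p U).
by rewrite !sum3 !mderivM; ring.
Qed.

Lemma dnormalD U V : dnormal n (U + V) = dnormal n U + dnormal n V.
Proof.
apply/matrixP => h l; rewrite [RHS]mxE !entry_dnormal (entryD U V) -big_split.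
by apply: eq_bigr => m _; rewrite mderivD mulrDr.
Qed.

Lemma second_formD U V : second_form (U + V) = second_form U + second_form V.
Proof.
rewrite !second_formE mulmxDl gradD dnormalD.
exact: conj_add.
Qed.

Lemma second_formZ U : second_form (ell *: U) =
  ell *: second_form U - c%:MP *: (Pi *m U *m Pi).
Proof.
rewrite !second_formE -scalemxAl gradM dnormalM ell_grad.
have -> : \sum_l N l 0 * ell^`M(l) = c%:MP.
  rewrite -[RHS]mulr1 -cst_unit mulr_sumr; apply: eq_bigr => l _.
  have /matrixP/(_ l 0) := ell_grad; rewrite entry_grad entryZ => ->.
  by rewrite expr2 mulrCA mulrA.
have -> : U *m N *m (c%:MP *: N)^T = c%:MP *: (U *m N *m N^T).
  by rewrite linearZ /= -scalemxAr.
exact: (conj_normal_scale _ _ _ _ _ Pi_N Nt_Pi).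
Qed.

(** On the plane, the second trace of a first order perturbation is its first trace; the
    tangential derivatives do not see the factor [ell]. *)
Lemma tr2_first_order U : tr2cott n (ell *: U) = ell *: tr2cott n U - c%:MP *: tr1cott n U.
Proof.
rewrite !tr2cottE second_formZ.
exact: (sym_part_second _ _ _ _ _ Pi_J).
Qed.

Lemma curlmM p U : curl (p *: U) = p *: curl U + U *m (mskw (gradv p))^T.
Proof.
apply/matrixP => h l; rewrite !mxE sum3 !mxE !mderivM.
move: l; apply: ord3_ind; rewrite !ord3D !ord3_eq ?eqxx /=; ring.
Qed.

Lemma sym_Pi_conj U : Pi *m sym U *m Pi = sym (Pi *m U *m Pi).
Proof. exact: (sym_part_conj _ _ Pi_tr). Qed.

(** On the plane, the third trace of a second order perturbation is a multiple of its
    first trace: both the curl and the normal derivative differentiate a factor [ell]. *)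
Lemma tr3_second_order U : exists V,
  tr3cott n (ell ^+ 2 *: U) = ell *: V + (2%:R * c%:MP * c%:MP) *: tr1cott n U.
Proof.
have -> : ell ^+ 2 *: U = ell *: (ell *: U) by rewrite scalerA expr2.
pose K := U *m J.
have K1 V : curl (ell *: V) = ell *: curl V - c%:MP *: (V *m J).
  by rewrite curlmM ell_grad mskwZ linearZ /= mskw_tr scalerN mulmxN -scalemxAr.
rewrite tr3cottE !K1 -scalemxAl -/K scalerBr.
have -> : ell *: (ell *: curl U) - ell *: (c%:MP *: K) - c%:MP *: (ell *: K) =
    ell *: (ell *: curl U - (2%:R * c%:MP) *: K).
  rewrite scalerBr -addrA -opprD; congr (_ - _).
  by rewrite !scalerA -scalerDl; congr (_ *: _); ring.
have symB2 p q V W : sym (p *: V - q *: W) = p *: sym V - q *: sym W.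
  by rewrite symD symN !symZ.
rewrite symZ second_formZ (symB2 ell).
set X := ell *: sym (curl U) - _; exists (second_form X - c%:MP *: (Pi *m sym (curl U) *m Pi)).
have -> : Pi *m X *m Pi = ell *: (Pi *m sym (curl U) *m Pi) - (2%:R * c%:MP) *: tr1cott n U.
  have SK : Pi *m sym K *m Pi = tr1cott n U.
    rewrite sym_Pi_conj /tr1cott /mxcross; congr (sym _).
    by apply: conj_absorb; exact: J_Pi.
  by rewrite -SK; exact: conj_sub.
rewrite scale_regroup; congr (_ + _ *: _); ring.
Qed.

Lemma symgrad_entry u h l :
  symgrad u h l = (2^-1)%:MP * ((u h 0)^`M(l) + (u l 0)^`M(h)).
Proof. by rewrite !mxE. Qed.

Lemma grad_symgrad_normal u h l :
  grad (symgrad u *m N) h l = \sum_m N m 0 * (symgrad u h m)^`M(l).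
Proof.
rewrite mxE [X in X^`M(l)]mxE raddf_sum; apply: eq_bigr => m _ /=.
by rewrite mderivM entryC mderivC mulr0 addr0 mulrC.
Qed.

(** The combination of derivatives of a strain is the one that expresses second
    derivatives of a displacement by its strain; so a strain contributes the tangential
    Hessian of the normal displacement. *)
Lemma second_form_symgrad u : second_form (symgrad u) = Pi *m grad (gradv (dot u N)) *m Pi.
Proof.
rewrite second_formE.
suff -> : grad (symgrad u *m N) + (grad (symgrad u *m N))^T - dnormal n (symgrad u) =
    grad (gradv (dot u N)) by [].
apply/matrixP => h l; move: (grad_symgrad_normal u h l) (grad_symgrad_normal u l h).
rewrite entryD entryN entryD [(grad _)^T h l]mxE => -> ->.
rewrite entry_dnormal [RHS]mxE entry_grad /dot.
have hess m : (N m 0 : {mpoly R[3]}) * (u m 0)^`M(h)^`M(l) = (u m 0 * N m 0)^`M(h)^`M(l).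
  by rewrite entryC mderivM mderivC mulr0 addr0 mderivM mderivC mulr0 addr0 mulrC.
have term m : N m 0 * (symgrad u h m)^`M(l) + N m 0 * (symgrad u l m)^`M(h) -
    N m 0 * (symgrad u h l)^`M(m) = (u m 0 * N m 0)^`M(h)^`M(l).
  rewrite -hess (symgrad_entry u h l) (symgrad_entry u h m) (symgrad_entry u l m).
  rewrite !mderivM !mderivC !mderivD (mderiv_comm l h (u m 0)).
  rewrite (mderiv_comm m l) (mderiv_comm m h).
  rewrite -[X in _ = _ * X]mul1r -half_two; ring.
by rewrite !sum3 !mderivD -!term; ring.
Qed.

Lemma gradvC k : gradv (k%:MP : {mpoly R[3]}) = 0.
Proof. by apply/matrixP => h l; rewrite entry_grad mderivC entry0. Qed.

Lemma grad_cst (a : 'cV[R]_3) : grad (cst a) = 0.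
Proof. by apply/matrixP => h l; rewrite mxE entryC mderivC entry0. Qed.

(** The terms in which a derivative falls on [ell] are dyads with the normal, and the
    projections annihilate them. *)
Lemma conj_hess f : mmultiple ell (Pi *m grad (gradv (ell * f)) *m Pi).
Proof.
apply/mmultipleP; exists (Pi *m grad (gradv f) *m Pi).
have gN : grad (c%:MP *: N) = 0.
  by rewrite gradM grad_cst scaler0 gradvC trmx0 mulmx0 addr0.
rewrite gradvM gradD !gradM ell_grad gN scaler0 add0r.
have -> : gradv f *m (c%:MP *: N)^T = c%:MP *: (gradv f *m N^T).
  by rewrite linearZ /= -scalemxAr.
by apply: conj_hessian; [exact: Pi_N|exact: Nt_Pi].
Qed.

Lemma symgradZ k u : symgrad (k%:MP *: u) = k%:MP *: symgrad u.
Proof. by rewrite /symgrad gradM gradvC trmx0 mulmx0 addr0 symZ. Qed.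

Lemma curl_grad_tr u : curl (grad u)^T = (grad (curlv u))^T.
Proof.
apply/matrixP => h l; rewrite [LHS]mxE !(mxE trmx_key) ![(grad u) _ _]mxE.
by rewrite [(grad _) l h]mxE entry_curl mderivB !(mderiv_comm h).
Qed.

Lemma curl_cstM k U : curl (k%:MP *: U) = k%:MP *: curl U.
Proof.
rewrite curlmM gradvC (_ : mskw 0 = 0) ?trmx0 ?mulmx0 ?addr0 //.
by apply/matrixP => h l; rewrite !mxE oppr0 !if_same.
Qed.

Lemma sym_trmx U : sym U^T = sym U.
Proof. by rewrite !symE trmxK addrC. Qed.

Lemma curl_symgrad u : curl (symgrad u) = (2^-1)%:MP *: (grad (curlv u))^T.
Proof. by rewrite /symgrad symE curl_cstM curlmD curl_grad add0r curl_grad_tr. Qed.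

(** The symmetrized curl of a conformal strain is again a strain, of half the curl; this
    reduces the third trace to the second form of a strain. *)
Lemma sym_curl_devdef u : sym (curl (devdef u)) = symgrad ((2^-1)%:MP *: curlv u).
Proof.
have -> : devdef u = symgrad u - ((3^-1)%:MP * \tr (symgrad u))%:M.
  by rewrite /devdef /dev scale_scalar_mx.
rewrite curlmB curl_scalar opprK symD sym_mskw addr0.
by rewrite curl_symgrad symZ sym_trmx symgradZ.
Qed.

Lemma second_form_strain u : mmultiple ell (second_form (symgrad (ell *: u))).
Proof.
rewrite second_form_symgrad (_ : dot (ell *: u) N = ell * dot u N); first exact: conj_hess.
by rewrite /dot mulr_sumr; apply: eq_bigr => l _; rewrite entryZ mulrA.
Qed.

Lemma second_form_scalar f : exists k, second_form (f%:M) *m J = k *: J.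
Proof.
exists (- \sum_l N l 0 * f^`M(l)).
have dn : dnormal n (f%:M) = (\sum_l N l 0 * f^`M(l))%:M.
  apply/matrixP => h l; rewrite entry_dnormal [RHS]mxE -sumrMnl; apply: eq_bigr => m _.
  have E : (f%:M : mfield R) h l = f *+ (h == l) by rewrite mxE.
  by rewrite E raddfMn /= mulrnAr.
rewrite second_formE mul_scalar_mx gradM grad_cst scaler0 add0r dn.
by apply: conj_scalar; [exact: Pi_N|exact: Nt_Pi|exact: Pi_J].
Qed.

Lemma tr2cottD U V : tr2cott n (U + V) = tr2cott n U + tr2cott n V.
Proof. by rewrite !tr2cottE second_formD mulmxDl symD. Qed.

Lemma tr3cottD U V : tr3cott n (U + V) = tr3cott n U + tr3cott n V.
Proof. by rewrite !tr3cottE curlmD symD second_formD. Qed.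

Definition traces_vanish U := [/\ mmultiple ell (tr1cott n U),
  mmultiple ell (tr2cott n U) & mmultiple ell (tr3cott n U)].

Lemma traces_devdef u : traces_vanish (devdef (ell *: u)).
Proof.
split.
- rewrite devdefM ell_grad dyadZr tr1cottD !tr1cottZ tr1_dyad scaler0 addr0.
  exact: mmultiple_refl.
- have -> : devdef (ell *: u) = symgrad (ell *: u) +
      (- ((3^-1)%:MP * \tr (symgrad (ell *: u))))%:M.
    by rewrite /devdef /dev scale_scalar_mx raddfN.
  have [k kE] := second_form_scalar (- ((3^-1)%:MP * \tr (symgrad (ell *: u)))).
  move: (symgrad _) (_%:M) kE (second_form_strain u) => A B kE A0.
  have B0 : tr2cott n B = 0 by rewrite tr2cottE kE symZ sym_mskw scaler0.
  rewrite tr2cottD B0 addr0 tr2cottE.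
  by apply: mmultiple_sym; exact: mmultiple_mulr.
- rewrite tr3cottE sym_curl_devdef curlvM ell_grad scalerDr.
  rewrite second_form_symgrad.
  have -> : dot ((2^-1)%:MP *: cross (c%:MP *: N) u + (2^-1)%:MP *: (ell *: curlv u)) N =
      ell * ((2^-1)%:MP * dot (curlv u) N).
    by rewrite crossZl /dot; apply: dot_cross_normal.
  exact: conj_hess.
Qed.

Lemma traces_cube Z : traces_vanish (ell ^+ 3 *: Z).
Proof.
split.
- rewrite tr1cottZ exprS -scalerA; exact: mmultiple_refl.
- rewrite exprS -scalerA tr2_first_order tr1cottZ expr2.
  apply: mmultipleB; first exact: mmultiple_refl.
  by apply: mmultipleZ; rewrite -scalerA; exact: mmultiple_refl.
- rewrite exprSr -scalerA; have [V ->] := tr3_second_order (ell *: Z).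
  rewrite tr1cottZ; apply: mmultipleD; first exact: mmultiple_refl.
  by apply: mmultipleZ; exact: mmultiple_refl.
Qed.

Lemma mmultiple_addl p U V : mmultiple p U -> mmultiple p (U + V) -> mmultiple p V.
Proof. by move=> Up UVp; rewrite -[V](addKr U) addrC; exact: mmultipleB. Qed.

Lemma mmultiple_unit k U : k != 0 -> mmultiple ell (k%:MP *: U) -> mmultiple ell U.
Proof.
move=> k0 /(mmultipleZ (k^-1)%:MP); rewrite scalerA -mpolyCM mulVf // mpolyC1.
by rewrite scale1r.
Qed.

(** Each trace controls one more order in [ell]: it kills the tangential part of the
    remainder, whose normal part is then absorbed in the displacement. Conversely
    conformal strains of displacements that vanish on the plane have no traces, and the
    traces involve at most two normal derivatives. *)
Lemma traces_vanishP U : U^T = U -> \tr U = 0 ->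
  traces_vanish U <-> exists u Z, U = devdef (ell *: u) + ell ^+ 3 *: Z.
Proof.
move=> US Ut; split; last first.
  move=> [u [Z ->]]; have [a1 a2 a3] := traces_devdef u; have [b1 b2 b3] := traces_cube Z.
  split; [rewrite tr1cottD|rewrite tr2cottD|rewrite tr3cottD].
  - exact: (mmultipleD a1 b1).
  - exact: (mmultipleD a2 b2).
  - exact: (mmultipleD a3 b3).
move=> [U1 U2 U3].
have [u0 [Z0 [UE Z0S Z0t]]] := absorb_dyad 0 US Ut U1.
rewrite expr0 scale1r !expr1 in UE.
have Z01 : mmultiple ell (tr1cott n Z0).
  apply: (mmultiple_unit c_neq0); have [_ d2 _] := traces_devdef u0.
  move: U2; rewrite UE tr2cottD => /(mmultiple_addl d2).
  rewrite tr2_first_order => /(mmultiple_addl (mmultiple_refl _ _)) /mmultipleN.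
  by rewrite opprK.
have [u1 [Z1 [Z0E Z1S Z1t]]] := absorb_dyad 1 Z0S Z0t Z01.
rewrite expr1 in Z0E.
have UE' : U = devdef (ell *: (u0 + ell *: u1)) + ell ^+ 2 *: Z1.
  have -> : ell *: (u0 + ell *: u1) = ell *: u0 + ell ^+ 2 *: u1.
    by rewrite scalerDr scalerA expr2.
  exact: (split_trans UE Z0E (devdefD _ _)).
have Z11 : mmultiple ell (tr1cott n Z1).
  have [_ _ d3] := traces_devdef (u0 + ell *: u1).
  have k0 : 2%:R * c * c != 0 by rewrite !mulf_neq0 // pnatr_eq0.
  apply: (mmultiple_unit k0).
  move: U3; rewrite UE' tr3cottD => /(mmultiple_addl d3).
  have [V ->] := tr3_second_order Z1 => /(mmultiple_addl (mmultiple_refl _ _)).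
  by rewrite !mpolyCM mpolyC_nat.
have [u2 [Z2 [Z1E _ _]]] := absorb_dyad 2 Z1S Z1t Z11.
exists (u0 + ell *: u1 + ell ^+ 2 *: u2), Z2.
have -> : ell *: (u0 + ell *: u1 + ell ^+ 2 *: u2) =
    ell *: (u0 + ell *: u1) + ell ^+ 3 *: u2 by rewrite scalerDr scalerA exprS.
exact: (split_trans UE' Z1E (devdefD _ _)).
Qed.

Lemma opSinvZ p U : opSinv (p *: U) = p *: opSinv U.
Proof.
have E : p *: U = opS (p *: opSinv U) by rewrite opSZ (opSinvK U).
by rewrite E (opSK (p *: opSinv U)).
Qed.

Lemma curl_pow m U : exists V, curl (ell ^+ m.+1 *: U) = ell ^+ m *: V.
Proof.
rewrite curlmM gradv_pow mskwZ linearZ /= -scalemxAr.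
exists (ell *: curl U + (m.+1%:R * c)%:MP *: (U *m J^T)).
by rewrite scalerDr !scalerA -exprSr [(_ * c)%:MP * _]mulrC.
Qed.

(** Every curl costs one factor [ell]; the last one leaves on the plane a cross product
    with the normal. *)
Lemma cott_cube_normal Z h : multiple ell (dot N (rowv (cott (ell ^+ 3 *: Z)) h)).
Proof.
rewrite /cott; have [V1 ->] := curl_pow 2 Z; rewrite opSinvZ.
have [V2 ->] := curl_pow 1 (opSinv V1); rewrite opSinvZ expr1.
move: (opSinv V2) => V.
rewrite rowv_curl rowvZ curlvM ell_grad crossZl.
exists (dot N (curlv (rowv V h))); exact: dot_normal_curl.
Qed.

End LocalTraces.

(** * Conformal Killing fields *)

Section ConformalKilling.
Variable R : realType.
Implicit Types (f g p : {mpoly R[3]}) (u w q : vfield R) (a : 'cV[R]_3) (i j k l m : 'I_3).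

Lemma multiple_unit (k : R) g f : k != 0 -> multiple g (k%:MP * f) -> multiple g f.
Proof.
move=> k0 /(multipleMl (k^-1)%:MP); rewrite mulrA -mpolyCM mulVf // mpolyC1.
by rewrite mul1r.
Qed.

Lemma multiple_deriv n g f l : multiple (g ^+ n.+1) f -> multiple (g ^+ n) f^`M(l).
Proof.
move=> [q ->]; elim: n q => [|n IH] q; first by exists (g ^+ 1 * q)^`M(l); rewrite expr0 mul1r.
rewrite (exprS g n.+1) -mulrA mderivM; apply: multipleD.
  by rewrite mulrCA; exact: multiple_refl.
by have [s ->] := IH q; rewrite mulrA -exprS; exact: multiple_refl.
Qed.

Definition dilation w : {mpoly R[3]} := (3^-1)%:MP * divv w.

Lemma strain_entry w i j : 2%:R * devdef w i j =
  (w i 0)^`M(j) + (w j 0)^`M(i) - (2%:R * dilation w) *+ (i == j).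
Proof.
rewrite devdefE entry_devsym mulrBr mulrA [2%:R * (2^-1)%:MP]mulrC half_two mul1r.
have -> : \tr (grad w) = divv w by apply: eq_bigr => l _; rewrite mxE.
rewrite ![grad w _ _]mxE; congr (_ - _).
by rewrite /dilation !mulrnAr.
Qed.

Lemma divv_dilation w : divv w = 3%:R * dilation w.
Proof. by rewrite /dilation mulrA [3%:R * _]mulrC third_three mul1r. Qed.

Definition laplacian f : {mpoly R[3]} := \sum_l f^`M(l)^`M(l).

Lemma laplacian_deriv f i : laplacian f^`M(i) = (laplacian f)^`M(i).
Proof.
rewrite /laplacian raddf_sum; apply: eq_bigr => l _ /=.
by rewrite (mderiv_comm i l f) (mderiv_comm i l).
Qed.

Lemma laplacianD f p : laplacian (f + p) = laplacian f + laplacian p.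
Proof. by rewrite /laplacian -big_split; apply: eq_bigr => l _; rewrite !mderivD. Qed.

Lemma deriv_nat n f l : (n%:R * f)^`M(l) = n%:R * f^`M(l).
Proof. by rewrite !mulr_natl mderivMn. Qed.

Lemma deriv_pick f l (c : bool) : (f *+ c)^`M(l) = f^`M(l) *+ c.
Proof. by rewrite mderivMn. Qed.

(** The first step of the prolongation: the divergence of the conformal strain isolates
    the Laplacian of [w] and the gradient of the dilation. *)
Lemma div_strain w i : 2%:R * \sum_l (devdef w i l)^`M(l) =
  laplacian (w i 0) + (dilation w)^`M(i).
Proof.
rewrite mulr_sumr.
under eq_bigr => l _ do
  rewrite -deriv_nat strain_entry mderivB mderivD deriv_pick deriv_nat.
rewrite sumrB big_split /=.
have -> : \sum_l (w l 0)^`M(i)^`M(l) = (divv w)^`M(i).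
  by rewrite /divv raddf_sum; apply: eq_bigr => l _; rewrite (mderiv_comm i l).
rewrite divv_dilation deriv_nat.
have -> : \sum_l (2%:R * (dilation w)^`M(l)) *+ (i == l) = 2%:R * (dilation w)^`M(i).
  rewrite (bigD1 i) //= eqxx big1 ?addr0 // => l /negPf li.
  by rewrite eq_sym li.
rewrite /laplacian; move: (\sum_l _) (_^`M(i)) => x y; ring.
Qed.

(** The conformal strain determines the second derivatives of the dilation, hence those
    of [w] up to the gradient of the dilation. So the equation [devdef w = 0] is of
    finite type. *)
Lemma hessian_dilation w i j : 2%:R * (dilation w)^`M(i)^`M(j) =
  2%:R * (\sum_l (devdef w i l)^`M(l)^`M(j) + \sum_l (devdef w j l)^`M(l)^`M(i))
  - 2%:R * laplacian (devdef w i j) - (2%:R * laplacian (dilation w)) *+ (i == j).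
Proof.
have D h k : 2%:R * \sum_l (devdef w h l)^`M(l)^`M(k) =
    laplacian (w h 0)^`M(k) + (dilation w)^`M(h)^`M(k).
  have := congr1 (mderiv k) (div_strain w h).
  by rewrite deriv_nat mderivD -laplacian_deriv raddf_sum.
have Lp : 2%:R * laplacian (devdef w i j) =
    laplacian (w i 0)^`M(j) + laplacian (w j 0)^`M(i)
    - (2%:R * laplacian (dilation w)) *+ (i == j).
  rewrite -laplacianD {1}/laplacian mulr_sumr.
  under eq_bigr => l _ do
    rewrite -!deriv_nat strain_entry !mderivB !deriv_pick !deriv_nat.
  by rewrite sumrB sumrMnl -mulr_sumr.
rewrite mulrDr !D Lp (mderiv_comm i j).
by move: (_ *+ (i == j)) => x; ring.
Qed.

(** The Christoffel formula: second derivatives of a displacement from the first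
    derivatives of its strain, here split into conformal strain and dilation. *)
Lemma hessian_strain w i j k : (w i 0)^`M(j)^`M(k) =
  (devdef w i j)^`M(k) + (devdef w i k)^`M(j) - (devdef w j k)^`M(i)
  + (dilation w)^`M(k) *+ (i == j) + (dilation w)^`M(j) *+ (i == k)
  - (dilation w)^`M(i) *+ (j == k).
Proof.
have S h l m : (w h 0)^`M(l)^`M(m) + (w l 0)^`M(h)^`M(m) =
    2%:R * (devdef w h l)^`M(m) + 2%:R * ((dilation w)^`M(m) *+ (h == l)).
  rewrite -(deriv_nat 2 (devdef w h l)) strain_entry mderivB mderivD deriv_pick deriv_nat.
  by rewrite [2%:R * (_ *+ _)]mulrnAr subrK.
have two_inj (x y : {mpoly R[3]}) : 2%:R * x = 2%:R * y -> x = y.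
  move=> E; have := congr1 (fun z => (2^-1)%:MP * z) E.
  by rewrite /= !mulrA half_two !mul1r.
apply: two_inj.
have := S i j k; have := S i k j; have := S j k i.
rewrite (mderiv_comm i k (w j 0)) (mderiv_comm j k (w i 0)) (mderiv_comm j i (w k 0)).
move: ((w i 0)^`M(_)^`M(_)) ((w j 0)^`M(_)^`M(_)) ((w k 0)^`M(_)^`M(_)).
move: (devdef w i j)^`M(k) (devdef w i k)^`M(j) (devdef w j k)^`M(i).
move: (_ *+ (i == j)) (_ *+ (i == k)) (_ *+ (j == k)) => p1 p2 p3 e1 e2 e3 x y z E1 E2 E3.
have -> : 2%:R * x = (x + y) + (x + z) - (y + z) by ring.
by rewrite E1 E2 E3; ring.
Qed.

(** The general conformal Killing field in Taylor form at [a]: translation, linear part,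
    and special conformal transformation. The linear part [H] has to be a rotation plus
    a dilation, that is, [H + H^T] is scalar. *)
Definition killing a (a0 kappa : 'cV[R]_3) (H : 'M[R]_3) : vfield R :=
  \col_i ((a0 i 0)%:MP + \sum_j (H i j)%:MP * shift a j
    + (\sum_j (kappa j 0)%:MP * shift a j) * shift a i
    - (2^-1)%:MP * (\sum_j shift a j * shift a j) * (kappa i 0)%:MP).

Lemma deriv_linear a (c : 'I_3 -> R) l :
  (\sum_j (c j)%:MP * shift a j)^`M(l) = (c l)%:MP.
Proof.
rewrite raddf_sum (bigD1 l) //= mderivM mderivC mul0r add0r deriv_shift eqxx mulr1.
rewrite big1 ?addr0 // => j /negPf jl.
by rewrite mderivM mderivC mul0r add0r deriv_shift eq_sym jl mulr0.
Qed.

Lemma deriv_half_square a l :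
  ((2^-1)%:MP * \sum_j shift a j * shift a j)^`M(l) = shift a l.
Proof.
rewrite mderivM mderivC mul0r add0r raddf_sum (bigD1 l) //= big1 ?addr0 => [|j /negPf jl].
  by rewrite mderivM deriv_shift eqxx mul1r mulr1 -mulr2n Defs.halfK.
by rewrite mderivM deriv_shift eq_sym jl mul0r mulr0 addr0.
Qed.

Lemma deriv_killing a a0 kappa H i j : (killing a a0 kappa H i 0)^`M(j) =
  (H i j)%:MP + (kappa j 0)%:MP * shift a i - (kappa i 0)%:MP * shift a j
  + (\sum_m (kappa m 0)%:MP * shift a m) *+ (i == j).
Proof.
rewrite [X in X^`M(j)]mxE mderivB !mderivD mderivC add0r deriv_linear.
rewrite [((\sum_m _) * _)^`M(_)]mderivM deriv_linear deriv_shift.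
rewrite [(_ * (kappa i 0)%:MP)^`M(_)]mderivM deriv_half_square mderivC mulr0 addr0.
rewrite mulr_natr [j == i]eq_sym.
by move: (_ *+ (i == j)) => x; ring.
Qed.

Lemma hessian_killing a a0 kappa H i j k : (killing a a0 kappa H i 0)^`M(j)^`M(k) =
  (kappa k 0)%:MP *+ (i == j) + (kappa j 0)%:MP *+ (i == k) - (kappa i 0)%:MP *+ (j == k).
Proof.
rewrite deriv_killing mderivD deriv_pick deriv_linear mderivB mderivD mderivC add0r.
rewrite !mderivM !mderivC !mul0r !add0r !deriv_shift !mulr_natr.
rewrite [k == i]eq_sym [k == j]eq_sym.
by move: (_ *+ _) (_ *+ _) (_ *+ _) => x y z; ring.
Qed.

Lemma devdef_killing a a0 kappa H s : H + H^T = s%:M -> devdef (killing a a0 kappa H) = 0.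
Proof.
move=> HS; set w := killing _ _ _ _.
set f := 2%:R * (\sum_m (kappa m 0)%:MP * shift a m) + s%:MP.
have wE i j : (w i 0)^`M(j) + (w j 0)^`M(i) = f *+ (i == j).
  have := congr1 (fun M : 'M_3 => M i j) HS; rewrite [LHS]mxE [H^T i j]mxE mxE => Hij.
  have {}Hij : (H i j)%:MP + (H j i)%:MP = s%:MP *+ (i == j) :> {mpoly R[3]}.
    by rewrite -mpolyCD Hij raddfMn.
  rewrite /w !deriv_killing [j == i]eq_sym /f mulrnDl -Hij.
  by case: (i == j); rewrite ?mulr1n ?mulr0n; ring.
have sg : symgrad w = ((2^-1)%:MP * f)%:M.
  by apply/matrixP => i j; rewrite symgrad_entry wE mulrnAr [RHS]mxE.
by rewrite /devdef sg /dev mxtrace_scalar scale_scalar_mx thirdK subrr.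
Qed.

Lemma vmsize_killing a a0 kappa H : vmsize_le 3 (killing a a0 kappa H).
Proof.
move=> i; rewrite mxE.
have S := msize_shift a.
have C c : (msize (c%:MP : {mpoly R[3]}) <= 1)%N := msize_leC c.
have lin (c : 'I_3 -> R) : (msize (\sum_j (c j)%:MP * shift a j) <= 2)%N.
  by apply: msize_le_sum => j _; exact: msize_leMC.
apply: msize_leB; first (apply: msize_leD; first apply: msize_leD).
- exact: leq_trans (C _) _.
- exact: leq_trans (lin _) _.
- exact: (@msize_leM _ 1 2).
- apply: (@msize_leM _ 2 1) (C _); apply: msize_leMC.
  by apply: msize_le_sum => j _; exact: (@msize_leM _ 1 2).
Qed.

Lemma multiple_const a g c : euler a g = g -> multiple g c%:MP -> c = 0.
Proof.
move=> ag [q E]; have := congr1 (ev a) E.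
by rewrite evC /ev mevalM -/(ev a g) -ag ev_euler mul0r.
Qed.

Lemma multiple_pick g f (c : bool) : multiple g f -> multiple g (f *+ c).
Proof. by case: c => // _; exact: multiple0. Qed.

(** Reading the prolongation modulo [g]: second derivatives of the dilation vanish, then
    the second derivatives of [w] are those of a Killing field, then [w] is one, each
    step by [grad_multiple]. The prolongation involves two derivatives of the strain,
    whence the cube. With [g = 0] this is the classification of Killing fields. *)
Lemma killing_of_strain a g w : euler a g = g ->
  (forall i j, multiple (g ^+ 3) (devdef w i j)) ->
  exists a0 kappa H s, H + H^T = s%:M /\ vmultiple g (w - killing a a0 kappa H).
Proof.
move=> ag E.
have E2 i j k : multiple (g ^+ 2) (devdef w i j)^`M(k) by apply: multiple_deriv.
have E1 i j k l : multiple g (devdef w i j)^`M(k)^`M(l).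
  by rewrite -[g]expr1; apply: multiple_deriv.
have lower n f : multiple (g ^+ n.+1) f -> multiple g f.
  by move=> [q ->]; rewrite exprS -mulrA; exact: multiple_refl.
set t := dilation w.
have sumE i j : multiple g (\sum_l (devdef w i l)^`M(l)^`M(j)).
  by apply: multiple_sum => l _.
have rest i j : multiple g (2%:R * t^`M(i)^`M(j) + (2%:R * laplacian t) *+ (i == j)).
  rewrite hessian_dilation subrK; apply: multipleB; apply: multipleMl.
    exact: multipleD.
  exact: multiple_sum.
(* Summing the relations [rest i i] gives [2 + 6] times the Laplacian of [t]. *)
have lapt : multiple g (laplacian t).
  apply: (@multiple_unit 8%:R); first by rewrite pnatr_eq0.
  have -> : 8%:R%:MP * laplacian t =
      \sum_i (2%:R * t^`M(i)^`M(i) + (2%:R * laplacian t) *+ (i == i)).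
    rewrite big_split /= -mulr_sumr -/(laplacian t) sum3 !eqxx !mulr1n mpolyC_nat.
    by move: (laplacian t) => x; ring.
  exact: multiple_sum.
have hess i j : multiple g t^`M(i)^`M(j).
  apply: (@multiple_unit 2%:R); first by rewrite pnatr_eq0.
  rewrite mpolyC_nat -[X in multiple g X](addrK ((2%:R * laplacian t) *+ (i == j))).
  by apply: multipleB => //; apply/multiple_pick/multipleMl.
(* The parameters of the Killing field are Taylor coefficients at [a]: [kappa] and
   [s0] of the dilation, then [H] and [a0] of [w]. *)
pose kappa : 'cV[R]_3 := \col_i ev a t^`M(i).
have kE i : multiple g (t^`M(i) - (kappa i 0)%:MP).
  by rewrite mxE; apply: grad_multiple.
set K := \sum_m (kappa m 0)%:MP * shift a m.
pose s0 := ev a (t - K).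
have s0E : multiple g (t - K - s0%:MP).
  by apply: grad_multiple => // l; rewrite mderivB deriv_linear.
pose w1 := w - killing a 0 kappa 0.
have w1E i : w1 i 0 = w i 0 - killing a 0 kappa 0 i 0 by rewrite entryD entryN.
have w1h i j k : multiple g (w1 i 0)^`M(j)^`M(k).
  rewrite w1E !mderivB hessian_killing hessian_strain.
  have -> : forall e1 e2 e3 d1 d2 d3 c1 c2 c3 : {mpoly R[3]},
      e1 + e2 - e3 + d1 *+ (i == j) + d2 *+ (i == k) - d3 *+ (j == k)
      - (c1 *+ (i == j) + c2 *+ (i == k) - c3 *+ (j == k)) =
      e1 + e2 - e3 + (d1 - c1) *+ (i == j) + (d2 - c2) *+ (i == k) - (d3 - c3) *+ (j == k).
    move=> *; rewrite !mulrnBl.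
    move: (_ *+ _) (_ *+ _) (_ *+ _) (_ *+ _) (_ *+ _) (_ *+ _) => *; ring.
  apply: multipleB; last exact: multiple_pick.
  apply: multipleD; last exact: multiple_pick.
  apply: multipleD; last exact: multiple_pick.
  apply: multipleB; last exact: lower (E2 _ _ _).
  by apply: multipleD; exact: lower (E2 _ _ _).
pose H : 'M[R]_3 := \matrix_(i, j) ev a (w1 i 0)^`M(j).
have HE i j : multiple g ((w1 i 0)^`M(j) - (H i j)%:MP).
  by rewrite [H i j]mxE; apply: grad_multiple.
pose a0 : 'cV[R]_3 := \col_i ev a (w1 i 0 - \sum_j (H i j)%:MP * shift a j).
exists a0, kappa, H, (2%:R * s0); split.
  apply/matrixP => i j; rewrite [LHS]mxE [H^T i j]mxE [RHS]mxE.
  apply/eqP; rewrite -subr_eq0; apply/eqP; apply: (multiple_const ag).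
  have strain : (w1 i 0)^`M(j) + (w1 j 0)^`M(i) =
      2%:R * devdef w i j + (2%:R * (t - K)) *+ (i == j).
    rewrite strain_entry !w1E !mderivB !deriv_killing -/K [j == i]eq_sym -/t.
    by case: (i == j); rewrite ?mulr1n ?mulr0n [(0 : 'M_3) i j]mxE [(0 : 'M_3) j i]mxE; ring.
  have -> : (H i j + H j i - (2%:R * s0) *+ (i == j))%:MP =
      2%:R * devdef w i j + (2%:R * (t - K - s0%:MP)) *+ (i == j)
      - ((w1 i 0)^`M(j) - (H i j)%:MP) - ((w1 j 0)^`M(i) - (H j i)%:MP).
    rewrite mpolyCB mpolyCD; move/eqP: strain; rewrite -subr_eq => /eqP <-.
    rewrite raddfMn /= mpolyCM mpolyC_nat.
    by case: (i == j); rewrite ?mulr1n ?mulr0n; ring.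
  apply: multipleB => //; apply: multipleB => //; apply: multipleD.
    by apply: multipleMl; apply: lower.
  by apply/multiple_pick/multipleMl.
move=> i.
have -> : (w - killing a a0 kappa H) i 0 =
    w1 i 0 - \sum_j (H i j)%:MP * shift a j - (a0 i 0)%:MP.
  rewrite w1E entryD entryN [killing a a0 kappa H i 0]mxE [killing a 0 kappa 0 i 0]mxE.
  have -> : \sum_j ((0 : 'M[R]_3) i j)%:MP * shift a j = 0.
    by rewrite big1 // => j _; rewrite mxE mpolyC0 mul0r.
  rewrite [(0 : 'cV_3) i 0]mxE mpolyC0.
  move: (\sum_j _) ((\sum_j _) * _) ((2^-1)%:MP * _ * _) => x y z; ring.
rewrite [a0 i 0]mxE; apply: grad_multiple => // j.
by rewrite mderivB deriv_linear.
Qed.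

Lemma killing_form a w : devdef w = 0 ->
  exists a0 kappa H s, H + H^T = s%:M /\ w = killing a a0 kappa H.
Proof.
move=> E; have a00 : euler a 0 = 0 by rewrite -[X in euler a X](mpolyC0 3) eulerC.
have [|a0 [kappa [H [s [HS wE]]]]] := @killing_of_strain a 0 w a00.
  by move=> i j; rewrite E entry0; exact: multiple0.
exists a0, kappa, H, s; split => //; apply/eqP; rewrite -subr_eq0; apply/eqP.
by apply/matrixP => i j; rewrite (ord1 j); have [q ->] := wE i; rewrite mul0r entry0.
Qed.

Lemma vmsize_killing_field w : devdef w = 0 -> vmsize_le 3 w.
Proof. by case/(killing_form 0) => a0 [kappa [H [s [_ ->]]]]; exact: vmsize_killing. Qed.

End ConformalKilling.

Lemma add0_eq (A : zmodType) (x y z : A) : x = y + z -> y = 0 -> x = z.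
Proof. by move=> -> ->; rewrite add0r. Qed.

(** * Gluing Killing fields over the faces *)

Section Gluing.
Variables (R : realType) (v : 'I_4 -> 'cV[R]_3).
Hypothesis vI : affinely_independent v.
Implicit Types (i j k : 'I_4) (p q r f : {mpoly R[3]}) (u w y z : vfield R).
Implicit Types (U V W Z : mfield R) (h l m : 'I_3).
Local Notation L := (bary v).
Local Notation g := (gradbary v).
Local Notation b := (bubble v).

Lemma ev_killing a a0 kappa (H : 'M[R]_3) (d : 'cV[R]_3) t h :
  ev (a + t *: d) (killing a a0 kappa H h 0) =
  a0 h 0 + t * (H *m d) h 0 + t ^+ 2 * ((\sum_l kappa l 0 * d l 0) * d h 0
    - 2^-1 * (\sum_l d l 0 ^+ 2) * kappa h 0).
Proof.
have sh l : ev (a + t *: d) (shift a l) = t * d l 0.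
  by rewrite /ev mevalB mevalXU mevalC !mxE addrAC subrr add0r.
have evS (F : 'I_3 -> {mpoly R[3]}) : ev (a + t *: d) (\sum_l F l) =
    \sum_l ev (a + t *: d) (F l) by rewrite /ev raddf_sum.
have evM p q : ev (a + t *: d) (p * q) = ev (a + t *: d) p * ev (a + t *: d) q.
  by rewrite /ev mevalM.
rewrite [killing _ _ _ _ h 0]mxE {1}/ev mevalB !mevalD -!/(ev _ _).
rewrite !evM !evS !sum3 !evM !sh !evC [(H *m d) h 0]mxE sum3; ring.
Qed.

Lemma sqnorm_edge_neq0 i j : i != j -> \sum_l (v i - v j) l 0 ^+ 2 != 0.
Proof.
move=> ij; apply/eqP => /eqP.
rewrite psumr_eq0 => [/allP d0|l _]; last exact: sqr_ge0.
have := gradbaryB i i j vI; rewrite eqxx eq_sym (negPf ij) subr0 big1 => [/eqP|l _].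
  by rewrite eq_sym oner_eq0.
by have := d0 l (mem_index_enum _); rewrite sqrf_eq0 => /eqP ->; rewrite mulr0.
Qed.

(** Along the edge the field is a quadratic polynomial in the arclength. Its
    coefficients, which vanish, kill the translation, the special conformal part and the
    dilation; what remains is a rotation about the edge. *)
Lemma killing_on_edge i j k a w : i != j -> k != i -> k != j -> a != i -> a != j -> k != a ->
  devdef w = 0 -> (forall h, ideal2 (L i) (L j) (w h 0)) ->
  exists H : 'M[R]_3, [/\ H^T = - H, H *m (v k - v a) = 0
    & w = cst H *m position (v a)].
Proof.
move=> ij ki kj ai aj ka wK w0; set d := v k - v a.
have [a0 [kappa [H [s [HS wE]]]]] := killing_form (v a) wK.
have van t h : a0 h 0 + t * (H *m d) h 0 + t ^+ 2 * ((\sum_l kappa l 0 * d l 0) * d h 0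
    - 2^-1 * (\sum_l d l 0 ^+ 2) * kappa h 0) = 0.
  have evL n : n != k -> n != a -> ev (v a + t *: d) (L n) = 0.
    move=> nk na; rewrite /ev baryE.
    have -> : \sum_l g n l 0 * (v a + t *: d) l 0 =
        \sum_l g n l 0 * v a l 0 + t * \sum_l g n l 0 * d l 0.
      by rewrite mulr_sumr -big_split; apply: eq_bigr => l _; rewrite !mxE /=; ring.
    rewrite gradbaryB // addrA -baryE bary_vtx // !(eq_sym _ n) (negPf nk) (negPf na).
    by rewrite subrr mulr0 addr0.
  rewrite -(ev_killing (v a)) -wE; have [p [q ->]] := w0 h.
  by rewrite /ev mevalD !mevalM -!/(ev _ _) !evL 1?eq_sym // !mul0r addr0.
set D := \sum_l d l 0 ^+ 2; have D0 : D != 0 by rewrite sqnorm_edge_neq0.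
set c := \sum_l kappa l 0 * d l 0.
have [A0 B0 C0] : [/\ forall h, a0 h 0 = 0, forall h, (H *m d) h 0 = 0
    & forall h, c * d h 0 - 2^-1 * D * kappa h 0 = 0].
  split=> h; have := van 0 h; have := van 1 h; have := van (-1) h; rewrite -/c -/D; lra.
(* Pair the quadratic coefficient with the direction [d] of the edge. *)
have c0 : c = 0.
  have : \sum_h d h 0 * (c * d h 0 - 2^-1 * D * kappa h 0) = 2^-1 * D * c.
    by rewrite /c /D !sum3; field.
  rewrite big1 => [/esym/eqP|h _]; last by rewrite C0 mulr0.
  by rewrite !mulf_eq0 invr_eq0 pnatr_eq0 (negPf D0) => /eqP.
have k0 h : kappa h 0 = 0.
  move/eqP: (C0 h); rewrite c0 mul0r sub0r oppr_eq0 !mulf_eq0 invr_eq0 pnatr_eq0.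
  by rewrite (negPf D0) => /eqP.
(* The linear coefficient [H d] vanishes, and [H] acts on [d] as [s / 2] modulo skew
   matrices. *)
have s0 : s = 0.
  have HSe h l : H h l + H l h = s *+ (h == l).
    by have := congr1 (fun M : 'M_3 => M h l) HS; rewrite [LHS]mxE [H^T h l]mxE mxE.
  have Hd : \sum_h d h 0 * (H *m d) h 0 = 0 by rewrite big1 // => h _; rewrite B0 mulr0.
  have : 2%:R * (\sum_h d h 0 * (H *m d) h 0) = s * D.
    have HD h : (H *m d) h 0 = \sum_l H h l * d l 0 by rewrite mxE.
    have -> : s * D = \sum_h \sum_l d h 0 * d l 0 * (H h l + H l h).
      rewrite /D mulr_sumr; apply: eq_bigr => h _; rewrite (bigD1 h) //= big1 => [|l lh].
        by rewrite HSe eqxx mulr1n; ring.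
      by rewrite HSe eq_sym (negPf lh) mulr0n mulr0.
    by rewrite !sum3 !HD !sum3; ring.
  by rewrite Hd mulr0 => /esym/eqP; rewrite mulf_eq0 (negPf D0) orbF => /eqP.
exists H; split.
- by apply/eqP; rewrite -addr_eq0 addrC HS s0 raddf0.
- by apply/matrixP => h l; rewrite (ord1 l) B0 mxE.
rewrite wE; apply/matrixP => h l; rewrite (ord1 l) [LHS]mxE [RHS]mxE.
under [RHS]eq_bigr => m _ do rewrite entryC entry_position.
have -> : \sum_j (kappa j 0)%:MP * shift (v a) j = 0.
  by apply: big1 => m _; rewrite k0 mpolyC0 mul0r.
by rewrite A0 k0 mpolyC0 mulr0 subr0 add0r mul0r addr0.
Qed.

Lemma grad_rotation a (H : 'M[R]_3) : grad (cst H *m position a) = cst H.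
Proof.
rewrite grad_cstM -[RHS]mulmx1; congr (_ *m _); apply/matrixP => h l.
by rewrite mxE entry_position deriv_shift mxE eq_sym.
Qed.

Lemma mpolyC_injective : injective (@mpolyC 3 R).
Proof. by move=> x y /(congr1 (ev 0)); rewrite !evC. Qed.

Lemma cst_eq0 (m n : nat) (A : 'M[R]_(m, n)) : cst A = 0 -> A = 0.
Proof.
move=> A0; apply/matrixP => h l; apply: mpolyC_injective.
by rewrite -entryC A0 entry0 mxE mpolyC0.
Qed.

(** The gradients of the barycentric coordinates are dual to the edges at a vertex. *)
Lemma edges_resolve_identity a :
  1%:M = \sum_k g k *m (v k - v a)^T :> 'M[R]_3.
Proof.
apply/matrixP => h l; rewrite summxE; apply: mpolyC_injective.
have := congr1 (mderiv h) (shift_bary vI a l); rewrite deriv_shift raddf_sum /=.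
rewrite [1%:M h l]mxE mpolyC_nat => ->; rewrite rmorph_sum; apply: eq_bigr => k _.
rewrite mderivM mderivC mulr0 addr0 deriv_bary -mpolyCM; congr (_%:MP).
by rewrite [RHS]mxE big_ord1 [_^T _ _]mxE.
Qed.

(** The three edges at a vertex form a basis, and the bilinear form of [Hk] vanishes on
    each pair of them: on pairs that contain its own axis, on the diagonal by skewness,
    and on the remaining pair because there the other two matrices each kill one
    argument. *)
Lemma rotations_independent i j k a (Hk Hi Hj : 'M[R]_3) :
  (forall c, [|| c == i, c == j, c == k | c == a]) ->
  Hk^T = - Hk -> Hi^T = - Hi -> Hk + Hi + Hj = 0 ->
  Hk *m (v k - v a) = 0 -> Hi *m (v i - v a) = 0 -> Hj *m (v j - v a) = 0 -> Hk = 0.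
Proof.
move=> all kS iS sum0 k0 i0 j0.
have left (H : 'M[R]_3) c : H^T = - H -> H *m (v c - v a) = 0 -> (v c - v a)^T *m H = 0.
  move=> HS H0; apply: trmx_inj; rewrite trmx_mul trmxK HS mulNmx H0 oppr0.
  by rewrite trmx0.
have HkE : Hk = - Hi - Hj.
  by move/eqP: sum0; rewrite -addrA addr_eq0 opprD => /eqP.
have zero c e : (v c - v a)^T *m Hk *m (v e - v a) = 0.
  have ij : (v i - v a)^T *m Hk *m (v j - v a) = 0.
    have -> : (v i - v a)^T *m Hk = - ((v i - v a)^T *m Hj).
      by rewrite HkE mulmxBr mulmxN (left Hi) // oppr0 sub0r.
    by rewrite mulNmx -mulmxA j0 mulmx0 oppr0.
  have ji : (v j - v a)^T *m Hk *m (v i - v a) = 0.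
    apply: trmx_inj; rewrite !trmx_mul trmxK kS trmx0 mulNmx mulmxN mulmxA ij.
    by rewrite oppr0.
  have self (w : 'cV[R]_3) : w^T *m Hk *m w = 0 :> 'M_1.
    have E : (w^T *m Hk *m w)^T = - (w^T *m Hk *m w).
      by rewrite !trmx_mul trmxK kS mulNmx mulmxN mulmxA.
    apply/matrixP => x y; rewrite (ord1 x) (ord1 y) [RHS]mxE.
    have := congr1 (fun M : 'M_1 => M 0 0) E; rewrite mxE [RHS]mxE; lra.
  have := all c; have := all e.
  case: (eqVneq e k) => [->|_]; first by rewrite -mulmxA k0 mulmx0.
  case: (eqVneq e a) => [->|_]; first by rewrite subrr mulmx0.
  case: (eqVneq c k) => [->|_]; first by rewrite left // mul0mx.
  case: (eqVneq c a) => [->|_]; first by rewrite subrr trmx0 !mul0mx.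
  rewrite !orbF => /orP[] /eqP -> /orP[] /eqP -> //.
have I2 : 1%:M = \sum_e (v e - v a) *m (g e)^T.
  rewrite -trmx1 (edges_resolve_identity a) raddf_sum; apply: eq_bigr => e _.
  by rewrite /= trmx_mul trmxK.
rewrite -[Hk]mul1mx -[LHS]mulmx1 {1}(edges_resolve_identity a) I2.
rewrite mulmx_suml mulmx_suml big1 // => c _; rewrite mulmx_sumr big1 // => e _.
by rewrite !mulmxA -(mulmxA (g c)) -(mulmxA (g c)) zero mulmx0 mul0mx.
Qed.

(** The differences around the three faces at a vertex are rotations about the three
    edges, and they add up to zero. *)
Lemma killing_agree (r : 'I_4 -> vfield R) : (forall i, devdef (r i) = 0) ->
  (forall i j, i != j -> forall h, ideal2 (L i) (L j) ((r i - r j) h 0)) ->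
  forall i j, r i = r j.
Proof.
move=> rK rE i j; case: (eqVneq i j) => [->//|ij].
have [k ki kj] := other2 i j; have [a [ai aj ak]] := other3 i j k.
have dK (c e : 'I_4) : devdef (r c - r e) = 0 by rewrite devdefB !rK subrr.
have all c : [|| c == i, c == j, c == k | c == a].
  have ijka : uniq [:: i; j; k; a].
    by rewrite /= !inE !negb_or ij ![_ == k]eq_sym ![_ == a]eq_sym ki kj ai aj ak.
  have [||_ /(_ c)] := @uniq_min_size _ _ (enum 'I_4) ijka.
  - by move=> x _; rewrite mem_enum.
  - by rewrite size_enum_ord.
  by rewrite mem_enum !inE.
have jk : j != k by rewrite eq_sym.
have ik : i != k by rewrite eq_sym.
have ka : k != a by rewrite eq_sym.
have ia : i != a by rewrite eq_sym.
have ja : j != a by rewrite eq_sym.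
have ji : j != i by rewrite eq_sym.
have [Hk [kS k0 kE]] := killing_on_edge ij ki kj ai aj ka (dK i j) (rE i j ij).
have [Hi [iS i0 iE]] := killing_on_edge jk ij ik aj ak ia (dK j k) (rE j k jk).
have [Hj [jS j0 jE]] := killing_on_edge ki jk ji ak ai ja (dK k i) (rE k i ki).
have sum0 : Hk + Hi + Hj = 0.
  apply: cst_eq0; rewrite -(grad_rotation (v a)) /cst !map_mxD !mulmxDl -!/(cst _).
  have E (x y t : vfield R) : x = r i - r j -> y = r j - r k -> t = r k - r i ->
      x + y + t = 0.
    by move=> -> -> ->; rewrite !subrKA subrr.
  rewrite (E _ _ _ (esym kE) (esym iE) (esym jE)).
  by apply/matrixP => h l; rewrite mxE !entry0 mderiv0.
have H0 := rotations_independent all kS iS sum0 k0 i0 j0.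
apply/eqP; rewrite -subr_eq0 kE H0; apply/eqP.
by rewrite /cst map_mx0 mul0mx.
Qed.

(** On each face [u] agrees with a Killing field, by [killing_of_strain]; two of them
    agree on the common edge, where both agree with [u], so there is only one. *)
Lemma glue_killing u (z : 'I_4 -> vfield R) :
  (forall i, mmultiple (L i ^+ 3) (devdef (u - L i *: z i))) ->
  exists r w : vfield R, devdef r = 0 /\ u = r + b *: w.
Proof.
move=> H.
have /choice [r rP] : forall i, exists q : vfield R, devdef q = 0 /\ vmultiple (L i) (u - q).
  move=> i; have [a ai] := other i.
  have ia : i != a by rewrite eq_sym.
  have [a0 [kappa [K [s [KS uE]]]]] := killing_of_strain (euler_bary vI ia) (H i).
  exists (killing (v a) a0 kappa K); split; first exact: devdef_killing KS.
  move=> h; have [p pE] := uE h; exists (p + z i h 0).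
  rewrite mulrDr -pE !(entryD, entryN, entryZ).
  move: (killing _ _ _ _ _ _) (L i * _) => x y; ring.
have rE i j : i != j -> forall h, ideal2 (L i) (L j) ((r i - r j) h 0).
  move=> _ h; have [p pE] := (rP i).2 h; have [q qE] := (rP j).2 h.
  exists (- p), q; rewrite mulrN -pE -qE !(entryD, entryN).
  by move: (u h 0) (r i h 0) (r j h 0) => x y t; ring.
have rr := killing_agree (fun i => (rP i).1) rE.
have [w wE] : exists w, u - r 0 = b *: w.
  apply/vmultipleP => h; apply: multiple_bubble => // i.
  by rewrite (rr 0 i); exact: (rP i).2.
by exists (r 0), w; split; [exact: (rP 0).1|rewrite -wE addrC subrK].
Qed.

(** Killing fields have degree at most two, while nonzero multiples of the bubble have
    degree at least four. *)
Lemma bubble_strain_injective u : devdef (b *: u) = 0 -> u = 0.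
Proof.
move=> /vmsize_killing_field S; apply/matrixP => h l; rewrite (ord1 l) [RHS]mxE.
apply/eqP; rewrite -msize_poly_eq0 -leqn0; apply: (@msize_bubble_div _ _ vI 0).
by apply: leq_trans (_ : 3 <= _)%N => //; have := S h; rewrite entryZ.
Qed.

Lemma cott_kernel_bubble d U : mmsize_le d.+3 U -> U^T = U -> \tr U = 0 -> cott U = 0 ->
  (forall i, exists u Z, U = devdef (L i *: u) + L i ^+ 3 *: Z) ->
  exists2 w, U = devdef (b *: w) & vmsize_le d w.
Proof.
move=> Us US Ut U0 UF.
have [u uE us] := @cott_free_devdef _ d.+1 U Us US Ut U0.
have /choice [z zP] : forall i, exists z, mmultiple (L i ^+ 3) (devdef (u - L i *: z)).
  move=> i; have [z [Z ZE]] := UF i; exists z; rewrite devdefB -uE {1}ZE addrC addKr.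
  exact: mmultiple_refl.
have [r [w [rK rE]]] := glue_killing zP.
exists w; first by rewrite uE rE; exact: (add0_eq (devdefD _ _) rK).
apply: (vmsize_bubble_div vI) => h.
have -> : (b *: w) h 0 = u h 0 - r h 0 by rewrite rE entryD addrAC subrr add0r.
apply: msize_leB; first exact: us.
exact: leq_trans (vmsize_killing_field rK h) _.
Qed.

End Gluing.

(** * The bubble complexes *)

Section Bubbles.
Variables (R : realType) (v : 'I_4 -> 'cV[R]_3).
Hypothesis vI : affinely_independent v.
Implicit Types (i j k : 'I_4) (p q r f : {mpoly R[3]}) (u w y z : vfield R).
Implicit Types (U V W Z : mfield R) (h l : 'I_3).
Local Notation L := (bary v).
Local Notation g := (gradbary v).
Local Notation b := (bubble v).

Lemma dot_double_dyad (n w : vfield R) h :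
  \sum_l (2%:R * dyad w n h l) * n l 0 =
  dot n n * w h 0 + (3^-1)%:MP * dot n w * n h 0.
Proof.
have E l : 2%:R * dyad w n h l = w h 0 * n l 0 + w l 0 * n h 0
    - 2%:R * (3^-1)%:MP * (dot n w *+ (h == l)).
  rewrite /dyad entry_devsym mulrBr mulrA [2%:R * (2^-1)%:MP]mulrC half_two mul1r.
  have -> : \tr (w *m n^T) = dot n w.
    by apply: eq_bigr => m _; rewrite mxE big_ord1 [_^T _ _]mxE mulrC.
  by rewrite ![(w *m n^T) _ _]mxE !big_ord1 ![n^T _ _]mxE !mulrA.
under eq_bigr => l _ do rewrite E.
have T : (3^-1)%:MP = 1 - 2%:R * (3^-1)%:MP :> {mpoly R[3]}.
  have := third_three R; move: ((3^-1)%:MP) => t T.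
  have -> : 1 - 2%:R * t = 1 - t * 3%:R + t by ring.
  by rewrite T subrr add0r.
have -> : dot n n * w h 0 + (3^-1)%:MP * dot n w * n h 0 =
    dot n n * w h 0 + (1 - 2%:R * (3^-1)%:MP) * dot n w * n h 0 by rewrite -T.
rewrite /dot !sum3; move: ((3^-1)%:MP) => t {T E}.
by move: h; apply: ord3_ind; rewrite !ord3_eq ?eqxx ?mulr1n ?mulr0n; ring.
Qed.

(** Apply the dyad to [n]: this gives [w] up to the normal component of [w], which a second
    pairing with [n] shows to be a multiple of [p]. *)
Lemma dyad_multiple p w (n : 'cV[R]_3) : \sum_l n l 0 ^+ 2 != 0 ->
  mmultiple p (dyad w (cst n)) -> vmultiple p w.
Proof.
move=> n0 H; set s := \sum_l n l 0 ^+ 2 in n0.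
have sE : dot (cst n) (cst n) = s%:MP.
  rewrite /dot /s rmorph_sum; apply: eq_bigr => l _.
  by rewrite entryC rmorphXn /= expr2.
have H1 h : multiple p (s%:MP * w h 0 + (3^-1)%:MP * dot (cst n) w * cst n h 0).
  rewrite -sE -dot_double_dyad; apply: multiple_sum => l _.
  by rewrite mulrC; apply: multipleMl; exact: multipleMl.
have H2 : multiple p (dot (cst n) w).
  (* The normal component is counted once by [s *: w] and a third time by the remaining
     term of [dot_double_dyad]. *)
  apply: (@multiple_unit _ (s * (4%:R / 3%:R))).
    by rewrite !mulf_neq0 ?invr_eq0 ?pnatr_eq0.
  have -> : (s * (4%:R / 3%:R))%:MP * dot (cst n) w =
      \sum_h cst n h 0 * (s%:MP * w h 0 + (3^-1)%:MP * dot (cst n) w * cst n h 0).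
    rewrite (_ : 4%:R / 3%:R = 1 + 3^-1 :> R); last by field.
    rewrite mpolyCM mpolyCD mpolyC1 -sE [in RHS]/dot !sum3 /dot !sum3; ring.
  by apply: multiple_sum => h _; exact: multipleMl.
move=> h; apply: (multiple_unit n0).
rewrite -[X in multiple p X](addrK ((3^-1)%:MP * dot (cst n) w * cst n h 0)).
by apply: multipleB => //; rewrite mulrAC; exact: multipleMl.
Qed.

Lemma gradv_exp p m : gradv (p ^+ m.+1) = (m.+1%:R * p ^+ m) *: gradv p.
Proof.
elim: m => [|m IH]; first by rewrite expr1 expr0 mulr1 scale1r.
rewrite exprS gradvM IH scalerA -scalerDl; congr (_ *: _).
by rewrite exprS -[m.+2%:R]nat1r; ring.
Qed.

Lemma devdef_exp p m w : devdef (p ^+ m.+1 *: w) =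
  p ^+ m *: (p *: devdef w + m.+1%:R *: dyad w (gradv p)).
Proof.
rewrite devdefM gradv_exp dyadZr exprSr [RHS]scalerDr !scalerA; congr (_ + _ *: _).
exact: mulrC.
Qed.

Lemma multiple_cancel p q f : p != 0 -> multiple (p * q) (p * f) -> multiple q f.
Proof. by move=> p0 [r]; rewrite -mulrA => /(mulfI p0) ->; exact: multiple_refl. Qed.

Lemma multiple_factor p q f : multiple (p * q) f -> multiple p f.
Proof. by move=> [r ->]; rewrite -mulrA; exact: multiple_refl. Qed.

(** When [devdef (b ^+ j.+1 *: w)] is divided by [b ^+ j], the term that does not contain
    [b] is a dyad of [w] with the gradient of the bubble, on each face a multiple of the
    normal. *)
Lemma strain_order (j : nat) w : mmultiple (b ^+ j.+1) (devdef (b ^+ j.+1 *: w)) ->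
  vmultiple b w.
Proof.
rewrite devdef_exp => H h; apply: multiple_bubble => // i; move: h.
apply: (dyad_multiple (sqnorm_grad_neq0 vI i)) => h l.
have {}H := H h l.
have b0 : b ^+ j != 0 by rewrite expf_neq0 // bubble_neq0.
rewrite exprSr entryZ in H; move/(multiple_cancel b0): H.
rewrite (bubbleE v i) => /multiple_factor.
rewrite -(bubbleE v i) entryD !entryZ {1}(bubbleE v i) => H.
have {}H : multiple (L i) (j.+1%:R * dyad w (gradv b) h l).
  rewrite -[X in multiple _ X](addKr (L i * coface v i * devdef w h l)) addrC.
  by apply: multipleB => //; rewrite -mulrA; exact: multiple_refl.
have {}H : multiple (L i) (dyad w (gradv b) h l).
  by apply: (@multiple_unit _ j.+1%:R); rewrite ?pnatr_eq0 // mpolyC_nat.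
apply: (face_prime_coface vI); move: H.
rewrite (grad_bubble v i) /dyad linearD /= mulmxDr devsymD entryD => H.
rewrite -[X in multiple _ X](addrK (devsym (w *m (L i *: gradv (coface v i))^T) h l)).
apply: multipleB.
  move: H; rewrite [(coface v i *: _)^T]linearZ /= -[w *m (_ *: _)]scalemxAr devsymZ entryZ.
  by [].
by rewrite linearZ /= -scalemxAr devsymZ entryZ; exact: multiple_refl.
Qed.

Lemma strain_order_exp m w : mmultiple (b ^+ m) (devdef (b *: w)) ->
  vmultiple (b ^+ m) w.
Proof.
elim: m w => [|m IH] w H; first by move=> h; exists (w h 0); rewrite expr0 mul1r.
have /IH/vmultipleP [z zE] : mmultiple (b ^+ m) (devdef (b *: w)).
  by move=> h l; have := H h l; rewrite exprSr; exact: multiple_factor.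
have /vmultipleP [y yE] : vmultiple b z.
  apply: (@strain_order m); move: H.
  by rewrite (_ : b *: w = b ^+ m.+1 *: z) // zE scalerA exprS.
apply/vmultipleP; exists y.
by rewrite zE yE scalerA exprSr.
Qed.

Definition admissible U := [/\ U^T = U, \tr U = 0 &
  forall i, exists u Z, U = devdef (L i *: u) + L i ^+ 3 *: Z].

(** The three bubble spaces of the complex are the cases [m = 0], [1] and [2], with
    [K] one more than the degree bound; the degree of the quotient by [b ^+ m] is then
    automatic. *)
Definition bubbles K m U := [/\ admissible U, mmsize_le K U & mmultiple (b ^+ m) U].

Definition div_bubbles K U := [/\ mmsize_le K U, U^T = U, \tr U = 0, div U = 0 &
  forall h, normal_free v (rowv U h)].

Lemma normal_bary i : exists c : R, [/\ \sum_l normal v i l 0 ^+ 2 = 1, c != 0 &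
  gradv (L i) = c%:MP *: cst (normal v i)].
Proof.
have [n1 _ _] := Defs.normalP i vI; set s := Num.sqrt (\sum_l g i l 0 ^+ 2).
have s0 : s != 0.
  rewrite sqrtr_eq0 -ltNge lt_neqAle eq_sym (sqnorm_grad_neq0 vI i).
  by apply: sumr_ge0 => l _; exact: sqr_ge0.
exists (- s); split => //; first by rewrite oppr_eq0.
apply/matrixP => h l; rewrite (ord1 l) gradv_bary entryZ !entryC -mpolyCM.
have -> : normal v i h 0 = - s^-1 * g i h 0 by rewrite mxE.
by rewrite mulrA mulrNN mulfV // mul1r.
Qed.

Lemma admissibleP U : U^T = U -> \tr U = 0 ->
  (forall i, exists u Z, U = devdef (L i *: u) + L i ^+ 3 *: Z) <->
  (forall i, traces_vanish (L i) (normal v i) U).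
Proof.
move=> US Ut.
have E i : traces_vanish (L i) (normal v i) U <->
    exists u Z, U = devdef (L i *: u) + L i ^+ 3 *: Z.
  have [c [n1 c0 Ln]] := normal_bary i.
  exact: (traces_vanishP n1 c0 (bary_neq0 vI i) Ln US Ut).
by split=> H i; apply/E.
Qed.

Lemma vanishes_onP i m n (U : 'M[{mpoly R[3]}]_(m, n)) :
  vanishes_on (face v i) U <-> forall (h : 'I_m) (l : 'I_n), multiple (L i) (U h l).
Proof.
split=> H.
  move=> h l; apply/(face_vanishP vI) => x /H /matrixP/(_ h l).
  by rewrite !mxE.
move=> x Fx; apply/matrixP => h l; rewrite !mxE.
by have /(face_vanishP vI)/(_ x Fx) := H h l.
Qed.

Lemma strain_bubbles K m u : vmultiple (b ^+ m.+1) u -> vmsize_le K.+1 u ->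
  bubbles K m (devdef u).
Proof.
move=> /vmultipleP [w wE] us; split.
- split; first by rewrite devdefE devsym_sym.
    by rewrite devdefE tr_devsym.
  move=> i; exists ((coface v i * b ^+ m) *: w), 0.
  by rewrite scaler0 addr0 wE scalerA mulrA -bubbleE exprS.
- exact: mmsize_devdef us.
- by rewrite wE devdef_exp; exact: mmultiple_refl.
Qed.

Lemma cott_bubbles K m U : bubbles K m U -> div_bubbles (K - 3) (cott U).
Proof.
move=> [[US Ut UF] Us _]; split.
- exact: mmsize_cott.
- exact: cott_sym.
- exact: cott_tr.
- exact: div_cott.
move=> h i; have [c [n1 c0 Ln]] := normal_bary i.
have [u [Z ->]] := UF i; rewrite cottD cott_devdef add0r -gradv_bary Ln.
have := cott_cube_normal Ln Z h; rewrite /dot => /(multipleMl c%:MP).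
rewrite mulr_sumr; congr (multiple _ _); apply: eq_bigr => l _.
by rewrite mulrA (entryZ c%:MP).
Qed.

Lemma cott_kernel K m U : (3 <= K)%N -> bubbles K m U -> cott U = 0 ->
  exists u, [/\ U = devdef u, vmultiple (b ^+ m.+1) u & vmsize_le K.+1 u].
Proof.
case: K => [|[|[|K]]] // _ [[US Ut UF] Us Um] U0.
have [w UE ws] := cott_kernel_bubble vI Us US Ut U0 UF.
exists (b *: w); split => //.
  have /vmultipleP [z zE] : vmultiple (b ^+ m) w by apply: strain_order_exp; rewrite -UE.
  by apply/vmultipleP; exists z; rewrite zE scalerA exprS.
by move=> h; rewrite entryZ; exact: (msize_bubbleM vI (ws h)).
Qed.

(** The potential of [cott_bubble_potential] is admissible: on each face its leading
    coefficient is a dyad with the normal, hence [b ^+ 2 *: devsym D] is to third order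
    the strain of a displacement vanishing there to third order. *)
Lemma cott_surjective K U : div_bubbles K.+4.+1 U ->
  exists2 V, bubbles (K + 8) 2 V & cott V = U.
Proof.
move=> [Us US Ut U0 Un].
have [D [B [w [Ds DE curlE Bt wt]]]] := cott_bubble_potential vI Us US Ut U0 Un.
exists (b ^+ 2 *: devsym D); last by rewrite -devsymZ cott_devsym.
split; last exact: mmultiple_refl.
  split; first by rewrite -devsymZ devsym_sym.
    by rewrite -devsymZ tr_devsym.
  move=> i; have [y [Z yE]] := cott_potential_face vI i curlE Bt wt.
  have Ln : gradv (L i) = 1%:MP *: cst (g i) by rewrite gradv_bary mpolyC1 scale1r.
  (* The third compensates the derivative of [L i ^+ 3]. *)
  pose y' := ((3^-1)%:MP * coface v i) *: y.
  exists (L i ^+ 2 *: y'), (coface v i *: Z - devdef y').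
  rewrite scalerA -exprS devdef_exp gradv_bary dyadZ.
  have -> : b ^+ 2 *: devsym D = (L i ^+ 2 * coface v i) *: (coface v i *: devsym D).
    by rewrite (bubbleE v i) scalerA; congr (_ *: _); ring.
  rewrite yE; move: (dyad y _) (devdef y') => A E.
  have T : 3%:R * ((3^-1)%:MP * coface v i) = coface v i.
    by rewrite mulrA [3%:R * _]mulrC third_three mul1r.
  rewrite [3%:R *: _]scalerA T; apply/matrixP => h l.
  rewrite !(entryD, entryZ, entryN); ring.
move=> h l; rewrite entryZ expr2 -mulrA (_ : (K + 8 = 4 + (4 + K))%N); last by lia.
by do 2!apply: (msize_bubbleM vI); exact: mmsize_devsym.
Qed.


Lemma degree_leE (k c : nat) p : (c <= k.+1)%N ->
  degree_le (k%:Z - c%:Z) p = (msize p <= k.+1 - c)%N.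
Proof.
rewrite leq_eqVlt => /predU1P [->|]; last first.
  by rewrite ltnS => ck; rewrite subzn // /degree_le subSn.
rewrite subnn leqn0 msize_poly_eq0 (_ : k%:Z - k.+1%:Z = Negz 0) //.
lia.
Qed.

Lemma PvecP (k c : nat) u : (c <= k.+1)%N ->
  Pvec (k%:Z - c%:Z) u <-> vmsize_le (k.+1 - c) u.
Proof. by move=> ck; split=> H l; have := H l; rewrite degree_leE. Qed.

Lemma PSTP (k c : nat) U : (c <= k.+1)%N ->
  PST (k%:Z - c%:Z) U <-> [/\ mmsize_le (k.+1 - c) U, U^T = U & \tr U = 0].
Proof.
move=> ck; split=> [[Us US Ut]|[Us US Ut]]; split=> // h l.
  by have := Us h l; rewrite degree_leE.
by rewrite degree_leE.
Qed.

Lemma BcottP (k : nat) U : Bcott v k%:Z U <-> admissible U /\ mmsize_le k.+1 U.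
Proof.
have E : PST k%:Z U <-> [/\ mmsize_le k.+1 U, U^T = U & \tr U = 0].
  by have := @PSTP k 0 U isT; rewrite subr0 subn0.
split=> [[/E [Us US Ut] UF]|[[US Ut UF] Us]].
  split=> //; split=> //; apply/(admissibleP US Ut) => i.
  by have [T1 T2 T3] := UF i; split; apply/vanishes_onP.
split; first by apply/E.
move=> i; have /(admissibleP US Ut) UF' := UF.
have [T1 T2 T3] := UF' i.
by split; apply/vanishes_onP; [exact: T1|exact: T2|exact: T3].
Qed.

Lemma scaled_bubblesP (k m : nat) U : (4 * m <= k.+1)%N ->
  scale_set (b ^+ m) (PST (k%:Z - (4 * m)%:Z) `&` [set V | Bcott v k%:Z (b ^+ m *: V)]) U <->
  bubbles k.+1 m U.
Proof.
move=> mk; split=> [[V [_ /BcottP [VA Vs]] <-]|[UA Us /mmultipleP [V UE]]].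
  by split=> //; exact: mmultiple_refl.
exists V; last by rewrite UE.
split; last by apply/BcottP; rewrite -UE.
have [US Ut _] := UA; apply/(PSTP _ mk).
have bm0 : b ^+ m != 0 by rewrite expf_neq0 // bubble_neq0.
have [VS Vt] : V^T = V /\ \tr V = 0 by apply: (sym_traceless_cancel bm0); rewrite -UE.
split=> // h l; have := Us h l; rewrite UE entryZ -{1}(subnKC mk) {mk}.
move: (_ - _)%N => d; elim: m {UE UA Us US Ut bm0} (V h l) => [|m IH] p.
  by rewrite muln0 expr0 mul1r.
rewrite exprS -mulrA mulnS -addnA => /(msize_bubble_div vI).
exact: IH.
Qed.

Lemma scaled_PvecP (k m : nat) u : (4 * m <= k.+2)%N ->
  scale_set (b ^+ m) (Pvec (k.+1%:Z - (4 * m)%:Z)) u <->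
  vmultiple (b ^+ m) u /\ vmsize_le k.+2 u.
Proof.
move=> mk; split.
  move=> [w /(PvecP _ mk) ws <-]; split; first exact: vmultiple_refl.
  move=> l; rewrite entryZ -(subnKC mk); move: (ws l); move: (_ - _)%N => d {ws}.
  elim: m {mk} (w l 0) => [|m IH] p ps; first by rewrite muln0 expr0 mul1r.
  rewrite exprS -mulrA mulnS -addnA; apply: (msize_bubbleM vI).
  exact: IH.
move=> [/vmultipleP [w wE] us]; exists w => //; apply/(PvecP _ mk) => l.
have := us l; rewrite wE entryZ -{1}(subnKC mk) {mk}.
move: (_ - _)%N => d; elim: m {wE us} (w l 0) => [|m IH] p.
  by rewrite muln0 expr0 mul1r.
rewrite exprS -mulrA mulnS -addnA => /(msize_bubble_div vI).
exact: IH.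
Qed.

Lemma BdivP (k : nat) U : (3 <= k.+1)%N ->
  (Bdiv v (k%:Z - 3%:Z) `&` kernel (@div R)) U <-> div_bubbles (k.+1 - 3) U.
Proof.
move=> k3; have normalE i h :
    multiple (L i) ((U *m cst (normal v i)) h 0) <-> multiple (L i) (dot (cst (g i)) (rowv U h)).
  have [c [_ c0 Ln]] := normal_bary i.
  rewrite -gradv_bary Ln rowv_dot_mulmx -scalemxAr entryZ.
  by split=> [|/(multiple_unit c0) //]; exact: multipleMl.
split.
  move=> [[/(PSTP _ k3) [Us US Ut] Un] U0]; split=> // h i.
  by apply/normalE; move: h 0; apply/vanishes_onP; exact: Un.
move=> [Us US Ut U0 Un]; split=> //; split; first by apply/(PSTP _ k3).
by move=> i; apply/vanishes_onP => h l; rewrite (ord1 l); apply/normalE; exact: Un.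
Qed.

(** The number [m] of extra factors of the bubble enters only at the left end, through
    [strain_order_exp]. At the right end every field of the target is already reached
    from [m = 2], the smallest of the three spaces. *)
Lemma bubbles_exact (k m : nat) (A : set (vfield R)) (B C : set (mfield R)) :
  (10 <= k)%N -> (m <= 2)%N ->
  (forall u, A u <-> vmultiple (b ^+ m.+1) u /\ vmsize_le k.+2 u) ->
  (forall U, B U <-> bubbles k.+1 m U) -> (forall U, C U <-> div_bubbles (k.+1 - 3) U) ->
  exact_sequence A (@devdef R) B (@cott R) C (@div R).
Proof.
move=> k10 m2 AE BE CE.
have dev0 : devdef (0 : vfield R) = 0.
  by apply: (@addrI _ (devdef 0)); rewrite -devdefD !addr0.
have A0 : A 0.
  by apply/AE; split=> l; rewrite entry0 ?msize0 //; exact: multiple0.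
have div0 : div (0 : mfield R) = 0.
  by have := @divmB R 0 0; rewrite !subrr.
have C0 : C 0.
  apply/CE; split=> // [h l|||h i]; rewrite ?entry0 ?msize0 ?trmx0 ?raddf0 //.
  rewrite /dot big1 => [|l _]; first exact: multiple0.
  by rewrite rowv0 entry0 mulr0.
split.
- apply/seteqP; split=> [u [/AE [/vmultipleP [w uE] _] uK]|u ->]; last by split.
  have : b *: (b ^+ m *: w) = u by rewrite scalerA -exprS.
  move=> E; rewrite /kernel /= -E in uK.
  by rewrite -E (bubble_strain_injective vI uK) scaler0.
- apply/seteqP; split=> [U [u /AE [um us] <-]|U [/BE UB UK]].
    by split; [apply/BE; exact: strain_bubbles|exact: cott_devdef].
  have k3 : (3 <= k.+1)%N by lia.
  have [u [uE um us]] := cott_kernel k3 UB UK.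
  by exists u => //; apply/AE.
- apply/seteqP; split=> [U [V /BE VB <-]|U [/CE UC _]].
    by have VC := cott_bubbles VB; split; [apply/CE|exact: div_cott].
  have kE : (k.+1 - 3 = (k - 7).+4.+1)%N by lia.
  rewrite kE in UC; have [V [VA Vs Vm] VE] := cott_surjective UC.
  exists V => //; apply/BE; split=> //; first by rewrite (_ : k.+1 = k - 7 + 8)%N //; lia.
  have bE : b ^+ 2 = b ^+ m * b ^+ (2 - m) by rewrite -exprD subnKC.
  by move=> h l; have := Vm h l; rewrite bE; exact: multiple_factor.
apply/seteqP; split=> [u [U /CE [_ _ _ U0 _] <-]|u ->]; first exact: U0.
by exists 0.
Qed.

End Bubbles.

Theorem theorem2p2 (R : realType) (k : int) (v : 'I_4 -> 'cV[R]_3) :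
  10 <= k -> affinely_independent v ->
  let b := bubble v in
  let C := Bdiv v (k - 3) `&` kernel (@div R) in
  [/\ scale_set (b ^+ 2) (B2cott v (k - 8)) `<=` scale_set b (B1cott v (k - 4)),
      scale_set b (B1cott v (k - 4)) `<=` Bcott v k,
      exact_sequence (scale_set b (Pvec (k - 3))) (@devdef R)
        (Bcott v k) (@cott R) C (@div R),
      exact_sequence (scale_set (b ^+ 2) (Pvec (k - 7))) (@devdef R)
        (scale_set b (B1cott v (k - 4))) (@cott R) C (@div R)
    & exact_sequence (scale_set (b ^+ 3) (Pvec (k - 11))) (@devdef R)
        (scale_set (b ^+ 2) (B2cott v (k - 8))) (@cott R) C (@div R)].
Proof.
case: k => [k|//] k10 vI b C; have {}k10 : (10 <= k)%N by [].
have CE U : C U <-> div_bubbles v (k.+1 - 3) U by apply: (BdivP vI); lia.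
have B0E U : Bcott v k U <-> bubbles v k.+1 0 U.
  split=> [/(BcottP vI) [UA Us]|[UA Us _]]; last exact/(BcottP vI).
  by split=> // h l; exists (U h l); rewrite mul1r.
have B1E U : scale_set b (B1cott v (k%:Z - 4)) U <-> bubbles v k.+1 1 U.
  rewrite /B1cott subrK -[b in scale_set b]expr1 -/b -(scaled_bubblesP vI); last by lia.
  by rewrite expr1.
have B2E U : scale_set (b ^+ 2) (B2cott v (k%:Z - 8)) U <-> bubbles v k.+1 2 U.
  by rewrite /B2cott subrK -(scaled_bubblesP vI) //; lia.
have A1E u : scale_set b (Pvec (k%:Z - 3)) u <-> vmultiple (b ^+ 1) u /\ vmsize_le k.+2 u.
  rewrite -[b in scale_set b]expr1 (_ : k%:Z - 3 = k.+1%:Z - (4 * 1)%:Z); last by lia.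
  by apply: (scaled_PvecP vI); lia.
have A2E u : scale_set (b ^+ 2) (Pvec (k%:Z - 7)) u <->
    vmultiple (b ^+ 2) u /\ vmsize_le k.+2 u.
  rewrite (_ : k%:Z - 7 = k.+1%:Z - (4 * 2)%:Z); last by lia.
  by apply: (scaled_PvecP vI); lia.
have A3E u : scale_set (b ^+ 3) (Pvec (k%:Z - 11)) u <->
    vmultiple (b ^+ 3) u /\ vmsize_le k.+2 u.
  rewrite (_ : k%:Z - 11 = k.+1%:Z - (4 * 3)%:Z); last by lia.
  by apply: (scaled_PvecP vI); lia.
have fewer m U : bubbles v k.+1 m.+1 U -> bubbles v k.+1 m U.
  move=> [UA Us Um]; split=> // h l.
  by have := Um h l; rewrite exprSr; exact: multiple_factor.
split.
- by move=> U /B2E /fewer /B1E.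
- by move=> U /B1E /fewer /B0E.
- exact: (bubbles_exact vI k10 _ A1E B0E CE).
- exact: (bubbles_exact vI k10 _ A2E B1E CE).
- exact: (bubbles_exact vI k10 _ A3E B2E CE).
Qed.
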